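(* For every $\mu\in\{0,1\}^N$ and $\lambda\subseteq\{1,\ldots,N\}$ such that $(\mu,\lambda)$ is admissible and $\lambda$ is column-full with respect to $\mu$, there exists an irreducible $\mathcal{H}$-submodule of $V$ with endpoint $\mu$ and shape $\lambda$. Moreover, the multiplicity with which (the isomorphism class of) such a module occurs in $V$ is \[ q^{|B_\mu|-n(\lambda\cap S_\mu)}\prod_{s\in\lambda\cap S_\mu}\left(q^{\rho(s,\mu,\lambda)}-1\right). \]
   Context: $q$ a prime power, $N\ge1$, $H$ an $N$-dimensional $\mathbb{F}_q$-space, $P$ its set of subspaces, fixed full flag $0=x_0\subsetneq\cdots\subsetneq x_N=H$ ($\dim x_i=i$). Location of $y$: $\mu\in\{0,1\}^N$ with $\dim(y\cap x_m)=\mu_1+\cdots+\mu_m$; $P_\mu$ the subspaces with location $\mu$; $\widehat m$ the $m$-th unit vector; $y$ $m$-covers $z$ if $z\subseteq y$, $\dim z=\dim y-1$ and location$(y)$=location$(z)+\widehat m$. $V=\mathbb{C}^P$; $E^*_\mu$ diagonal with $(y,y)$-entry $1$ iff $y\in P_\mu$; $(L_m)_{y,z}=1$ iff $z$ $m$-covers $y$; $R_m=L_m^T$; $\mathcal{H}$ the subalgebra of $\mathrm{Mat}_P(\mathbb{C})$ generated by all $L_m,R_m,E^*_\mu$. $\mathcal{H}$ is semisimple, so $V$ decomposes into irreducible $\mathcal{H}$-submodules; the multiplicity of an irreducible module is the number of summands isomorphic to it in such a decomposition. $S_\mu=\{s:\mu_s=0\}$, $T_\mu=\{t:\mu_t=1\}$,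 $B_\mu=\{(s,t)\in S_\mu\times T_\mu:s<t\}$, $S_\mu(m)=\{s\in S_\mu:s\le m\}$, $T_\mu(m)=\{t\in T_\mu:t\ge m\}$, $n(\pi)=\sum_{s\in\pi}|S_\mu(s)|$ for $\pi\subseteq S_\mu$, and $\rho(m,\mu,\lambda)=|\lambda\cap S_\mu(m)|+|\lambda\cap T_\mu(m)|-|\lambda|/2$. $(\mu,\lambda)$ admissible: $|\lambda\cap S_\mu|=|\lambda\cap T_\mu|=n$ and the $i$-th smallest of $\lambda\cap S_\mu$ is less than the $i$-th smallest of $\lambda\cap T_\mu$ for $1\le i\le n$; column-full: $T_\mu\subseteq\lambda$. $E_\lambda$: fix a basis $v_1,\ldots,v_N$ with $x_i=\mathrm{span}(v_1..v_i)$; for $\mu$ not all zeros/ones, each $y\in P_\mu$ has a unique matrix form $Y$ ($S_\mu\times T_\mu$ over $\mathbb{F}_q$ supported in $B_\mu$) with $\sum_{s\in S_\mu}Y_{s,t}v_s+v_t$ ($t\in T_\mu$) a basis of $y$. For such $M$ and $(s,t)\in B_\mu$, $M(s,t)$ is the submatrix on rows $\{s'\in S_\mu: s'\le s\}$ and columns $\{t'\in T_\mu:t'\ge t\}$; $s^-$/$t^+$ are predecessor/successor in $S_\mu$/$T_\mu$ ($0$/$N+1$ if none); $r^-,r^+,r^{-+}$ the ranks of $M(s^-,t),M(s,t^+),M(s^-,t^+)$ (zero when an index is $0$ or $N+1$); $\sigma(M)=\{(s,t)\in B_\mu:r^-=r^+=r^{-+}=\mathrm{rank}\,M(s,t)-1\}$;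 type of $y$ = set of indices occurring in $\sigma(Y)$ ($\emptyset$ if $\mu$ all zeros/ones). For a nontrivial additive character $\chi$: $\chi_y$ = indicator of $y$ if $\mu$ all zeros/ones, else $\chi_y(z)=\chi(\mathrm{tr}(YZ^T))$ on $P_\mu$ and $0$ elsewhere. $V_\lambda=\mathrm{span}\{\chi_y:y$ of type $\lambda\}$ for even-size $\lambda$, $V=\bigoplus V_\lambda$, $E_\lambda$ the projection onto $V_\lambda$ along the others. Endpoint/shape: an irreducible $\mathcal{H}$-submodule $W$ of $V$ has endpoint $\mu$ and shape $\lambda$ if $(\mu,\lambda)$ is admissible with $\lambda$ column-full and $W$ is generated by a nonzero vector of $E^*_\mu E_\lambda V$ (such a pair is unique for each $W$). *)

(* Defs.v *)
From HB Require Import structures.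
From mathcomp Require Import all_boot all_order all_algebra.
From mathcomp Require Import boolp reals complex.

Set Implicit Arguments.
Unset Strict Implicit.
Unset Printing Implicit Defensive.

Import Order.TTheory GRing.Theory Num.Theory.
Local Open Scope ring_scope.

(* The indices 1, ..., N are represented by 'I_N: the ordinal i stands for     *)
(* i + 1. An index m ranging over 0, ..., N (flag members) is in 'I_N.+1.     *)
(* {0,1}^N is {ffun 'I_N -> bool}.                                            *)

Section FiniteSubspaces.
Variables (F : finFieldType) (H : vectType F).
Import VectorInternalTheory.
HB.instance Definition _ := [Countable of {vspace H} by <:].
HB.instance Definition _ := [Finite of {vspace H} by <:].
End FiniteSubspaces.

Section Combinatorics.
Variable N : nat.
Implicit Types (mu : {ffun 'I_N -> bool}) (la p : {set 'I_N}).

Definition Sset mu : {set 'I_N} := [set s | ~~ mu s].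
Definition Tset mu : {set 'I_N} := [set t | mu t].

Definition Bset mu : {set 'I_N * 'I_N} :=
  [set st | [&& st.1 \in Sset mu, st.2 \in Tset mu & (st.1 < st.2)%N]].

Definition Sle mu (m : 'I_N) : {set 'I_N} := [set s in Sset mu | (s <= m)%N].
Definition Tge mu (m : 'I_N) : {set 'I_N} := [set t in Tset mu | (m <= t)%N].

Definition nstat mu p : nat := (\sum_(s in p) #|Sle mu s|)%N.

(* rho is only used for admissible (mu, la); then #|la| is even, so the       *)
(* halving is exact.                                                          *)
Definition rho (m : 'I_N) mu la : int :=
  (#|la :&: Sle mu m| + #|la :&: Tge mu m|)%N%:Z - (#|la|./2)%:Z.

(* enum lists a subset of 'I_N in increasing order, so this is the (i+1)-st   *)
(* smallest element of p.                                                     *)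
Definition nth_smallest p (i : nat) : nat := nth 0%N [seq val j | j <- enum p] i.

Definition admissible mu la : Prop :=
  exists n : nat,
    [/\ #|la :&: Sset mu| = n, #|la :&: Tset mu| = n &
        forall i : nat, (i < n)%N ->
          (nth_smallest (la :&: Sset mu) i < nth_smallest (la :&: Tset mu) i)%N].

Definition column_full mu la : Prop := Tset mu \subset la.

Definition constant_loc mu : bool := (Tset mu == set0) || (Sset mu == set0).

End Combinatorics.

Section MatrixType.
Variables (F : finFieldType) (N : nat).
Implicit Types (mu : {ffun 'I_N -> bool}) (M : 'M[F]_N).

(* An S_mu x T_mu matrix supported in B_mu is stored as an N x N matrix that  *)
(* vanishes off B_mu.                                                         *)
Definition supported mu M : bool :=
  [forall s, forall t, (M s t != 0) ==> ((s, t) \in Bset mu)].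

(* Here a and b are 1-based, with 0 <= a and b <= N + 1: the rank of the      *)
(* submatrix on rows s' <= a of S_mu and columns t' >= b of T_mu. At a = 0 or *)
(* b = N + 1 the submatrix is empty and its rank is 0.                        *)
Definition subrank mu M (a b : nat) : nat :=
  \rank (\matrix_(i < #|[set s in Sset mu | (s.+1 <= a)%N]|,
                  j < #|[set t in Tset mu | (b <= t.+1)%N]|)
           M (enum_val i) (enum_val j)).

(* 1-based predecessor in S_mu (0 if none) and successor in T_mu (N+1 if none) *)
Definition predS mu (s : 'I_N) : nat :=
  (\max_(s' in Sset mu | (s' < s)%N) s'.+1)%N.
Definition succT mu (t : 'I_N) : nat :=
  \big[minn/N.+1]_(t' in Tset mu | (t < t')%N) t'.+1.

Definition sigma mu M : {set 'I_N * 'I_N} :=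
  [set st in Bset mu |
    let r   := subrank mu M st.1.+1 st.2.+1 in
    let rm  := subrank mu M (predS mu st.1) st.2.+1 in
    let rp  := subrank mu M st.1.+1 (succT mu st.2) in
    let rmp := subrank mu M (predS mu st.1) (succT mu st.2) in
    [&& rm == rp, rp == rmp & rmp.+1 == r]].

Definition indices (A : {set 'I_N * 'I_N}) : {set 'I_N} :=
  [set i | [exists st in A, (i == st.1) || (i == st.2)]].

End MatrixType.

Section Setup.
Variables (F : finFieldType) (N : nat) (H : vectType F).
Variables (x : 'I_N.+1 -> {vspace H}) (v : N.-tuple H).

Definition full_flag : Prop :=
  (forall m : 'I_N.+1, \dim (x m) = m) /\
  (forall m m' : 'I_N.+1, (m < m')%N -> (x m <= x m')%VS /\ x m != x m').

Definition adapted_basis : Prop :=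
  basis_of fullv v /\ (forall m : 'I_N.+1, x m = <<take m v>>%VS).

Implicit Types (mu : {ffun 'I_N -> bool}) (y z : {vspace H}).

Definition is_location y mu : bool :=
  [forall m : 'I_N.+1, \dim (y :&: x m) == (\sum_(i < N | (i < m)%N) mu i)%N].

(* For a full flag the location exists and is unique; the default is unused.  *)
Definition location y : {ffun 'I_N -> bool} :=
  odflt [ffun=> false] [pick mu | is_location y mu].

Definition mcovers (m : 'I_N) y z : bool :=
  [&& (z <= y)%VS, (\dim z).+1 == \dim y &
      [forall i, location y i == (location z i + (i == m))%N :> nat]].

Definition is_matrix_form y (Y : 'M[F]_N) : bool :=
  let mu := location y in
  supported mu Y &&
  basis_of y [seq (\sum_(s in Sset mu) Y s t *: tnth v s) + tnth v t
             | t <- enum (Tset mu)].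

(* For an adapted basis the matrix form exists and is unique.                 *)
Definition matrix_form y : 'M[F]_N := odflt 0 [pick Y | is_matrix_form y Y].

Definition vtype y : {set 'I_N} :=
  if constant_loc (location y) then set0
  else indices (sigma (location y) (matrix_form y)).

Variable C : fieldType.

(* Rows and columns of matrices over P are numbered by enum_val / enum_rank.  *)
Notation nP := #|{: {vspace H}}|.
Notation V := 'cV[C]_nP.

Definition Lmx (m : 'I_N) : 'M[C]_nP :=
  \matrix_(i, j) (mcovers m (enum_val j) (enum_val i))%:R.
Definition Rmx (m : 'I_N) : 'M[C]_nP := (Lmx m)^T.
Definition Emx mu : 'M[C]_nP :=
  \matrix_(i, j) ((i == j) && (location (enum_val i) == mu))%:R.

Inductive inH : 'M[C]_nP -> Prop :=
| inH_L m : inH (Lmx m)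
| inH_R m : inH (Rmx m)
| inH_E mu : inH (Emx mu)
| inH_1 : inH 1%:M
| inH_scale a X : inH X -> inH (a *: X)
| inH_add X Y : inH X -> inH Y -> inH (X + Y)
| inH_mul X Y : inH X -> inH Y -> inH (X *m Y).

Definition Hsubmodule (W : {vspace V}) : Prop :=
  forall X, inH X -> forall w, w \in W -> X *m w \in W.

Definition Hirreducible (W : {vspace V}) : Prop :=
  [/\ Hsubmodule W, W != 0%VS &
      forall U, Hsubmodule U -> (U <= W)%VS -> U = 0%VS \/ U = W].

(* An isomorphism W -> W' is given as the restriction to W of a linear map    *)
(* defined on all of V.                                                       *)
Definition Hisomorphic (W W' : {vspace V}) : Prop :=
  exists f : 'End(V),
    [/\ (f @: W)%VS = W', (W :&: lker f)%VS = 0%VS &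
        forall X, inH X -> forall w, w \in W -> f (X *m w) = X *m f w].

Definition Hgenerated_by (W : {vspace V}) (w : V) : Prop :=
  [/\ Hsubmodule W, w \in W &
      forall U, Hsubmodule U -> w \in U -> (W <= U)%VS].

Definition irr_decomposition (k : nat) (D : 'I_k -> {vspace V}) : Prop :=
  [/\ forall i, Hirreducible (D i), directv (\sum_i D i) &
      (\sum_i D i)%VS = fullv].

Definition is_multiplicity (W : {vspace V}) (m : nat) : Prop :=
  (exists (k : nat) (D : 'I_k -> {vspace V}), irr_decomposition D) /\
  (forall (k : nat) (D : 'I_k -> {vspace V}), irr_decomposition D ->
     #|[set i | `[< Hisomorphic (D i) W >]]| = m).

Variable chi : F -> C.

Definition nontrivial_additive_character : Prop :=
  [/\ chi 0 = 1, forall a b, chi (a + b) = chi a * chi b &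
      exists a, chi a != 1].

Definition chi_vec y : V :=
  \col_i (let z := enum_val i in
          if constant_loc (location y) then (z == y)%:R
          else if location z == location y
               then chi (\tr (matrix_form y *m (matrix_form z)^T))
               else 0).

Definition Vtype (la : {set 'I_N}) : {vspace V} :=
  <<[seq chi_vec y | y <- enum [pred y | vtype y == la]]>>%VS.

(* The projection onto Vtype la along the sum of the other summands of        *)
(* V = \bigoplus_(la of even size) Vtype la.                                  *)
Definition Eproj (la : {set 'I_N}) : 'End(V) :=
  daddv_pi (Vtype la)
    (\sum_(la' : {set 'I_N} | ~~ odd #|la'| && (la' != la)) Vtype la')%VS.

Definition has_endpoint_shape (W : {vspace V}) mu (la : {set 'I_N}) : Prop :=
  [/\ admissible mu la, column_full mu la &
      exists u : V, let w := Emx mu *m Eproj la u in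
        w != 0 /\ Hgenerated_by W w].

End Setup.

(* Main.v *)
(* A subspace of location mu is encoded by its S_mu x T_mu matrix, so each cell
   P_mu is an additive group. In these coordinates R_m L_m and L_m R_m act on a
   cell as convolutions, hence the characters chi_y are joint eigenvectors; the
   eigenvalue of R_m L_m + L_m R_m at chi_y vanishes exactly when m is in the
   type of y, because m is in the type iff the ranks of the north-east corners
   (rows < k, columns >= k) of the matrix for k = m and k = m + 1 differ. So the
   projector e onto E*_mu E_la V lies in H. If la is column-full, then L_m kills
   e V and L_m R_m is scalar on it; since L_m R_n = R_n L_m for m <> n, R_m R_m = 0
   and R_m R_n is proportional to R_n R_m, the module generated by w in e V is
   spanned by words in the R's applied to w, and e X e is a scalar multiple of e
   for X in H. By semisimplicity the multiplicity is then dim e V, the number of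
   matrices supported in B_mu of type la. These are counted row by row: the number
   of fillings of the rows above k whose corner has a given row space depends
   only on the dimension of that row space. *)

(* The covering relation is not linear in the matrix coordinates: it involves products of a row
   entry and a column entry. Fourier analysis still applies because going up and back down (or down
   and back up) changes a matrix by a rank-one matrix which, after reparametrising the inner sum, no
   longer depends on the starting point. Summing the character over one of the two factors turns the
   eigenvalue into the number of solutions of an affine linear system, times a nonzero constant.
   Solvability means that a new row or column lies in the span of the old ones, whence the rank
   criterion. The eigenvalues are natural numbers, so a polynomial in the operator projects onto its
   kernel. Semisimplicity comes from closure under conjugate transposition, and an irreducible
   summand of [V] is isomorphic to the given module exactly when e does not kill it. In the count,
   the corner ranks follow a lattice path fixed by [mu] and [la]: admissibility keeps it
   nonnegative, and column-fullness makes every index of [Tset mu] a down-step, at which the old row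
   space is determined by the new one. *)
Require Import Defs.
From HB Require Import structures.
From mathcomp Require Import all_boot all_order all_algebra.
From mathcomp Require Import boolp reals complex.
From mathcomp Require Import mxabelem zify ring.

Set Implicit Arguments.
Unset Strict Implicit.
Unset Printing Implicit Defensive.

Import Order.TTheory GRing.Theory Num.Theory.
Local Open Scope ring_scope.

(** * Schubert cells *)

Section SchubertCells.
Variables (F : finFieldType) (N : nat) (H : vectType F).
Variables (x : 'I_N.+1 -> {vspace H}) (v : N.-tuple H).
Hypothesis xv : adapted_basis x v.

Implicit Types (mu nu : {ffun 'I_N -> bool}) (y z : {vspace H}) (u w : H).
Implicit Types (Y Z : 'M[F]_N).

Let v_free : free v. Proof. by case: xv => /basis_free. Qed.

Lemma coord_flag (m : 'I_N.+1) u :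
  u \in x m <-> forall i : 'I_N, (m <= i)%N -> coord v i u = 0.
Proof.
have [bv ->] := xv; split=> [|cu].
  move=> /coord_span {1}-> i mi.
  rewrite linear_sum big1 // => j _; rewrite linearZ /=.
  have jm : (j < m)%N by rewrite (leq_trans (ltn_ord j)) // geq_minl.
  have jN : (j < N)%N by rewrite (leq_trans jm) // -ltnS.
  rewrite nth_take // -[nat_of_ord j]/(nat_of_ord (Ordinal jN)) coord_free //.
  case: eqP => [/(congr1 val)/= ij|_]; last by rewrite mulr0.
  by move: jm; rewrite ltnNge ij mi.
rewrite [u](coord_basis bv) ?memvf //; apply: memv_suml => i _.
have [im|mi] := ltnP i m; last by rewrite cu // scale0r mem0v.
apply: memvZ; apply: memv_span; rewrite -(nth_take 0 im) mem_nth //.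
by rewrite size_takel // size_tuple -ltnS.
Qed.

Lemma coord_inj u w : (forall i, coord v i u = coord v i w) -> u = w.
Proof.
have [bv _] := xv; move=> cuw.
rewrite (coord_basis bv (memvf u)) (coord_basis bv (memvf w)).
by apply: eq_bigr => i _; rewrite cuw.
Qed.

Lemma coordD i u w : coord v i (u + w) = coord v i u + coord v i w.
Proof. exact: linearD. Qed.

Lemma coordZ i c u : coord v i (c *: u) = c * coord v i u.
Proof. exact: linearZ. Qed.

Lemma coordB i u w : coord v i (u - w) = coord v i u - coord v i w.
Proof. exact: linearB. Qed.

Lemma coord_tnth i j : coord v i (tnth v j) = (i == j)%:R.
Proof. by rewrite (tnth_nth 0) coord_free // eq_sym. Qed.

(** [u] is monic with leading index [i]. The location of a subspace will be its set of leading
    indices, as for the pivots of an echelon form. *)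
Definition leads (i : 'I_N) u : Prop :=
  coord v i u = 1 /\ forall j : 'I_N, (i < j)%N -> coord v j u = 0.

Lemma leads_exists u : u != 0 -> exists i (c : F), leads i (c *: u).
Proof.
move=> u0.
have [i ci] : exists i, coord v i u != 0.
  apply/existsP; apply: contraNT u0; rewrite negb_exists => /forallP c0.
  by apply/eqP/coord_inj => i; rewrite linear0; apply/eqP; rewrite -[_ == _]negbK c0.
case: (@arg_maxnP _ i (fun j => coord v j u != 0) (fun j => nat_of_ord j) ci) => j cj jmax.
exists j, (coord v j u)^-1; split; first by rewrite linearZ /= mulVf.
move=> k jk; rewrite linearZ /=; case: (eqVneq (coord v k u) 0) => [->|ck].
  by rewrite mulr0.
by move: (jmax k ck); rewrite /= leqNgt jk.
Qed.

(** Rank-nullity for the coordinate form at [m]: the kernel is the intersection with the previous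
    flag member, and the image is the whole field iff some vector of [y] leads at [m]. *)
Let lowdim y (m : 'I_N) : \dim (y :&: x (lift ord0 m)) =
  (\dim (y :&: x (widen_ord (leqnSn N) m)) + `[< exists2 u, u \in y & leads m u >])%N.
Proof.
pose f : 'Hom(H, F^o) := linfun (coord v m : H -> F^o).
have ker : (y :&: x (lift ord0 m) :&: lker f = y :&: x (widen_ord (leqnSn N) m))%VS.
  apply/vspaceP => u; rewrite !memv_cap memv_ker lfunE /= -andbA; congr (_ && _).
  apply/andP/idP => [[/coord_flag cu /eqP cm]|/coord_flag cu].
    apply/coord_flag => i; rewrite /= leq_eqVlt => /orP[/eqP mi|]; last exact: cu.
    by rewrite -(val_inj mi).
  split; last by rewrite cu.
  by apply/coord_flag => i mi; apply: cu; apply: ltnW.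
rewrite -(limg_ker_dim f (y :&: x (lift ord0 m))) ker; congr (_ + _)%N.
case: asboolP => [[u uy [cm cu]]|nu].
  apply/eqP; rewrite eqn_leq; apply/andP; split.
    by rewrite (leq_trans (dimvS (subvf _))) // dimvf /dim.
  rewrite lt0n dimv_eq0; apply/eqP => im0.
  have : f u \in (f @: (y :&: x (lift ord0 m)))%VS.
    by apply: memv_img; rewrite memv_cap uy; apply/coord_flag.
  by rewrite im0 memv0 lfunE /= cm oner_eq0.
apply/eqP; rewrite dimv_eq0 -subv0; apply/subvP => a /memv_imgP[u].
rewrite memv_cap => /andP[uy /coord_flag cu] ->; rewrite memv0 lfunE /=.
apply: contra_notT nu => cm; exists ((coord v m u)^-1 *: u); first exact: memvZ.
split=> [|j mj]; first by rewrite linearZ /= mulVf.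
by rewrite coordZ (cu j) ?mulr0 // lift0.
Qed.

Lemma is_locationP y mu :
  reflect (forall i, mu i = `[< exists2 u, u \in y & leads i u >]) (is_location x y mu).
Proof.
apply: (iffP forallP) => [lmu i|muE m].
  have /eqP := lmu (lift ord0 i); have /eqP := lmu (widen_ord (leqnSn N) i).
  rewrite lowdim => -> /=.
  have -> : (\sum_(j < N | (j < bump 0 i)%N) mu j = \sum_(j < N | (j < i)%N) mu j + mu i)%N.
    rewrite (bigD1 i) /= ?/bump ?leq0n ?add1n //= addnC; congr (_ + _)%N; apply: eq_bigl => j.
    rewrite ltnS leq_eqVlt andbC.
    by rewrite val_eqE; case: (eqVneq j i) => [->|ji] /=; rewrite ?ltnn.
  by move=> /addnI; case: (mu i); case: `[< _ >].
case: m => m mN; elim: m mN => [|m IHm] mN.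
  rewrite big_pred0 // dimv_eq0 -subv0; apply/subvP => u.
  rewrite memv_cap memv0 => /andP[_ /coord_flag cu].
  by apply/eqP/coord_inj => i; rewrite linear0 cu.
have mN' : (m < N)%N by [].
have -> : Ordinal mN = lift ord0 (Ordinal mN') by apply: val_inj; rewrite /= ?lift0.
rewrite lowdim -muE.
have -> : widen_ord (leqnSn N) (Ordinal mN') = Ordinal (ltnW mN) by apply: val_inj.
rewrite (eqP (IHm _)) [X in _ == X](bigD1 (Ordinal mN')) ?lift0 //= addnC.
apply/eqP; congr (_ + _)%N; apply: eq_bigl => j; rewrite ltnS -val_eqE /= ltn_neqAle.
by rewrite andbC.
Qed.

Lemma locationP y : is_location x y (location x y).
Proof.
rewrite /location; case: pickP => //= nol.
have := nol [ffun i => `[< exists2 u, u \in y & leads i u >]].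
by move/negbT/negP; case; apply/is_locationP => i; rewrite ffunE.
Qed.

Lemma locE y i : location x y i = `[< exists2 u, u \in y & leads i u >].
Proof. by have /is_locationP := locationP y. Qed.

Lemma dim_location y : \dim y = #|Tset (location x y)|.
Proof.
have /forallP/(_ ord_max)/eqP := locationP y.
rewrite (_ : y :&: x ord_max = y)%VS.
  move=> ->; rewrite -sum1_card big_mkcond [RHS]big_mkcond /=.
  by apply: eq_bigr => i _; rewrite ltn_ord inE; case: (location _ _ _).
apply/capv_idPl/subvP => u _; apply/coord_flag => i.
by rewrite leqNgt ltn_ord.
Qed.

Lemma Tset_subv y z :
  (y <= z)%VS -> Tset (location x y) \subset Tset (location x z).
Proof.
move=> /subvP yz; apply/subsetP => i; rewrite !inE !locE => /asboolP[u /yz uz lu].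
by apply/asboolP; exists u.
Qed.

(** A nonzero vector of [y], once normalised, leads at an index of the location and has coordinate 1
    there. Matrix forms are compared below through these coordinates alone. *)
Lemma coordT_eq0 y u :
  u \in y -> (forall t, location x y t -> coord v t u = 0) -> u = 0.
Proof.
move=> uy cu; case: (eqVneq u 0) => // /leads_exists[i [c lu]].
have yi : location x y i by rewrite locE; apply/asboolP; exists (c *: u) => //; apply: memvZ.
by case: lu; rewrite linearZ /= cu // mulr0 => /eqP; rewrite eq_sym oner_eq0.
Qed.

Definition wvec mu Y (t : 'I_N) : H :=
  \sum_(s in Sset mu) Y s t *: tnth v s + tnth v t.

Lemma coord_wvec mu Y t i :
  coord v i (wvec mu Y t) = (if mu i then 0 else Y i t) + (i == t)%:R.
Proof.
rewrite /wvec linearD linear_sum /= coord_tnth; congr (_ + _).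
case: (boolP (mu i)) => mui; last first.
  rewrite (bigD1 i) ?inE //= linearZ /= coord_tnth eqxx mulr1 big1 ?addr0 // => j /andP[_ ji].
  by rewrite linearZ /= coord_tnth eq_sym (negPf ji) mulr0.
rewrite big1 // => j; rewrite inE => muj; rewrite linearZ /= coord_tnth.
by case: eqP => [ij|]; rewrite ?mulr0 //; rewrite -ij mui in muj.
Qed.

Lemma supportedP mu Y :
  reflect (forall s t, Y s t != 0 -> [/\ mu s = false, mu t & (s < t)%N]) (supported mu Y).
Proof.
apply: (iffP forallP) => [sY s t|sY s].
  have /forallP/(_ t)/implyP h := sY s; move=> /h.
  by rewrite !inE /= => /and3P[/negPf].
apply/forallP => t; apply/implyP => /sY[ms mt st].
by rewrite !inE /= ms mt st.
Qed.

Lemma leads_wvec mu Y t : supported mu Y -> mu t -> leads t (wvec mu Y t).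
Proof.
move=> /supportedP sY mut; split; first by rewrite coord_wvec mut eqxx add0r.
move=> j tj; rewrite coord_wvec -val_eqE /= gtn_eqF // addr0.
case: (boolP (mu j)) => // _; apply/eqP/negP => /negP /sY[_ _].
by rewrite ltnNge ltnW.
Qed.

(** Membership replaces the basis condition of [is_matrix_form]: the vectors are reduced in the
    coordinates of the location, so they span by [mform_expand], and their number is the
    dimension. *)
Definition mform y Y :=
  supported (location x y) Y /\
  forall t, location x y t -> wvec (location x y) Y t \in y.

Lemma mform_expand y Y u : mform y Y -> u \in y ->
  u = \sum_(t in Tset (location x y)) coord v t u *: wvec (location x y) Y t.
Proof.
move=> [sY wY] uy; apply/eqP; rewrite -subr_eq0; apply/eqP/(@coordT_eq0 y).
  by rewrite rpredB // memv_suml // => t; rewrite inE => /wY; apply: memvZ.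
move=> t yt; rewrite linearB linear_sum /= (bigD1 t) ?inE //= linearZ /= coord_wvec yt eqxx add0r mulr1.
rewrite big1 ?addr0 ?subrr // => s /andP[_ st].
by rewrite linearZ /= coord_wvec yt add0r eq_sym (negPf st) mulr0.
Qed.

Lemma is_matrix_formP y Y : reflect (mform y Y) (is_matrix_form x v y Y).
Proof.
apply: (iffP andP) => [[sY bY]|[sY wY]].
  by split=> // t yt; apply: (basis_mem bY); apply/mapP; exists t; rewrite ?mem_enum ?inE.
split=> //; rewrite basisEdim size_map -cardE -dim_location leqnn andbT.
apply/subvP => u uy; rewrite (mform_expand (conj sY wY) uy).
apply: memv_suml => t tT; apply: memvZ; apply: memv_span; apply/mapP.
by exists t; rewrite ?mem_enum.
Qed.

Lemma mform_uniq y Y Z : mform y Y -> mform y Z -> Y = Z.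
Proof.
move=> [/supportedP sY wY] [/supportedP sZ wZ]; apply/matrixP => s t.
have [yt|nyt] := boolP (location x y t); last first.
  have [/eqP->|/sY[_]] := boolP (Y s t == 0); last by rewrite (negPf nyt).
  by have [/eqP->|/sZ[_]] := boolP (Z s t == 0); last by rewrite (negPf nyt).
have [ys|nys] := boolP (location x y s).
  have [/eqP->|/sY[]] := boolP (Y s t == 0); last by rewrite ys.
  by have [/eqP->|/sZ[]] := boolP (Z s t == 0); last by rewrite ys.
have : wvec (location x y) Y t - wvec (location x y) Z t = 0.
  apply: (@coordT_eq0 y); first by rewrite rpredB ?wY ?wZ.
  by move=> r yr; rewrite linearB /= !coord_wvec yr subrr.
move=> /(congr1 (coord v s)); rewrite linearB /= !coord_wvec (negPf nys) linear0.
by rewrite opprD addrACA subrr addr0 => /eqP; rewrite subr_eq0 => /eqP.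
Qed.

Lemma mform_exists y : exists Y, mform y Y.
Proof.
(* Gaussian elimination by induction on a bound for [t]: subtracting reduced vectors with smaller
   leading index clears the smaller coordinates of the location, and the larger ones vanish because
   [u] leads at [t]. *)
have red (n : nat) (t : 'I_N) : (t < n)%N -> location x y t ->
    exists w, [/\ w \in y, leads t w & forall r, location x y r -> coord v r w = (r == t)%:R].
  elim: n t => // n IHn t tn; rewrite locE => /asboolP[u uy [ut1 ut]].
  have /fin_all_exists[f fP] (r : 'I_N) : exists w, (r < t)%N -> location x y r ->
      [/\ w \in y, leads r w & forall k, location x y k -> coord v k w = (k == r)%:R].
    have [rt|] := ltnP r t; last by exists 0.
    have [yr|] := boolP (location x y r); last by exists 0.
    have [|w wP] := IHn r _ yr; first by rewrite (leq_trans rt).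
    by exists w.
  exists (u - \sum_(r in Tset (location x y) | (r < t)%N) coord v r u *: f r); split.
  - rewrite rpredB // memv_suml // => r; rewrite inE => /andP[yr rt].
    by apply: memvZ; case: (fP r rt yr).
  - split=> [|j tj]; rewrite linearB linear_sum /= ?ut1 ?ut // big1 ?subr0 //.
      move=> r; rewrite inE => /andP[yr rt]; rewrite linearZ /=.
      by case: (fP r rt yr) => _ [_ ->] //; rewrite mulr0.
    move=> r; rewrite inE => /andP[yr rt]; rewrite linearZ /=.
    by case: (fP r rt yr) => _ [_ ->]; rewrite ?mulr0 // (ltn_trans rt).
  - move=> k yk; rewrite linearB linear_sum /=.
    rewrite (eq_bigr (fun r => coord v r u * (k == r)%:R)); last first.
      by move=> r; rewrite inE => /andP[yr rt]; rewrite linearZ /=; case: (fP r rt yr) => _ _ ->.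
    have [kt|tk] := ltnP k t.
      rewrite (bigD1 k) ?inE ?yk //= eqxx mulr1 big1 ?addr0 ?subrr.
        by rewrite -val_eqE /= ltn_eqF.
      by move=> r /andP[_ rk]; rewrite eq_sym (negPf rk) mulr0.
    rewrite big1 ?subr0 => [|r /andP[_ rt]]; last first.
      by rewrite -val_eqE /= gtn_eqF ?mulr0 // (leq_trans rt).
    move: tk; rewrite leq_eqVlt => /orP[/eqP/val_inj<-|tk]; first by rewrite ut1 eqxx.
    by rewrite ut // -val_eqE /= gtn_eqF.
have /fin_all_exists[f fP] (t : 'I_N) : exists w, location x y t ->
    [/\ w \in y, leads t w & forall r, location x y r -> coord v r w = (r == t)%:R].
  have [yt|] := boolP (location x y t); last by exists 0.
  by have [w wP] := red N t (ltn_ord t) yt; exists w.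
pose Y := \matrix_(s, t) if ~~ location x y s && location x y t then coord v s (f t) else 0.
exists Y; split.
  apply/supportedP => s t; rewrite mxE.
  case: (boolP (location x y s)) => ys /=; first by rewrite eqxx.
  case: (boolP (location x y t)) => yt /=; last by rewrite eqxx.
  case: (fP t yt) => _ [ft1 ft] _ fst; split=> //.
  case: (ltngtP s t) => // [ts|/val_inj st]; first by rewrite ft ?eqxx in fst.
  by rewrite st yt in ys.
move=> t yt; case: (fP t yt) => fy [_ ft] fr.
rewrite (_ : wvec _ _ _ = f t) //; apply: coord_inj => i; rewrite coord_wvec mxE yt andbT.
case: (boolP (location x y i)) => yi /=; first by rewrite fr // add0r.
case: eqP => [it|_]; last by rewrite addr0.
by rewrite it yt in yi.
Qed.

Lemma matrix_formP y : mform y (matrix_form x v y).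
Proof.
rewrite /matrix_form; case: pickP => [Y /is_matrix_formP //|noY].
by have [Y /is_matrix_formP] := mform_exists y; rewrite noY.
Qed.

Lemma matrix_form_eq y Y : mform y Y -> matrix_form x v y = Y.
Proof. exact: mform_uniq (matrix_formP y). Qed.

Lemma matrix_form_supported y : supported (location x y) (matrix_form x v y).
Proof. by case: (matrix_formP y). Qed.

Definition cell_point mu Y : {vspace H} := (\sum_(t in Tset mu) <[wvec mu Y t]>)%VS.

Lemma mem_cell_point mu Y t : mu t -> wvec mu Y t \in cell_point mu Y.
Proof.
by move=> mut; apply: (subvP (sumv_sup t _ (subvv _)) _ (memv_line _)); rewrite inE.
Qed.

Lemma location_cell_point mu Y :
  supported mu Y -> location x (cell_point mu Y) = mu.
Proof.
move=> sY; apply/ffunP => i; rewrite locE.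
apply/asboolP/idP => [[u /memv_sumP[w wP ->] [ui1 ui]]|mui]; last first.
  by exists (wvec mu Y i); [apply: mem_cell_point | apply: leads_wvec].
have /fin_all_exists[c cP] t : exists c, mu t -> w t = c *: wvec mu Y t.
  have [mut|] := boolP (mu t); last by exists 0.
  have tT : t \in Tset mu by rewrite inE.
  by have /vlineP[c wc] := wP t tT; exists c.
have wE : \sum_(t in Tset mu) w t = \sum_(t in Tset mu) c t *: wvec mu Y t.
  by apply: eq_bigr => t; rewrite inE => /cP.
move: ui1 ui; rewrite {}wE => ui1 ui.
(* Outside [mu], coordinate [i] is a sum of terms [c t * Y i t] with [i < t] by the support; but
   [c t] is the coordinate of the vector at [t], which is 0 beyond its leading index. *)
apply/negPn/negP => mui; move: ui1; rewrite linear_sum big1 ?(eqP (oner_eq0 _)).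
  by move/eqP; rewrite eq_sym oner_eq0.
move=> t; rewrite inE => mut; rewrite linearZ /= coord_wvec (negPf mui).
case: eqP => [it|_]; first by rewrite it mut in mui.
rewrite addr0; have [->|/(supportedP _ _ sY)[_ _ it]] := eqVneq (Y i t) 0.
  by rewrite mulr0.
have := ui t it; rewrite linear_sum (bigD1 t) ?inE //= linearZ /= coord_wvec mut eqxx add0r mulr1.
rewrite big1 ?addr0 => [->|r /andP[_ rt]]; first by rewrite mul0r.
by rewrite linearZ /= coord_wvec mut add0r eq_sym (negPf rt) mulr0.
Qed.

Lemma matrix_form_cell_point mu Y :
  supported mu Y -> matrix_form x v (cell_point mu Y) = Y.
Proof.
move=> sY; apply: matrix_form_eq; split; rewrite location_cell_point //.
by move=> t mut; apply: mem_cell_point.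
Qed.

Lemma cell_pointK y : cell_point (location x y) (matrix_form x v y) = y.
Proof.
have yY := matrix_formP y; apply/eqP; rewrite eqEsubv; apply/andP; split.
  by apply/subv_sumP => t; rewrite inE => yt; rewrite -memvE; case: yY => _ ->.
apply/subvP => u uy; rewrite (mform_expand yY uy); apply: memv_sumr => t tT.
by rewrite memvZ // memv_line.
Qed.

Lemma big_cell (V : nmodType) mu (f : 'M[F]_N -> V) :
  \sum_(y | location x y == mu) f (matrix_form x v y) = \sum_(Y | supported mu Y) f Y.
Proof.
rewrite (reindex_onto (matrix_form x v) (cell_point mu)) /=.
  apply: eq_bigl => y; apply/eqP/andP => [<-|[sY /eqP <-]].
    by rewrite matrix_form_supported cell_pointK.
  by rewrite location_cell_point.
by move=> Y /matrix_form_cell_point.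
Qed.

(** The basis vector of [z] at [t] must be that of [y] at [t] plus [Z m t] times that of [y] at [m];
    coordinate [s] of this identity is the equation. Row [m] of [Z] and column [m] of [Y] enter only
    as parameters. *)
Definition covers (m : 'I_N) mu Y nu Z : Prop :=
  [/\ mu m, nu = [ffun i => if i == m then false else mu i] &
      forall s t, s != m -> t != m -> Z s t = Y s t + Y s m * Z m t].

Lemma mcoversP m y z :
  reflect [/\ (z <= y)%VS, m \notin Tset (location x z) &
             Tset (location x y) = m |: Tset (location x z)] (mcovers x m y z).
Proof.
apply: (iffP and3P) => [[zy _ /forallP yz]|[zy mz yE]].
  split=> //; first by have := yz m; rewrite inE eqxx; case: (location x z m);
    case: (location x y m).
  apply/setP => i; have := yz i; rewrite !inE.
  by case: (location x y i); case: (location x z i); case: (i == m).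
split=> //; first by rewrite !dim_location yE cardsU1 mz.
apply/forallP => i; have /setP/(_ i) := yE; rewrite !inE => ->.
rewrite inE in mz; case: (eqVneq i m) => [->|_]; last by rewrite addn0.
by rewrite (negPf mz).
Qed.

Lemma mcovers_coversP m y z :
  mcovers x m y z <-> covers m (location x y) (matrix_form x v y)
                               (location x z) (matrix_form x v z).
Proof.
have [sY' wY] := matrix_formP y; have [sZ' wZ] := matrix_formP z.
have zexp u (uz : u \in z) := mform_expand (matrix_formP z) uz.
have y0 := @coordT_eq0 y; have := mcoversP m y z.
have /supportedP sY := sY'; have /supportedP sZ := sZ'.
move: (location x y) (matrix_form x v y) (location x z) (matrix_form x v z) sY sZ wY wZ zexp y0 {sY' sZ'}.
move=> mu Y nu Z sY sZ wY wZ zexp y0 mcP.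
have expand t : mu m -> nu = [ffun i => if i == m then false else mu i] -> nu t -> t != m -> mu t.
  by move=> mum -> ; rewrite ffunE; case: eqP.
split=> [/mcP[/subvP zy mz yE]|[mum nuE YZ]].
  have mum : mu m by have /setP/(_ m) := yE; rewrite !inE eqxx.
  have nuE : nu = [ffun i => if i == m then false else mu i].
    apply/ffunP => i; rewrite ffunE; have /setP/(_ i) := yE; rewrite !inE .
    by case: eqP => [->|_ -> //]; move: mz; rewrite inE => /negPf.
  split=> // s t sm tm.
  have num : nu m = false by rewrite nuE ffunE eqxx.
  have nus : nu s = mu s by rewrite nuE ffunE (negPf sm).
  have nut : nu t = mu t by rewrite nuE ffunE (negPf tm).
  have Z0 i j : ~~ nu j -> Z i j = 0.
    by move=> nuj; apply/eqP/negP => /negP/sZ[_]; rewrite (negPf nuj).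
  have Y0 i j : ~~ mu j -> Y i j = 0.
    by move=> muj; apply/eqP/negP => /negP/sY[_]; rewrite (negPf muj).
  have [mut|nmut] := boolP (mu t); last by rewrite !Z0 ?nut // Y0 // mulr0 addr0.
  have [mus|nmus] := boolP (mu s).
    have Ys j : Y s j = 0 by apply/eqP/negP => /negP/sY[]; rewrite mus.
    rewrite !Ys mul0r addr0; apply/eqP/negP => /negP/sZ[].
    by rewrite nus mus.
  have wzy : wvec nu Z t \in y by apply/zy/wZ; rewrite nut.
  have : wvec nu Z t - (wvec mu Y t + Z m t *: wvec mu Y m) = 0.
    apply: y0.
      by rewrite rpredB // rpredD ?wY // memvZ ?wY.
    move=> r mur; rewrite coordB coordD coordZ !coord_wvec mur.
    rewrite !add0r nuE ffunE; have [->|rm] := eqVneq r m.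
      by rewrite eq_sym (negPf tm) addr0 mulr1 add0r subrr.
    by rewrite mur mulr0 addr0 add0r subrr.
  move=> /(congr1 (coord v s)); rewrite coordB coordD coordZ !coord_wvec linear0.
  rewrite nus (negPf nmus) (negPf sm) addr0 => /eqP; rewrite subr_eq0 addrAC.
  by move=> /eqP/addIr ->; rewrite mulrC.
apply/mcP; split; last first.
- by apply/setP => i; rewrite !inE nuE ffunE; case: eqP => [->|].
- by rewrite inE nuE ffunE eqxx.
apply/subvP => u uz; rewrite (zexp u uz).
apply: memv_suml => t; rewrite inE => nut; apply: memvZ.
have tm : t != m by apply: contraTneq nut => ->; rewrite nuE ffunE eqxx.
have mut := expand t mum nuE nut tm.
rewrite (_ : wvec nu Z t = wvec mu Y t + Z m t *: wvec mu Y m).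
  by rewrite rpredD ?wY // memvZ ?wY.
apply: coord_inj => i; rewrite coordD coordZ !coord_wvec nuE ffunE.
have [->|im] := eqVneq i m.
  by rewrite mum [m == t]eq_sym (negPf tm) /= !addr0 !add0r mulr1.
rewrite (_ : false%:R = 0) // addr0.
case: (boolP (mu i)) => mui; first by rewrite mulr0 addr0.
by rewrite YZ // addrAC [Z m t * _]mulrC.
Qed.

End SchubertCells.

(** * Relations between the covering operators *)

Section Relations.
Variables (F : finFieldType) (N : nat) (H : vectType F).
Variables (x : 'I_N.+1 -> {vspace H}) (v : N.-tuple H).
Hypothesis xv : adapted_basis x v.
Variable C : numClosedFieldType.

Implicit Types (mu nu : {ffun 'I_N -> bool}) (y z w : {vspace H}) (m n : 'I_N).

Notation T := (fun y => Tset (location x y)).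
Notation nP := #|{: {vspace H}}|.

Let mcE m y z : mcovers x m y z ->
  [/\ (z <= y)%VS, m \notin T z & T y = m |: T z].
Proof. by move/(mcoversP xv). Qed.

Let mcI m y z : (z <= y)%VS -> m \notin T z -> T y = m |: T z -> mcovers x m y z.
Proof. by move=> zy mz yE; apply/(mcoversP xv). Qed.

Let dimT := dim_location xv.
Let subT := Tset_subv xv.

Lemma mcovers_dim m y z : mcovers x m y z -> \dim y = (\dim z).+1.
Proof. by move=> /mcE[_ mz yE]; rewrite !dimT yE cardsU1 mz. Qed.

(** [y] and [z] are distinct hyperplanes of [w], since only [y] has [m] in its location; so they
    span [w] and meet in codimension one. Inclusion and cardinality then force the location of the
    meet. *)
Lemma mcovers_meet m n y z w : m != n ->
  mcovers x m w z -> mcovers x n w y ->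
  [/\ w = (y + z)%VS, mcovers x n z (y :&: z)%VS & mcovers x m y (y :&: z)%VS].
Proof.
move=> mn wz wy; have [zw mz wEz] := mcE wz; have [yw ny wEy] := mcE wy.
have dz := mcovers_dim wz; have dy := mcovers_dim wy.
have nz : n \in T z.
  by have := setU11 n (T y); rewrite -wEy wEz in_setU1 eq_sym (negPf mn).
have my : m \in T y.
  by have := setU11 m (T z); rewrite -wEz wEy in_setU1 (negPf mn).
have wE : w = (y + z)%VS.
  apply/eqP; rewrite eq_sym eqEdim subv_add yw zw /= leqNgt; apply/negP => lt.
  have : (y + z == z)%VS.
    by rewrite eq_sym eqEdim addvSr /= -ltnS -dz.
  move=> /eqP yz; have /subT/subsetP/(_ m my) : (y <= z)%VS by rewrite -yz addvSl.
  by rewrite (negPf mz).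
have dcap : (\dim (y :&: z)).+1 = \dim z.
  have := dimv_sum_cap y z; rewrite -wE dy => e; apply/eqP.
  by rewrite -(eqn_add2l (\dim y)) -e addSn addnS.
have dyz : \dim y = \dim z by apply: succn_inj; rewrite -dy -dz.
have sub1 : T (y :&: z)%VS \subset T z :\ n.
  rewrite subsetD1 (subT (capvSr _ _)) /=.
  by apply: contra ny => /(subsetP (subT (capvSl _ _))).
have sub2 : T (y :&: z)%VS \subset T y :\ m.
  rewrite subsetD1 (subT (capvSl _ _)) /=.
  by apply: contra mz => /(subsetP (subT (capvSr _ _))).
have e1 : T (y :&: z)%VS = T z :\ n.
  by apply/eqP; rewrite eqEcard sub1 /= -dimT -ltnS dcap dimT [in leqRHS](cardsD1 n) nz.
have e2 : T (y :&: z)%VS = T y :\ m.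
  by apply/eqP; rewrite eqEcard sub2 /= -dimT -ltnS dcap -dyz dimT [in leqRHS](cardsD1 m) my.
split=> //; apply: mcI; rewrite ?capvSl ?capvSr //.
- by rewrite e1 in_setD1 eqxx.
- by rewrite e1 setD1K.
- by rewrite e2 in_setD1 eqxx.
- by rewrite e2 setD1K.
Qed.

(** Dual of [mcovers_meet]. Together they match common upper covers with common lower covers, which
    is the commutation of lowering and raising operators. *)
Lemma mcovers_join m n y z u : m != n ->
  mcovers x n z u -> mcovers x m y u ->
  [/\ u = (y :&: z)%VS, mcovers x m (y + z)%VS z & mcovers x n (y + z)%VS y].
Proof.
move=> mn zu yu; have [uz nu zE] := mcE zu; have [uy mu yE] := mcE yu.
have dz := mcovers_dim zu; have dy := mcovers_dim yu.
have nz : n \in T z by rewrite zE setU11.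
have my : m \in T y by rewrite yE setU11.
have ny : n \notin T y by rewrite yE in_setU1 eq_sym (negPf mn).
have mz : m \notin T z by rewrite zE in_setU1 (negPf mn).
have uE : u = (y :&: z)%VS.
  apply/eqP; rewrite eqEdim subv_cap uy uz /= -ltnS -dy ltnNge.
  apply/negP => le.
  have /eqP yz : (y :&: z == y)%VS by rewrite eqEdim capvSl.
  by have := subsetP (subT (capvSr y z)) m; rewrite yz my (negPf mz) => /(_ isT).
have dsum : \dim (y + z) = (\dim z).+1.
  by apply: (@addIn (\dim u)); rewrite {1}uE dimv_sum_cap dy !addSn addnC.
have dyz : \dim y = \dim z by rewrite dy dz.
have e1 : T (y + z)%VS = m |: T z.
  apply/eqP; rewrite eq_sym eqEcard cardsU1 mz -!dimT dsum leqnn andbT.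
  have s1 := subT (addvSr y z).
  have s2 := subsetP (subT (addvSl y z)) m my.
  by rewrite subUset sub1set s2 s1.
have e2 : T (y + z)%VS = n |: T y.
  apply/eqP; rewrite eq_sym eqEcard cardsU1 ny -!dimT dsum dyz leqnn andbT.
  have s1 := subT (addvSl y z); have s2 := subsetP (subT (addvSr y z)) n nz.
  by rewrite subUset sub1set s2 s1.
by split=> //; apply: mcI; rewrite ?addvSl ?addvSr.
Qed.

Lemma big_enum_val_vspace (f : {vspace H} -> C) :
  \sum_(k < nP) f (enum_val k) = \sum_(y : {vspace H}) f y.
Proof. by rewrite -big_enum_val. Qed.

Lemma Lmx_Rmx_comm m n : m != n -> Lmx x C m *m Rmx x C n = Rmx x C n *m Lmx x C m.
Proof.
move=> mn; apply/matrixP => i j; rewrite !mxE.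
under eq_bigr do rewrite !mxE; under [RHS]eq_bigr do rewrite !mxE.
set z := enum_val i; set y := enum_val j.
rewrite (big_enum_val_vspace (fun w => (mcovers x m w z)%:R * (mcovers x n w y)%:R)).
rewrite (big_enum_val_vspace (fun u => (mcovers x n z u)%:R * (mcovers x m y u)%:R)).
(* Each side has at most one nonzero term: the sum of the two subspaces on the left, their
   intersection on the right. *)
rewrite (bigD1 (y + z)%VS) //= big1 ?addr0; last first.
  move=> w wE; rewrite -natrM mulnb; case: andP => // -[wz wy].
  by case: (mcovers_meet mn wz wy) wE => ->; rewrite eqxx.
rewrite (bigD1 (y :&: z)%VS) //= big1 ?addr0; last first.
  move=> u uE; rewrite -natrM mulnb; case: andP => // -[zu yu].
  by case: (mcovers_join mn zu yu) uE => ->; rewrite eqxx.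
rewrite -!natrM !mulnb; congr (nat_of_bool _)%:R; apply/andP/andP => -[h1 h2].
  by case: (mcovers_meet mn h1 h2).
by case: (mcovers_join mn h1 h2).
Qed.

Lemma Rmx_sqr m : Rmx x C m *m Rmx x C m = 0.
Proof.
apply/matrixP => i j; rewrite !mxE big1 // => k _; rewrite !mxE -natrM mulnb.
case: andP => // -[/mcE[_ mk _] /mcE[_ _ kE]].
by rewrite kE setU11 in mk.
Qed.

Definition between m n y z := [set w | mcovers x m y w && mcovers x n w z].

Lemma RmxM_entry m n i j : (Rmx x C m *m Rmx x C n) i j =
  #|between m n (enum_val i) (enum_val j)|%:R.
Proof.
rewrite mxE; under eq_bigr do rewrite !mxE.
rewrite (big_enum_val_vspace (fun w => (mcovers x m (enum_val i) w)%:R *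
  (mcovers x n w (enum_val j))%:R)).
rewrite -sum1_card natr_sum [RHS]big_mkcond /=; apply: eq_bigr => w _.
by rewrite inE -natrM mulnb; case: (_ && _).
Qed.

Lemma betweenE m n y z : (z <= y)%VS -> m != n -> m \notin T z -> n \notin T z ->
  T y = m |: (n |: T z) ->
  between m n y z = [set w | [&& (z <= w)%VS, (w <= y)%VS & T w == n |: T z]].
Proof.
move=> zy mn mz nz yE; apply/setP => w; rewrite !inE.
apply/andP/and3P => [[/mcE[wy _ _] /mcE[zw _ wE]]|[zw wy /eqP wE]].
  by split=> //; rewrite wE.
by split; apply: mcI; rewrite ?wE // in_setU1 (negPf mn).
Qed.

Lemma betweenP m n y z w : w \in between m n y z -> m != n ->
  [/\ (z <= y)%VS, m \notin T z, n \notin T z & T y = m |: (n |: T z)].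
Proof.
rewrite inE => /andP[/mcE[wy mw yE] /mcE[zw nz wE]] mn; split=> //.
- exact: subv_trans zw wy.
- by apply: contra mw => mz; rewrite wE inE mz orbT.
- by rewrite yE wE.
Qed.

Lemma leads_Tset y u i : u \in y -> leads v i u -> i \in T y.
Proof. by move=> uy lu; rewrite inE (locE xv); apply/asboolP; exists u. Qed.

(** Modulo [z], [y] is a plane spanned by [a] leading at [m] and [b] leading at [n]. As [m < n],
    only the line of [a] has leading index [m], while the q other lines, spanned by the
    [b + c *: a], lead at [n]. *)
Lemma card_between m n y z : (m < n)%N ->
  #|between m n y z| = (#|F| * #|between n m y z|)%N.
Proof.
move=> ltmn; have mn : m != n by rewrite -val_eqE ltn_eqF.
have nm : n != m by rewrite eq_sym.
have [|] := boolP [&& (z <= y)%VS, m \notin T z, n \notin T z & T y == m |: (n |: T z)]; last first.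
  move=> no; suff [-> ->] : between m n y z = set0 /\ between n m y z = set0 by rewrite !cards0 muln0.
  split; apply/setP => w; rewrite [RHS]inE; apply/negP => wb; case/negP: no.
    by have [-> -> -> ->] := betweenP wb mn; rewrite eqxx.
  by have [-> -> -> ->] := betweenP wb nm; rewrite setUCA eqxx.
move=> /and4P[zy mz nz /eqP yE].
have /asboolP[a ay la] : `[< exists2 u, u \in y & leads v m u >].
  have : m \in T y by rewrite yE setU11.
  by rewrite inE (locE xv).
have /asboolP[b by_ lb] : `[< exists2 u, u \in y & leads v n u >].
  have : n \in T y by rewrite yE !in_setU1 eqxx orbT.
  by rewrite inE (locE xv).
have dyz : \dim y = (\dim z).+2 by rewrite !dimT yE !cardsU1 in_setU1 (negPf mn) mz nz.
have line_dim u w : u \notin w -> \dim (w + <[u]>) = (\dim w).+1.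
  move=> uw; rewrite dimv_disjoint_sum ?dim_vline; last first.
    apply/eqP; rewrite -subv0; apply/subvP => k; rewrite memv_cap => /andP[kw /vlineP[c kE]].
    rewrite memv0 kE; have [->|c0] := eqVneq c 0; first by rewrite scale0r.
    by case/negP: uw; rewrite -[u](scalerK c0) -kE memvZ.
  by case: eqP uw => [->|_]; rewrite ?mem0v // addn1.
have aw w : T w = n |: T z -> a \notin w.
  move=> wE; apply/negP => aw; have := leads_Tset aw la.
  by rewrite wE in_setU1 (negPf mn) (negPf mz).
(* A hyperplane [w] of [y] that misses [a] satisfies [y = w + <[a]>], so [b] can be moved into [w]
   by a multiple of [a]. *)
have spany w : (z <= w)%VS -> (w <= y)%VS -> \dim w = (\dim z).+1 -> a \notin w ->
    exists2 k, b + k *: a \in w & True.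
  move=> zw wy dw naw; have : b \in (w + <[a]>)%VS.
    rewrite (_ : (w + <[a]>)%VS = y) //; apply/eqP.
    by rewrite eqEdim subv_add wy -memvE ay /= line_dim // dw dyz.
  case/memv_addP => u uw [_ /vlineP[k ->] ->]; exists (- k) => //.
  by rewrite scaleNr addrK.
have za : T (z + <[a]>)%VS = m |: T z.
  have naz : a \notin z by apply/negP => /leads_Tset/(_ la); apply/negP.
  apply/eqP; rewrite eq_sym eqEcard cardsU1 mz -!dimT line_dim // leqnn andbT.
  rewrite subUset sub1set (subT (addvSl _ _)) andbT (leads_Tset _ la) //.
  exact: (subvP (addvSr z _) _ (memv_line a)).
have zay : (z + <[a]> <= y)%VS by rewrite subv_add zy -memvE.
have lead_ba c : leads v n (b + c *: a).
  case: la lb => [am a0] [bn b0]; split=> [|j nj]; rewrite coordD coordZ.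
    by rewrite bn a0 // mulr0 addr0.
  by rewrite b0 // a0 ?mulr0 ?addr0 // (ltn_trans ltmn).
have yE' : T y = n |: (m |: T z) by rewrite setUCA.
have -> : #|between n m y z| = 1%N.
  rewrite betweenE // -(cards1 (z + <[a]>)%VS); congr #|pred_of_set _|.
  apply/setP => w; rewrite !inE; apply/and3P/eqP => [[zw wy /eqP wE]|->]; last first.
    by rewrite addvSl zay za.
  have dw : \dim w = (\dim z).+1 by rewrite !dimT wE cardsU1 mz.
  have aw' : a \in w.
    apply/negPn/negP => naw; have [k kw _] := spany w zw wy dw naw.
    by have := leads_Tset kw (lead_ba k); rewrite wE in_setU1 (negPf nm) (negPf nz).
  apply/eqP; rewrite eq_sym eqEdim subv_add zw -memvE aw' /= dw.
  by rewrite !dimT za cardsU1 mz.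
pose f (c : F) := (z + <[b + c *: a]>)%VS.
have fT c : [/\ (z <= f c)%VS, (f c <= y)%VS & T (f c) = n |: T z].
  have bc : b + c *: a \in f c by exact: (subvP (addvSr z _) _ (memv_line _)).
  have bz : b + c *: a \notin z.
    by apply/negP => /leads_Tset/(_ (lead_ba c)); apply/negP.
  split; first exact: addvSl.
    by rewrite subv_add zy -memvE rpredD // memvZ.
  apply/eqP; rewrite eq_sym eqEcard cardsU1 nz -!dimT line_dim // leqnn andbT.
  by rewrite subUset sub1set (subT (addvSl _ _)) andbT (leads_Tset bc (lead_ba c)).
have f_inj : injective f.
  move=> c d fcd; apply/eqP/negPn/negP => cd.
  have [_ _ /aw/negP] := fT c; apply.
  have h1 : b + c *: a \in f c by exact: (subvP (addvSr z _) _ (memv_line _)).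
  have h2 : b + d *: a \in f c by rewrite fcd -[X in X \in _]add0r memv_add ?mem0v ?memv_line.
  have := memvB h1 h2; rewrite opprD addrACA subrr add0r -scalerBl.
  by move=> /(memvZ (c - d)^-1); rewrite scalerK // subr_eq0.
rewrite muln1 betweenE // -(card_imset _ f_inj); congr #|pred_of_set _|.
apply/setP => w; rewrite inE; apply/and3P/imsetP => [[zw wy /eqP wE]|[c _ ->]]; last first.
  by have [-> -> ->] := fT c; rewrite eqxx.
have dw : \dim w = (\dim z).+1 by rewrite !dimT wE cardsU1 nz.
have [k kw _] := spany w zw wy dw (aw w wE); exists k => //.
have [_ _ fkE] := fT k.
have dfk : \dim (f k) = (\dim z).+1 by rewrite dimT fkE cardsU1 nz -dimT.
by apply/eqP; rewrite eq_sym eqEdim dw dfk leqnn andbT subv_add zw -memvE.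
Qed.

Lemma card_field_neq0 : (#|F|%:R : C) != 0.
Proof. by rewrite pnatr_eq0 -lt0n; apply/card_gt0P; exists 0. Qed.

Lemma Rmx_qcomm m n : exists c : C, Rmx x C m *m Rmx x C n = c *: (Rmx x C n *m Rmx x C m).
Proof.
case: (ltngtP m n) => [mn|nm|/val_inj->].
- exists #|F|%:R; apply/matrixP => i j.
  by rewrite RmxM_entry card_between // natrM mxE RmxM_entry.
- exists (#|F|%:R)^-1; apply/matrixP => i j; rewrite RmxM_entry mxE RmxM_entry.
  by rewrite (card_between _ _ nm) natrM mulKf ?card_field_neq0.
- by exists 1; rewrite scale1r.
Qed.

Definition unset (mu : {ffun 'I_N -> bool}) m : {ffun 'I_N -> bool} :=
  [ffun i => if i == m then false else mu i].

Lemma mcovers_location m y z : mcovers x m y z ->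
  location x y m /\ location x z = unset (location x y) m.
Proof. by move=> /(mcovers_coversP xv)[]. Qed.

Lemma Emx_Rmx mu m : Emx x C mu *m Rmx x C m =
  if mu m then Rmx x C m *m Emx x C (unset mu m) else 0.
Proof.
apply/matrixP => i j; rewrite !mxE (bigD1 i) //= !mxE eqxx /= big1 ?addr0; last first.
  by move=> k ki; rewrite !mxE eq_sym (negPf ki) mul0r.
case: (boolP (mu m)) => mum; rewrite !mxE; last first.
  rewrite -natrM mulnb; case: andP => // -[/eqP ei /mcovers_location[]].
  by rewrite ei (negPf mum).
rewrite (bigD1 j) //= !mxE eqxx /= big1 ?addr0; last first.
  by move=> k kj; rewrite !mxE (negPf kj) mulr0.
rewrite -!natrM !mulnb; congr (nat_of_bool _)%:R; rewrite andbC.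
case: (boolP (mcovers _ _ _ _)) => //= h; apply/eqP/eqP => [e|e].
  by have [_ ->] := mcovers_location h; rewrite e.
have [yi yE] := mcovers_location h; apply/ffunP => k.
have /ffunP/(_ k) := e; rewrite yE !ffunE; case: eqP => [->|//]; by rewrite yi mum.
Qed.

Lemma Emx_Rmx_col mu m (u : 'cV[C]_nP) : Emx x C mu *m (Rmx x C m *m u) =
  if mu m then Rmx x C m *m (Emx x C (unset mu m) *m u) else 0.
Proof. by rewrite mulmxA Emx_Rmx; case: ifP; rewrite ?mul0mx // mulmxA. Qed.

Lemma EmxM mu nu : Emx x C mu *m Emx x C nu = if mu == nu then Emx x C mu else 0.
Proof.
apply/matrixP => i j; rewrite !mxE (bigD1 i) //= !mxE eqxx /= big1 ?addr0; last first.
  by move=> k ki; rewrite !mxE eq_sym (negPf ki) mul0r.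
rewrite -natrM mulnb; case: (eqVneq mu nu) => [<-|mn]; rewrite !mxE.
  by congr (nat_of_bool _)%:R; case: (i == j); rewrite ?andbF // andbb.
case: (eqVneq i j) => //=; rewrite ?andbF // => _.
by case: eqP => // ->; rewrite (negPf mn).
Qed.

End Relations.

(** * Corner ranks and types *)

(** Discrete intermediate value principle, used to locate the row or column at which a rank
    difference appears. *)
Lemma nat_jump (f : nat -> bool) n : ~~ f 0%N -> f n ->
  exists2 k, (k < n)%N & ~~ f k && f k.+1.
Proof.
move=> f0; elim: n => [fn|n IHn fn]; first by rewrite fn in f0.
have [/IHn[k kn fk]|nfn] := boolP (f n); first by exists k => //; apply: ltnW.
by exists n; rewrite // nfn fn.
Qed.

Lemma bigmin_leq (I : eqType) (r : seq I) (P : pred I) (f : I -> nat) x0 i :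
  i \in r -> P i -> (\big[minn/x0]_(j <- r | P j) f j <= f i)%N.
Proof.
elim: r => // j r IHr; rewrite inE big_cons => /predU1P[<- ->|ir Pi].
  exact: geq_minl.
by case: ifP => _; rewrite ?geq_min IHr ?orbT.
Qed.

Section Below.
Variable N : nat.
Implicit Type b : 'I_N -> bool.

Definition below b (k : nat) : nat := #|[set m : 'I_N | (m < k)%N && b m]|.

Lemma below0 b : below b 0 = 0%N.
Proof. by apply: eq_card0 => i; rewrite inE. Qed.

Lemma belowS b (k : 'I_N) : below b k.+1 = (below b k + b k)%N.
Proof.
rewrite /below -!sum1_card.
rewrite [LHS](eq_bigl (fun m : 'I_N => (m < k.+1)%N && b m)); last by move=> i; rewrite inE.
rewrite [in RHS](eq_bigl (fun m : 'I_N => (m < k)%N && b m)); last by move=> i; rewrite inE.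
rewrite [LHS]big_mkcond [in RHS]big_mkcond /= [LHS](bigD1 k) //= [in RHS](bigD1 k) //=.
rewrite ltnn ltnSn /= add0n [LHS]addnC; congr addn.
apply: eq_bigr => i; rewrite -val_eqE /= => ik.
by rewrite ltnS leq_eqVlt (negPf ik).
Qed.

End Below.

(** * Ranks of north-east corners *)

Section RankLemmas.
Variables (F : fieldType).

Lemma rank_rowsub_supp p n (K : 'M[F]_(p, n)) (A : {set 'I_p}) :
  (forall i, i \notin A -> row i K = 0) ->
  \rank (rowsub (@enum_val _ (mem A)) K) = \rank K.
Proof.
move=> KA; apply: eqmx_rank; apply/andP; split; apply/row_subP => i.
  by rewrite row_rowsub row_sub.
have [iA|/KA ->] := boolP (i \in A); last by rewrite sub0mx.
by rewrite -(enum_rankK_in iA iA) -row_rowsub row_sub.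
Qed.

(** Allows the submatrices in [subrank], whose sizes vary, to be replaced by matrices of fixed size
    padded with zeros. *)
Lemma rank_mxsub_supp p n (K : 'M[F]_(p, n)) (A : {set 'I_p}) (B : {set 'I_n}) :
  (forall i j, K i j != 0 -> i \in A /\ j \in B) ->
  \rank (\matrix_(i < #|A|, j < #|B|) K (enum_val i) (enum_val j)) = \rank K.
Proof.
move=> KAB.
rewrite (_ : \matrix_(i, j) _ = rowsub (@enum_val _ (mem A)) (colsub (@enum_val _ (mem B)) K)).
  rewrite rank_rowsub_supp.
    rewrite -mxrank_tr (_ : (colsub _ K)^T = rowsub (@enum_val _ (mem B)) K^T); last first.
      by apply/matrixP => i j; rewrite !mxE.
    rewrite rank_rowsub_supp ?mxrank_tr // => i iB.
    apply/rowP => j; rewrite !mxE; apply/eqP/negP => /negP/KAB[_].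
    by rewrite (negPf iB).
  move=> i iA; apply/rowP => j; rewrite !mxE; apply/eqP/negP => /negP/KAB[].
  by rewrite (negPf iA).
by apply/matrixP => i j; rewrite !mxE.
Qed.

(** Converts the rank criterion for the type into solvability of a linear system: [B] is [A] with
    its zero row [i] filled in, so its row space contains that of [A], and equal ranks mean equal
    spaces. *)
Lemma rank_addrow p n (A B : 'M[F]_(p, n)) i :
  (forall k, k != i -> row k B = row k A) -> row i A = 0 ->
  (\rank B == \rank A) = (row i B <= A)%MS.
Proof.
move=> BA Ai.
have AB : (A <= B)%MS.
  apply/row_subP => k; have [->|/BA <-] := eqVneq k i; last exact: row_sub.
  by rewrite Ai sub0mx.
rewrite eq_sym (mxrank_leqif_sup AB); apply/idP/idP => [|Bi].
  exact/submx_trans/row_sub.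
by apply/row_subP => k; have [->//|/BA ->] := eqVneq k i; apply: row_sub.
Qed.

Definition corner N (a b : nat) (M : 'M[F]_N) : 'M[F]_N :=
  \matrix_(i, j) if (i < a)%N && (b <= j)%N then M i j else 0.

Definition rk N a b (M : 'M[F]_N) : nat := \rank (corner a b M).

Section Mask.
Variable N : nat.
Implicit Types (M : 'M[F]_N).

Definition Prow a : 'M[F]_N := diag_mx (\row_i ((i < a)%N)%:R).
Definition Pcol b : 'M[F]_N := diag_mx (\row_i ((b <= i)%N)%:R).

Lemma cornerE a b M : corner a b M = Prow a *m M *m Pcol b.
Proof.
apply/matrixP => i j; rewrite mul_mx_diag mxE [RHS]mxE mul_diag_mx !mxE.
by case: (i < a)%N; case: (b <= j)%N; rewrite ?mul1r ?mulr1 ?mul0r ?mulr0.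
Qed.

Lemma corner_mulr a b b' M : (b <= b')%N -> corner a b M *m Pcol b' = corner a b' M.
Proof.
move=> bb; apply/matrixP => i j; rewrite mul_mx_diag !mxE.
have [bj|jb] := leqP b' j; last by rewrite mulr0 andbF.
by rewrite mulr1 (leq_trans bb).
Qed.

Lemma corner_mull a a' b M : (a <= a')%N -> Prow a *m corner a' b M = corner a b M.
Proof.
move=> aa; apply/matrixP => i j; rewrite mul_diag_mx !mxE.
have [ia|ai] := ltnP i a; last by rewrite mul0r.
by rewrite mul1r (leq_trans ia).
Qed.

(** Frobenius inequality for row mask, corner and column mask: the rank gained from extra rows can
    only grow when columns are added. *)
Lemma rk_submod a a' b b' M : (a <= a')%N -> (b <= b')%N ->
  (rk a b M + rk a' b' M <= rk a' b M + rk a b' M)%N.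
Proof.
move=> aa bb; have := mxrank_Frobenius (Prow a) (corner a' b M) (Pcol b').
by rewrite corner_mull // !corner_mulr.
Qed.

Lemma rk_mono a a' b b' M : (a <= a')%N -> (b' <= b)%N -> (rk a b M <= rk a' b' M)%N.
Proof.
move=> aa bb; rewrite /rk -(corner_mull _ _ aa) -(corner_mulr _ _ bb).
by rewrite (leq_trans (mxrankM_maxr _ _)) // mxrankM_maxl.
Qed.

Lemma rk_rowS a b M : (rk a.+1 b M <= (rk a b M).+1)%N.
Proof.
have [aN|Na] := ltnP a N; last first.
  rewrite (_ : rk a.+1 b M = rk a b M) //; congr (\rank _); apply/matrixP => i j.
  by rewrite !mxE !(leq_trans (ltn_ord i)) // ltnW.
rewrite /rk (_ : corner a.+1 b M = corner a b M + delta_mx (Ordinal aN) 0 *m row (Ordinal aN) (corner a.+1 b M)).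
  apply: leq_trans (mxrank_add _ _) _; rewrite -[leqRHS]addn1 leq_add2l.
  by rewrite (leq_trans (mxrankM_maxr _ _)) // rank_leq_row.
apply/matrixP => i j; rewrite !mxE big_ord1 !mxE eqxx andbT -val_eqE /= ltnS.
case: (ltngtP i a) => [ia|ia|ia] /=; rewrite ?mul0r ?addr0 // add0r mul1r ltnSn /=.
by rewrite (_ : Ordinal aN = i) //; apply: val_inj.
Qed.

Lemma rk_colS a b M : (rk a b M <= (rk a b.+1 M).+1)%N.
Proof.
have [bN|Nb] := ltnP b N; last first.
  rewrite (_ : rk a b M = rk a b.+1 M) //; congr (\rank _); apply/matrixP => i j.
  rewrite !mxE ![(_ <= j)%N]leqNgt !(leq_trans (ltn_ord j)) //.
  by rewrite (leq_trans Nb).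
rewrite /rk (_ : corner a b M = corner a b.+1 M + col (Ordinal bN) (corner a b M) *m delta_mx 0 (Ordinal bN)).
  apply: leq_trans (mxrank_add _ _) _; rewrite -[leqRHS]addn1 leq_add2l.
  by rewrite (leq_trans (mxrankM_maxl _ _)) // rank_leq_col.
apply/matrixP => i j; rewrite !mxE big_ord1 !mxE eqxx /= -val_eqE /=.
case: (ltngtP b j) => [bj|jb|bj]; rewrite ?mulr0 ?addr0 ?andbF ?add0r // mulr1 ?bj ?leqnn.
by rewrite (_ : Ordinal bN = j) //; apply: val_inj.
Qed.

Lemma rk_row0 b M : rk 0 b M = 0%N.
Proof.
by apply/eqP; rewrite mxrank_eq0; apply/eqP/matrixP => i j; rewrite !mxE.
Qed.

Lemma rk_colN a b M : (N <= b)%N -> rk a b M = 0%N.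
Proof.
move=> Nb; apply/eqP; rewrite mxrank_eq0; apply/eqP/matrixP => i j; rewrite !mxE.
by rewrite [(b <= j)%N]leqNgt (leq_trans (ltn_ord j)) // andbF.
Qed.

End Mask.
End RankLemmas.

(** * Types as rank jumps along the diagonal *)

Section Types.
Variables (F : finFieldType) (N : nat).
Variables (mu : {ffun 'I_N -> bool}) (M : 'M[F]_N).
Hypothesis sM : supported mu M.

Lemma supported_nz s t : M s t != 0 -> [/\ ~~ mu s, mu t & (s < t)%N].
Proof.
have /forallP/(_ s)/forallP/(_ t)/implyP := sM.
by move=> h /h; rewrite !inE /= => /and3P[].
Qed.

Lemma supported_eq0 s t : [|| mu s, ~~ mu t | (t <= s)%N] -> M s t = 0.
Proof.
move=> h; apply/eqP/negP => /negP/supported_nz[ms mt st].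
by move: h; rewrite (negPf ms) mt leqNgt st.
Qed.

Lemma rk_row_Tset (s : 'I_N) b : mu s -> rk s.+1 b M = rk s b M.
Proof.
move=> mus; congr (\rank _); apply/matrixP => i j; rewrite !mxE ltnS leq_eqVlt.
have [->|] := eqVneq i s; rewrite ?eqxx ?ltnn /=.
  by case: ifP => // _; rewrite supported_eq0 // mus.
by rewrite -val_eqE => /negPf ->.
Qed.

Lemma rk_col_Sset a (t : 'I_N) : ~~ mu t -> rk a t M = rk a t.+1 M.
Proof.
move=> mut; congr (\rank _); apply/matrixP => i j; rewrite !mxE [(t <= j)%N]leq_eqVlt.
have [->|] := eqVneq j t; rewrite ?eqxx ?ltnn /= ?andbF.
  by case: ifP => // _; rewrite supported_eq0 // mut orbT.
by rewrite eq_sym -val_eqE => /negPf ->.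
Qed.

(** [subrank] numbers rows and columns from 1 and [rk] from 0: the row bound becomes strict and the
    column bound drops by one. *)
Lemma subrankE a b : subrank mu M a b.+1 = rk a b M.
Proof.
rewrite /subrank /rk -[RHS](@rank_mxsub_supp _ _ _ _ [set s in Sset mu | (s < a)%N]
  [set t in Tset mu | (b <= t)%N]).
  congr (\rank _); apply/matrixP => i j; rewrite !mxE.
  by have := enum_valP i; have := enum_valP j; rewrite !inE ltnS => /andP[_ ->] /andP[_ ->].
move=> i j; rewrite mxE; case: (ltnP i a) => /= ia; last by rewrite eqxx.
case: (leqP b j) => bj; last by rewrite eqxx.
by move=> /supported_nz[mi mj _]; rewrite !inE mi mj ia bj.
Qed.

Lemma subrank_predS (s : 'I_N) b : subrank mu M (predS mu s) b = subrank mu M s b.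
Proof.
rewrite /subrank (_ : [set _ in _ | (_ <= predS mu s)%N] = [set s' in Sset mu | (s' < s)%N]) //.
apply/setP => s'; rewrite !inE; case: (boolP (mu s')) => //= ms'; apply/idP/idP => h.
  by rewrite (leq_trans h) //; apply/bigmax_leqP => k /andP[_].
by apply: (@leq_bigmax_cond _ (fun k => (k \in Sset mu) && (k < s)%N) (fun k => k.+1));
  rewrite inE ms'.
Qed.

Lemma subrank_succT a (t : 'I_N) : subrank mu M a (succT mu t) = subrank mu M a t.+2.
Proof.
rewrite /subrank (_ : [set _ in _ | (succT mu t <= _)%N] = [set t' in Tset mu | (t.+1 < t'.+1)%N]) //.
apply/setP => t'; rewrite !inE; case: (boolP (mu t')) => //= mt'; apply/idP/idP => h.
  rewrite (leq_trans _ h) // /succT; elim/big_ind: _ => [|p q hp hq|k /andP[_]].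
  - by rewrite !ltnS.
  - by rewrite leq_min hp.
  - by rewrite ltnS.
by apply: (@bigmin_leq _ _ _ (fun k : 'I_N => k.+1)); rewrite ?mem_index_enum ?inE ?mt'.
Qed.

Lemma sigmaE (s t : 'I_N) : ((s, t) \in sigma mu M) =
  [&& ~~ mu s, mu t, (s < t)%N, rk s t M == rk s.+1 t.+1 M,
      rk s.+1 t.+1 M == rk s t.+1 M & (rk s t.+1 M).+1 == rk s.+1 t M].
Proof.
rewrite inE [X in _ && X]/= !subrank_predS !subrank_succT !subrankE.
by rewrite !inE /= -!andbA.
Qed.

(** The rank gained by column [t] on the first [a] rows is 0 or 1, starts at 0 and never decreases
    with [a], by [rk_submod]. It is 1 at [a = t] iff it jumps at some row [s < t], and a jump is
    what the rank equations of [sigma] describe. *)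
Lemma sigma_colP (t : 'I_N) : mu t ->
  reflect (exists s, (s, t) \in sigma mu M) (rk t t M != rk t t.+1 M).
Proof.
move=> mut; apply: (iffP idP) => [ft|[s]]; last first.
  rewrite sigmaE => /and5P[_ _ st _ /andP[/eqP e' /eqP e]].
  have := rk_submod M st (leqnSn t); lia.
have [||s st /andP[fs fs1]] := @nat_jump (fun a => rk a t M != rk a t.+1 M) t; rewrite ?rk_row0 //.
have sN : (s < N)%N by rewrite (ltn_trans st).
have nms : ~~ mu (Ordinal sN).
  by apply: contraNN fs => /rk_row_Tset h; move: fs1; rewrite !(h _).
exists (Ordinal sN); rewrite sigmaE nms mut st /=.
have := rk_mono M (leqnn s) (leqnSn t); have := rk_mono M (leqnn s.+1) (leqnSn t).
have := rk_colS s.+1 t M; have := rk_rowS s t M.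
have := rk_mono M (leqnSn s) (leqnn t.+1); move: fs fs1; rewrite negbK; lia.
Qed.

Lemma sigma_rowP (s : 'I_N) : ~~ mu s ->
  reflect (exists t, (s, t) \in sigma mu M) (rk s.+1 s.+1 M != rk s s.+1 M).
Proof.
move=> nmus; apply: (iffP idP) => [fs|[t]]; last first.
  rewrite sigmaE => /and5P[_ _ st /eqP e1 /andP[/eqP e2 /eqP e3]].
  have := rk_submod M (leqnSn s) st; lia.
(* Columns are added from the right, so that [k = 0] is the empty corner. *)
pose f k := rk s.+1 (N - k) M != rk s (N - k) M.
have [||k kN /andP[fk fk1]] := @nat_jump f (N - s.+1).
- by rewrite /f subn0 !rk_colN.
- by rewrite /f subKn.
have tN : (N - k.+1 < N)%N by have := ltn_ord s; lia.
have tE : (N - k = (N - k.+1).+1)%N by lia.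
have mut : mu (Ordinal tN).
  apply: contraNT fk => /rk_col_Sset h; move: fk1; rewrite /f tE.
  by have := h s; have := h s.+1; rewrite /= => -> ->.
exists (Ordinal tN); rewrite sigmaE nmus mut /=.
have st : (s < N - k.+1)%N by lia.
move: fk fk1 st; rewrite /f tE negbK; move: (N - k.+1)%N => t.
have := rk_mono M (leqnn s) (leqnSn t); have := rk_mono M (leqnSn s) (leqnn t).
have := rk_colS s.+1 t M; have := rk_rowS s t M.
have := rk_mono M (leqnSn s) (leqnn t.+1); have := rk_mono M (leqnn s.+1) (leqnSn t).
lia.
Qed.

(** Between consecutive diagonal corners column [m] is lost and row [m] is gained, but only one of
    them can be nonzero, according to [mu m]. So one comparison covers both kinds of index. *)
Definition pivot (m : 'I_N) : bool := rk m m M != rk m.+1 m.+1 M.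

Lemma mem_indices_sigma m : (m \in indices (sigma mu M)) = pivot m.
Proof.
rewrite /pivot inE; have [mum|nmum] := boolP (mu m).
  rewrite rk_row_Tset //; apply/existsP/(sigma_colP mum) => [[[s t]]|[s st]].
    move=> /andP[st /orP[]/eqP/= mE]; last by exists s; rewrite mE.
    by move: st; rewrite sigmaE -mE mum.
  by exists (s, m); rewrite st eqxx orbT.
rewrite rk_col_Sset // eq_sym; apply/existsP/(sigma_rowP nmum) => [[[s t]]|[t st]].
  move=> /andP[st /orP[]/eqP/= mE]; first by exists t; rewrite mE.
  by move: st; rewrite sigmaE -mE (negPf nmum) andbF.
by exists (m, t); rewrite st eqxx.
Qed.

Lemma rkS (m : 'I_N) : (rk m.+1 m.+1 M + (mu m && pivot m) = rk m m M + (~~ mu m && pivot m))%N.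
Proof.
rewrite /pivot; have [mum|nmum] /= := boolP (mu m); rewrite ?addn0.
  rewrite rk_row_Tset //; have := rk_colS m m M; have := rk_mono M (leqnn m) (leqnSn m).
  by case: eqVneq => [->|]; lia.
rewrite -rk_col_Sset //; have := rk_rowS m m M; have := rk_mono M (leqnSn m) (leqnn m).
by case: eqVneq => [->|]; lia.
Qed.

(** Pivots in [Sset mu] raise the diagonal rank by one and those in [Tset mu] lower it. At [k = N]
    the corner is empty, so a type has as many indices of each kind. *)
Lemma rk_diag k : (k <= N)%N ->
  (rk k k M + below (fun m => mu m && pivot m) k = below (fun m => ~~ mu m && pivot m) k)%N.
Proof.
elim: k => [_|k IHk kN]; first by rewrite rk_row0 !below0.
have := rkS (Ordinal kN); rewrite /= !(belowS _ (Ordinal kN)) /=.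
by have := IHk (ltnW kN); lia.
Qed.

End Types.

(** * Characters of the cells *)

Section Characters.
Variables (F : finFieldType) (C : numClosedFieldType) (chi : F -> C).
Hypothesis chiP : nontrivial_additive_character chi.

Let chi0 : chi 0 = 1. Proof. by case: chiP. Qed.
Let chiD a b : chi (a + b) = chi a * chi b. Proof. by case: chiP. Qed.

(** If [phi] is not zero on the subspace [G], translation by an element [B] with [chi (phi B) != 1]
    multiplies the sum by that value, so the sum is 0. *)
Lemma char_sum p q (G : {pred 'M[F]_(p, q)}) (phi : 'M[F]_(p, q) -> F) :
  (forall c A B, A \in G -> B \in G -> c *: A + B \in G) ->
  (forall c A B, phi (c *: A + B) = c * phi A + phi B) ->
  \sum_(A in G) chi (phi A) = (if [forall A in G, phi A == 0] then #|G| else 0%N)%:R.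
Proof.
move=> GD phiD; case: ifPn => [/forall_inP phi0|].
  by rewrite (eq_bigr (fun=> 1)) ?sumr_const // => A /phi0/eqP ->.
rewrite negb_forall_in => /exists_inP[A0 GA0 phiA0].
have [_ _ [a0 chia0]] := chiP.
pose B := (a0 / phi A0) *: A0.
have phi0 : phi 0 = 0.
  by have := phiD 1 0 0; rewrite scaler0 addr0 mul1r => /eqP;
    rewrite addrC -subr_eq subrr eq_sym => /eqP.
have phiDD A A' : phi (A + A') = phi A + phi A' by rewrite -[A]scale1r phiD scale1r mul1r.
have phiB : phi B = a0 by rewrite -[B]addr0 phiD phi0 addr0 divfK.
have G0 : 0 \in G by rewrite -(addNr A0) -scaleN1r GD.
have GB : B \in G by rewrite -[B]addr0 GD.
have GB' A : (A + B \in G) = (A \in G).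
  apply/idP/idP => [GAB|GA]; last by rewrite -[A]scale1r GD.
  by rewrite -[A](addrK B) addrC -scaleN1r GD.
apply/eqP; rewrite -(mulrI_eq0 _ (@mulfI _ (chi a0 - 1) _)) ?subr_eq0 //.
rewrite mulrBl mul1r subr_eq0 mulr_sumr [X in _ == X](reindex_inj (addIr B)) /=.
rewrite [X in _ == X](eq_bigl (fun A => A \in G)) //; apply/eqP; apply: eq_bigr => A _.
by rewrite phiDD phiB chiD mulrC.
Qed.

Definition ip p q (A B : 'M[F]_(p, q)) : F := \tr (A *m B^T).

Lemma ipDr p q (A : 'M[F]_(p, q)) c B B' : ip A (c *: B + B') = c * ip A B + ip A B'.
Proof. by rewrite /ip linearP linearP /= linearP. Qed.

Lemma ipDl p q (A : 'M[F]_(p, q)) c B B' : ip (c *: B + B') A = c * ip B A + ip B' A.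
Proof. by rewrite /ip mulmxDl -scalemxAl linearP. Qed.

Lemma ip_delta p q (A : 'M[F]_(p, q)) i j : ip A (delta_mx i j) = A i j.
Proof.
rewrite /ip trmx_delta /mxtrace (bigD1 i) //= big1 ?addr0 => [|k ki].
  rewrite mxE (bigD1 j) //= mxE !eqxx mulr1 big1 ?addr0 // => k kj.
  by rewrite mxE (negPf kj) mulr0.
by rewrite mxE big1 // => l _; rewrite mxE (negPf ki) andbF mulr0.
Qed.

Lemma supported_closed N (mu : {ffun 'I_N -> bool}) c (A B : 'M[F]_N) :
  supported mu A -> supported mu B -> supported mu (c *: A + B).
Proof.
move=> sA sB; apply/supportedP => s t; rewrite !mxE.
have [As|As _] := eqVneq (A s t) 0.
  rewrite As mulr0 add0r => /(supported_nz sB)[ms mt st].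
  by rewrite (negPf ms).
by have [/negPf ms mt st] := supported_nz sA As.
Qed.

Lemma supported_delta N (mu : {ffun 'I_N -> bool}) (A : 'M[F]_N) i j :
  supported mu A -> A i j != 0 -> supported mu (delta_mx i j : 'M[F]_N).
Proof.
move=> sA /(supported_nz sA)[ms mt st]; apply/supportedP => s t; rewrite mxE.
case: (eqVneq s i) => [->|] /=; last by rewrite eqxx.
case: (eqVneq t j) => [->|] /=; last by rewrite eqxx.
by rewrite (negPf ms).
Qed.

Lemma char_orthogonal N (mu : {ffun 'I_N -> bool}) (A B : 'M[F]_N) :
  supported mu A -> supported mu B ->
  \sum_(Z | supported mu Z) chi (ip A Z) * chi (- ip B Z) =
  ((A == B) * #|[pred Z : 'M[F]_N | supported mu Z]|)%:R.
Proof.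
move=> sA sB; rewrite (eq_bigr (fun Z => chi (ip (A - B) Z))); last first.
  by move=> Z _; rewrite -chiD addrC -[A - B]addrC -scaleN1r ipDl mulN1r.
rewrite (@char_sum _ _ (supported mu) (ip (A - B))); last 2 first.
- by move=> c Z Z'; apply: supported_closed.
- by move=> c Z Z'; apply: ipDr.
case: ifPn => [/forall_inP AB0|]; last first.
  by case: eqP => [->|//]; case/negP; apply/forall_inP => Z _; rewrite subrr /ip mul0mx mxtrace0.
case: eqP => [_|AB]; first by rewrite mul1n.
case: AB; apply/eqP; rewrite -subr_eq0; apply/eqP/matrixP => i j; rewrite [RHS]mxE.
apply/eqP/negP => /negP ABij.
have sAB : supported mu (A - B) by rewrite addrC -scaleN1r supported_closed.
by have := AB0 _ (supported_delta sAB ABij); rewrite ip_delta (negPf ABij).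
Qed.

End Characters.

Lemma mem_mktuple_enum_val (T : finType) (V : eqType) (f : T -> V) y :
  f y \in [tuple f (enum_val i) | i < #|T|].
Proof. by apply/mapP; exists (enum_rank y); rewrite ?mem_enum ?enum_rankK. Qed.

(** * Fourier basis of a cell and sums over covers *)

Section Fourier.
Variables (F : finFieldType) (N : nat) (H : vectType F).
Variables (x : 'I_N.+1 -> {vspace H}) (v : N.-tuple H).
Hypothesis xv : adapted_basis x v.
Variables (C : numClosedFieldType) (chi : F -> C).
Hypothesis chiP : nontrivial_additive_character chi.

Implicit Types (mu nu : {ffun 'I_N -> bool}) (y z w : {vspace H}) (m n : 'I_N).
Implicit Types (Y Z : 'M[F]_N).

Notation loc := (location x).
Notation mf := (matrix_form x v).
Notation nP := #|{: {vspace H}}|.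
Notation V := 'cV[C]_nP.

Lemma constant_loc_supported mu Y : constant_loc mu -> supported mu Y -> Y = 0.
Proof.
move=> cmu sY; apply/matrixP => s t; rewrite [RHS]mxE; apply/eqP/negP => /negP.
move=> /(supported_nz sY)[ms mt _]; case/orP: cmu => /eqP/setP.
  by move/(_ t); rewrite !inE mt.
by move/(_ s); rewrite !inE ms.
Qed.

Lemma vtypeE y m : (m \in vtype x v y) = pivot (mf y) m.
Proof.
have sY := matrix_form_supported xv y; rewrite /vtype; case: ifP => [cy|_].
  rewrite (constant_loc_supported cy sY) inE /pivot /rk.
  suff m0 a b : corner a b (0 : 'M[F]_N) = 0 by rewrite !m0 eqxx.
  by apply/matrixP => i j; rewrite !mxE; case: ifP.
exact: mem_indices_sigma.
Qed.

(** The case split of [chi_vec] disappears: a cell of constant location is a single point with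
    matrix 0, where the character takes the value 1. *)
Lemma chi_vecE y z : chi_vec x v chi y (enum_rank z) 0 =
  if loc z == loc y then chi (ip (mf y) (mf z)) else 0.
Proof.
rewrite /chi_vec mxE enum_rankK /=; case: ifP => // cy.
have [chi0 _ _] := chiP.
case: (eqVneq (loc z) (loc y)) => [zy|zy].
  have Y0 := constant_loc_supported cy (matrix_form_supported xv y).
  have Z0 : mf z = 0.
    by apply: (constant_loc_supported cy); rewrite -zy; apply: matrix_form_supported.
  have -> : z = y by rewrite -(cell_pointK xv z) -(cell_pointK xv y) zy Y0 Z0.
  by rewrite eqxx Y0 /ip mul0mx mxtrace0 chi0.
by case: (eqVneq z y) zy => // ->; rewrite eqxx.
Qed.

Lemma colP_rank (u w : V) : (forall z, u (enum_rank z) 0 = w (enum_rank z) 0) -> u = w.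
Proof. by move=> uw; apply/colP => i; rewrite -(enum_valK i) uw. Qed.

Definition cell_card mu := #|[pred Z : 'M[F]_N | supported mu Z]|.

Lemma cell_card_neq0 mu : (cell_card mu)%:R != 0 :> C.
Proof.
rewrite pnatr_eq0 -lt0n; apply/card_gt0P; exists 0; rewrite inE.
by apply/forallP => s; apply/forallP => t; rewrite mxE eqxx.
Qed.

(** Fourier inversion on the cell of [z]. It shows that the character vectors span, and their number
    is the dimension. *)
Lemma chi_vec_sum z : delta_mx (enum_rank z) 0 =
  \sum_(y | loc y == loc z) (chi (- ip (mf z) (mf y)) / (cell_card (loc z))%:R) *: chi_vec x v chi y.
Proof.
apply: colP_rank => w; rewrite summxE.
under eq_bigr => y yz do rewrite mxE chi_vecE (eqP yz).
rewrite mxE (inj_eq enum_rank_inj) andbT.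
case: (eqVneq (loc w) (loc z)) => [wz|wz]; last first.
  rewrite big1 => [|y _]; last by rewrite mulr0.
  by case: (eqVneq w z) wz => // ->; rewrite eqxx.
rewrite (big_cell xv _ (fun Y => chi (- ip (mf z) Y) / (cell_card (loc z))%:R * chi (ip Y (mf w)))).
have ipC (A B : 'M[F]_N) : ip A B = ip B A.
  by rewrite /ip -mxtrace_tr trmx_mul trmxK.
have sz := matrix_form_supported xv z.
have sw : supported (loc z) (mf w) by rewrite -wz; apply: matrix_form_supported.
rewrite (eq_bigr (fun Y => (chi (ip (mf w) Y) * chi (- ip (mf z) Y)) / (cell_card (loc z))%:R));
  last first.
  by move=> Y _; rewrite mulrAC [ip Y _]ipC [chi (- _) * _]mulrC.
rewrite -mulr_suml char_orthogonal //.
case: (eqVneq (mf w) (mf z)) => wzE; last first.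
  by rewrite mul0n mul0r; case: (eqVneq w z) wzE => // ->; rewrite eqxx.
rewrite mul1n divff ?cell_card_neq0 // (_ : w == z) //.
by apply/eqP; rewrite -(cell_pointK xv w) -(cell_pointK xv z) wz wzE.
Qed.

Definition chi_tuple : nP.-tuple V := [tuple chi_vec x v chi (enum_val i) | i < nP].

Lemma chi_basis : basis_of fullv chi_tuple.
Proof.
rewrite basisEdim size_tuple dimvf /dim /= muln1 leqnn andbT.
apply/subvP => u _; have -> : u = \sum_(z : {vspace H}) u (enum_rank z) 0 *: delta_mx (enum_rank z) 0.
  apply: colP_rank => w; rewrite summxE (bigD1 w) //= !mxE eqxx mulr1 big1 ?addr0 // => z zw.
  by rewrite !mxE (inj_eq enum_rank_inj) eq_sym (negPf zw) mulr0.
apply: memv_suml => z _; apply: memvZ; rewrite chi_vec_sum.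
apply: memv_suml => y _; apply: memvZ; apply: memv_span.
exact: mem_mktuple_enum_val.
Qed.

Lemma Lmx_mul m (u : V) z : (Lmx x C m *m u) (enum_rank z) 0 =
  \sum_(w | mcovers x m w z) u (enum_rank w) 0.
Proof.
rewrite mxE [RHS]big_mkcond /= -(big_enum_val_vspace (fun w => if mcovers x m w z then u (enum_rank w) 0 else 0)).
apply: eq_bigr => i _; rewrite mxE enum_rankK enum_valK.
by case: ifP; rewrite ?mul1r ?mul0r.
Qed.

Lemma Rmx_mul m (u : V) w : (Rmx x C m *m u) (enum_rank w) 0 =
  \sum_(z | mcovers x m w z) u (enum_rank z) 0.
Proof.
rewrite mxE [RHS]big_mkcond /= -(big_enum_val_vspace (fun z => if mcovers x m w z then u (enum_rank z) 0 else 0)).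
apply: eq_bigr => i _; rewrite !mxE enum_rankK enum_valK.
by case: ifP; rewrite ?mul1r ?mul0r.
Qed.

(** Possible rows [m] of a supported matrix when [m] is outside the location; [colsupp] is the
    analogue for columns when [m] is inside. Neither depends on [mu m], so both ends of a cover
    share them. *)
Definition rowsupp mu m : pred 'rV[F]_N := [pred a : 'rV[F]_N | [forall t, (a 0 t != 0) ==> mu t && (m < t)%N]].
Definition colsupp mu m : pred 'cV[F]_N := [pred c : 'cV[F]_N | [forall s, (c s 0 != 0) ==> ~~ mu s && (s < m)%N]].

(** [down] and [up] solve the equation of [covers] for the lower and the upper matrix: given one
    end, the other is determined by its row [m] (below) or column [m] (above). *)
Definition down (W : 'M[F]_N) m (a : 'rV[F]_N) : 'M[F]_N :=
  \matrix_(s, t) if s == m then a 0 t else if t == m then 0 else W s t + W s m * a 0 t.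
Definition up (Z : 'M[F]_N) m (c : 'cV[F]_N) : 'M[F]_N :=
  \matrix_(s, t) if t == m then c s 0 else if s == m then 0 else Z s t - c s 0 * Z m t.

Lemma sum_down m w (g : 'M[F]_N -> C) : loc w m ->
  \sum_(z | mcovers x m w z) g (mf z) = \sum_(a | rowsupp (loc w) m a) g (down (mf w) m a).
Proof.
move=> wm; set mu := loc w; set W := mf w.
pose cov (Z : 'M[F]_N) := [forall s, forall t, (s != m) && (t != m) ==> (Z s t == W s t + W s m * Z m t)].
have covP z : mcovers x m w z = (loc z == unset mu m) && cov (mf z).
  apply/idP/andP => [/(mcovers_coversP xv)[_ e h]|[/eqP e /forallP h]].
    split; first exact/eqP.
    by apply/forallP => s; apply/forallP => t; apply/implyP => /andP[sm tm]; rewrite h.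
  apply/(mcovers_coversP xv); split=> // s t sm tm.
  by have /forallP/(_ t) := h s; rewrite sm tm => /eqP.
rewrite (eq_bigl _ _ covP) big_mkcondr (big_cell xv _ (fun Z => if cov Z then g Z else 0)) -big_mkcondr.
have sW : supported mu W := matrix_form_supported xv w.
rewrite (reindex_onto (down W m) (row m)) /=; last first.
  move=> Z /andP[sZ /forallP cZ]; apply/matrixP => s t; rewrite !mxE.
  case: (eqVneq s m) => [->//|sm]; case: (eqVneq t m) => [->|tm].
    by rewrite (supported_eq0 sZ) // [unset mu m m]ffunE eqxx orbT.
  by have /forallP/(_ t) := cZ s; rewrite sm tm => /eqP.
apply: eq_bigl => a.
have -> : (row m (down W m a) == a) = true.
  by apply/eqP/rowP => t; rewrite !mxE eqxx.
have -> : cov (down W m a).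
  apply/forallP => s; apply/forallP => t; apply/implyP => /andP[sm tm].
  by rewrite !mxE eqxx (negPf sm) (negPf tm).
rewrite !andbT; apply/idP/forallP => [sD t|ra].
  apply/implyP => at0; have := @supported_nz _ _ _ _ sD m t; rewrite mxE eqxx => /(_ at0)[].
  by rewrite !ffunE eqxx; case: eqP => // _ _ -> ->.
have raP t : a 0 t != 0 -> mu t && (m < t)%N by move=> h; have /implyP := ra t; apply.
apply/supportedP => s t; rewrite mxE !ffunE.
case: (eqVneq s m) => [->|sm].
  move=> /raP/andP[mt lt]; rewrite mt lt; split=> //.
  by case: eqP lt => // ->; rewrite ltnn.
case: (eqVneq t m) => [_|tm]; first by rewrite eqxx.
have [Wst|] := eqVneq (W s t) 0.
  rewrite Wst add0r mulf_eq0 negb_or => /andP[/(supported_nz sW)[/negPf ms _ lsm] /raP/andP[mt lmt]].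
  by split=> //; apply: ltn_trans lmt.
by move=> /(supported_nz sW)[/negPf ms mt lst].
Qed.

Lemma sum_up m z (g : 'M[F]_N -> C) : ~~ loc z m ->
  \sum_(w | mcovers x m w z) g (mf w) = \sum_(c | colsupp (loc z) m c) g (up (mf z) m c).
Proof.
move=> zm; set mu := loc z; set Z := mf z.
pose mu1 : {ffun 'I_N -> bool} := [ffun i => if i == m then true else mu i].
pose cov (W : 'M[F]_N) := [forall s, forall t, (s != m) && (t != m) ==> (Z s t == W s t + W s m * Z m t)].
have sZ : supported mu Z := matrix_form_supported xv z.
have covP w : mcovers x m w z = (loc w == mu1) && cov (mf w).
  apply/idP/andP => [/(mcovers_coversP xv)[wm e h]|[/eqP e /forallP h]].
    split; last first.
      by apply/forallP => s; apply/forallP => t; apply/implyP => /andP[sm tm]; rewrite /Z h.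
    by apply/eqP/ffunP => i; rewrite ffunE /mu e ffunE; case: eqP => [->|].
  apply/(mcovers_coversP xv); split=> [||s t sm tm].
  - by rewrite e ffunE eqxx.
  - apply/ffunP => i; rewrite e !ffunE; case: eqP => [->|//].
    by rewrite -/mu (negPf zm).
  - by have /forallP/(_ t) := h s; rewrite sm tm => /eqP.
rewrite (eq_bigl _ _ covP) big_mkcondr (big_cell xv _ (fun W => if cov W then g W else 0)) -big_mkcondr.
rewrite (reindex_onto (up Z m) (col m)) /=; last first.
  move=> W /andP[sW /forallP cW]; apply/matrixP => s t; rewrite !mxE.
  case: (eqVneq t m) => [->//|tm]; case: (eqVneq s m) => [->|sm].
    by rewrite (supported_eq0 sW) // ffunE eqxx.
  have /forallP/(_ t) := cW s; rewrite sm tm => /eqP ->.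
  by rewrite addrK.
apply: eq_bigl => c.
have -> : (col m (up Z m c) == c) = true.
  by apply/eqP/colP => t; rewrite !mxE eqxx.
have -> : cov (up Z m c).
  apply/forallP => s; apply/forallP => t; apply/implyP => /andP[sm tm].
  by rewrite !mxE eqxx (negPf sm) (negPf tm) subrK.
rewrite !andbT; apply/idP/forallP => [sD s|ra].
  apply/implyP => at0; have := @supported_nz _ _ _ _ sD s m; rewrite mxE eqxx => /(_ at0)[].
  by rewrite !ffunE; case: eqP => // _ -> _ ->.
have raP s : c s 0 != 0 -> ~~ mu s && (s < m)%N by move=> h; have /implyP := ra s; apply.
apply/supportedP => s t; rewrite mxE !ffunE.
case: (eqVneq t m) => [->|tm].
  move=> /raP/andP[/negPf ms lt]; rewrite lt; split=> //.
  by case: eqP lt => // ->; rewrite ltnn.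
case: (eqVneq s m) => [_|sm]; first by rewrite eqxx.
have [Zst|] := eqVneq (Z s t) 0.
  rewrite Zst add0r oppr_eq0 mulf_eq0 negb_or => /andP[/raP/andP[/negPf ms lsm] /(supported_nz sZ)[_ mt lmt]].
  by split=> //; apply: ltn_trans lmt.
by move=> /(supported_nz sZ)[/negPf ms mt lst].
Qed.


(** These are the nonconstant factors of the rank-one shifts produced by a round trip along a cover,
    upwards first for [point_col] and downwards first for [point_row]. *)
Definition point_col m (c : 'cV[F]_N) : 'cV[F]_N := delta_mx m 0 + c.
Definition point_row m (a : 'rV[F]_N) : 'rV[F]_N := delta_mx 0 m - a.

Lemma rowsupp_closed mu m c a b :
  a \in rowsupp mu m -> b \in rowsupp mu m -> c *: a + b \in rowsupp mu m.
Proof.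
rewrite !inE => /forallP ra /forallP rb; apply/forallP => t; apply/implyP; rewrite !mxE => nz.
have [at0|] := eqVneq (a 0 t) 0; last by move: (ra t) => /implyP; apply.
by move: nz; rewrite at0 mulr0 add0r; move: (rb t) => /implyP; apply.
Qed.

Lemma colsupp_closed mu m c a b :
  a \in colsupp mu m -> b \in colsupp mu m -> c *: a + b \in colsupp mu m.
Proof.
rewrite !inE => /forallP ra /forallP rb; apply/forallP => t; apply/implyP; rewrite !mxE => nz.
have [at0|] := eqVneq (a t 0) 0; last by move: (ra t) => /implyP; apply.
by move: nz; rewrite at0 mulr0 add0r; move: (rb t) => /implyP; apply.
Qed.

End Fourier.

(** * Eigenvalues *)

Section Eigen.
Variables (F : finFieldType) (N : nat) (H : vectType F).
Variables (x : 'I_N.+1 -> {vspace H}) (v : N.-tuple H).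
Hypothesis xv : adapted_basis x v.
Variables (C : numClosedFieldType) (chi : F -> C).
Hypothesis chiP : nontrivial_additive_character chi.

Implicit Types (mu nu : {ffun 'I_N -> bool}) (y z w : {vspace H}) (m n : 'I_N).
Implicit Types (Y Z : 'M[F]_N).

Notation loc := (location x).
Notation mf := (matrix_form x v).
Notation nP := #|{: {vspace H}}|.
Notation V := 'cV[C]_nP.


Lemma colsupp_m mu m (c : 'cV[F]_N) : c \in colsupp mu m -> c m 0 = 0.
Proof.
by rewrite inE => /forallP/(_ m)/implyP h; apply/eqP/negP => /negP/h; rewrite ltnn andbF.
Qed.

Lemma rowsupp_m mu m (a : 'rV[F]_N) : a \in rowsupp mu m -> a 0 m = 0.
Proof.
by rewrite inE => /forallP/(_ m)/implyP h; apply/eqP/negP => /negP/h; rewrite ltnn andbF.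
Qed.

(** The convolution property: with the row parameter shifted by [row m Z], the quadratic terms
    combine into a rank-one matrix that does not involve [Z]. *)
Lemma down_up mu (Z : 'M[F]_N) m c a : supported mu Z -> ~~ mu m -> c \in colsupp mu m ->
  a \in rowsupp mu m -> down (up Z m c) m (a + row m Z) = point_col m c *m a + Z.
Proof.
move=> sZ mm cc ra; apply/matrixP => s t; rewrite !mxE big_ord1 !mxE eqxx andbT.
case: (eqVneq s m) => [->|sm]; first by rewrite (colsupp_m cc) addr0 mul1r.
case: (eqVneq t m) => [->|tm].
  by rewrite (rowsupp_m ra) mulr0 add0r (supported_eq0 sZ) // mm orbT.
by rewrite (_ : false%:R = 0) // ord1; ring.
Qed.

Lemma up_down mu (Y : 'M[F]_N) m c a : supported mu Y -> mu m -> c \in colsupp mu m ->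
  a \in rowsupp mu m -> up (down Y m a) m (c + col m Y) = c *m point_row m a + Y.
Proof.
move=> sY mm cc ra; apply/matrixP => s t; rewrite !mxE big_ord1 !mxE eqxx andTb.
case: (eqVneq t m) => [->|tm]; first by rewrite (rowsupp_m ra) subr0 mulr1.
case: (eqVneq s m) => [->|sm].
  by rewrite (colsupp_m cc) mul0r add0r (supported_eq0 sY) // mm.
by rewrite (_ : false%:R = 0) // ord1; ring.
Qed.

Lemma LR_chi m y : Lmx x C m *m (Rmx x C m *m chi_vec x v chi y) =
  (if loc y m then 0 else
   \sum_(c | colsupp (loc y) m c) \sum_(a | rowsupp (loc y) m a)
     chi (ip (mf y) (point_col m c *m a))) *: chi_vec x v chi y.
Proof.
have [_ chiD _] := chiP.
apply: colP_rank => z0; rewrite Lmx_mul mxE [in RHS](chi_vecE xv chiP).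
rewrite (eq_bigr (fun w => \sum_(z | mcovers x m w z) chi_vec x v chi y (enum_rank z) 0));
  last first.
  by move=> w _; rewrite Rmx_mul.
have [z0y|z0y] := eqVneq (loc z0) (loc y); last first.
  rewrite mulr0 big1 // => w /(mcovers_location xv)[wm wz0].
  rewrite big1 // => z /(mcovers_location xv)[_ wz].
  by rewrite (chi_vecE xv chiP) wz -wz0 (negPf z0y).
have [ym|ym] := ifPn.
  rewrite mul0r big1 // => w /(mcovers_coversP xv)[wm e _].
  by move: ym; rewrite -z0y e ffunE eqxx.
have sZ := matrix_form_supported xv z0; have ym' : ~~ loc z0 m by rewrite z0y.
rewrite (eq_bigr (fun w => \sum_(a | rowsupp (loc z0) m a) chi (ip (mf y) (down (mf w) m a))));
  last first.
  move=> w cw; have [wm ez0] := mcovers_location xv cw.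
  rewrite (eq_bigr (fun z => chi (ip (mf y) (mf z)))); last first.
    move=> z cz; have [_ ez] := mcovers_location xv cz.
    by rewrite (chi_vecE xv chiP) ez -ez0 z0y eqxx.
  rewrite (sum_down xv (fun Z => chi (ip (mf y) Z)) wm); apply: eq_bigl => a.
  apply: eq_forallb => t; rewrite ez0 ffunE; case: (eqVneq t m) => // ->.
  by rewrite ltnn !andbF.
rewrite (sum_up xv (fun W => \sum_(a | rowsupp (loc z0) m a) chi (ip (mf y) (down W m a))) ym').
rewrite z0y mulr_suml; apply: eq_bigr => c cc.
have a0P : row m (mf z0) \in rowsupp (loc y) m.
  rewrite inE; apply/forallP => t; rewrite mxE; apply/implyP => /(supported_nz sZ)[_].
  by rewrite z0y => -> ->.
have shift a : rowsupp (loc y) m (a + row m (mf z0)) = rowsupp (loc y) m a.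
  apply/idP/idP => h; last by rewrite -[a]scale1r; apply: rowsupp_closed.
  by rewrite -[a](addrK (row m (mf z0))) addrC -scaleN1r; apply: rowsupp_closed.
(* The shift preserves the parameter space and removes the dependence on the starting point, via
   [down_up]. *)
rewrite (reindex_inj (addIr (row m (mf z0)))) mulr_suml /=.
apply: eq_big => // a; rewrite shift => ra; rewrite z0y in sZ.
by rewrite -chiD (down_up sZ ym cc ra) -[_ *m a]scale1r ipDr mul1r scale1r.
Qed.


Lemma RL_chi m y : Rmx x C m *m (Lmx x C m *m chi_vec x v chi y) =
  (if loc y m then
   \sum_(a | rowsupp (loc y) m a) \sum_(c | colsupp (loc y) m c)
     chi (ip (mf y) (c *m point_row m a)) else 0) *: chi_vec x v chi y.
Proof.
have [_ chiD _] := chiP.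
apply: colP_rank => y0; rewrite Rmx_mul mxE [in RHS](chi_vecE xv chiP).
rewrite (eq_bigr (fun z => \sum_(w | mcovers x m w z) chi_vec x v chi y (enum_rank w) 0));
  last first.
  by move=> w _; rewrite Lmx_mul.
have [y0y|y0y] := eqVneq (loc y0) (loc y); last first.
  rewrite mulr0 big1 // => z /(mcovers_location xv)[ym yz0].
  rewrite big1 // => w /(mcovers_location xv)[wm wz].
  rewrite (chi_vecE xv chiP); case: eqP => // wy; case/negP: y0y; apply/eqP/ffunP => i.
  have /ffunP/(_ i) := wz; rewrite yz0 !ffunE wy; case: eqP => [->|//].
  by rewrite ym -wy wm.
have [ym|ym] := ifPn; last first.
  rewrite mul0r big1 // => z /(mcovers_location xv)[].
  by rewrite y0y (negPf ym).
have sY := matrix_form_supported xv y0; have ym' : loc y0 m by rewrite y0y.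
rewrite (eq_bigr (fun z => \sum_(c | colsupp (loc y0) m c) chi (ip (mf y) (up (mf z) m c))));
  last first.
  move=> z cz; have [_ ez] := mcovers_location xv cz.
  have zm : ~~ loc z m by rewrite ez ffunE eqxx.
  rewrite (eq_bigr (fun w => chi (ip (mf y) (mf w)))); last first.
    move=> w cw; have [wm ew] := mcovers_location xv cw.
    rewrite (chi_vecE xv chiP); case: eqP => // wy; case: wy; rewrite -y0y; apply/ffunP => i.
    have /ffunP/(_ i) := ew; rewrite ez !ffunE; case: eqP => [->|//].
    by rewrite ym' wm.
  rewrite (sum_up xv (fun Z => chi (ip (mf y) Z)) zm); apply: eq_bigl => a.
  apply: eq_forallb => t; rewrite ez ffunE; case: (eqVneq t m) => // ->.
  by rewrite ltnn !andbF.
rewrite (sum_down xv (fun Z => \sum_(c | colsupp (loc y0) m c) chi (ip (mf y) (up Z m c))) ym').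
rewrite y0y mulr_suml; apply: eq_bigr => a ra.
have c0P : col m (mf y0) \in colsupp (loc y) m.
  rewrite inE; apply/forallP => t; rewrite mxE; apply/implyP => /(supported_nz sY)[].
  by rewrite y0y => -> _ ->.
have shift c : colsupp (loc y) m (c + col m (mf y0)) = colsupp (loc y) m c.
  apply/idP/idP => h; last by rewrite -[c]scale1r; apply: colsupp_closed.
  by rewrite -[c](addrK (col m (mf y0))) addrC -scaleN1r; apply: colsupp_closed.
rewrite (reindex_inj (addIr (col m (mf y0)))) mulr_suml /=.
apply: eq_big => // c; rewrite shift => cc; rewrite y0y in sY.
by rewrite -chiD (up_down sY ym cc ra) -[c *m _]scale1r ipDr mul1r scale1r.
Qed.


(** For fixed [c], the character sum over [a] is the number of all [a] if the linear form in [a]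
    vanishes, and 0 otherwise; so the eigenvalue counts the [c] for which it vanishes. *)
Definition solrow mu X m : nat :=
  #|[pred c : 'cV[F]_N | (c \in colsupp mu m) &&
     [forall a in rowsupp mu m, ip X (point_col m c *m a) == 0]]|.

Definition solcol mu X m : nat :=
  #|[pred a : 'rV[F]_N | (a \in rowsupp mu m) &&
     [forall c in colsupp mu m, ip X (c *m point_row m a) == 0]]|.

(** Eigenvalue of [Rmx m *m Lmx m + Lmx m *m Rmx m]: on each cell one of the two products is 0,
    according to whether [m] lies in the location. *)
Definition theta y m : nat :=
  if loc y m then (#|(colsupp (loc y) m : pred 'cV[F]_N)| * solcol (loc y) (mf y) m)%N
  else (#|(rowsupp (loc y) m : pred 'rV[F]_N)| * solrow (loc y) (mf y) m)%N.

Lemma sum_count (T : finType) (P Q : pred T) (k : nat) :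
  \sum_(i | P i) (if Q i then k else 0%N)%:R = (k * #|[pred i | P i && Q i]|)%:R :> C.
Proof.
by rewrite -natr_sum -big_mkcondr /= sum_nat_const mulnC.
Qed.

Lemma LR_eigen m y : Lmx x C m *m (Rmx x C m *m chi_vec x v chi y) =
  (if loc y m then 0%N else theta y m)%:R *: chi_vec x v chi y.
Proof.
rewrite LR_chi /theta; case: (loc y m) => //; congr (_ *: _).
rewrite -sum_count; apply: eq_bigr => c cc.
rewrite (@char_sum _ _ _ chiP _ _ (rowsupp (loc y) m) (fun a => ip (mf y) (point_col m c *m a))) //.
  by move=> d a b; apply: rowsupp_closed.
by move=> d a b; rewrite mulmxDr -scalemxAr ipDr.
Qed.

Lemma RL_eigen m y : Rmx x C m *m (Lmx x C m *m chi_vec x v chi y) =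
  (if loc y m then theta y m else 0%N)%:R *: chi_vec x v chi y.
Proof.
rewrite RL_chi /theta; case: (loc y m) => //; congr (_ *: _).
rewrite -sum_count; apply: eq_bigr => a ra.
rewrite (@char_sum _ _ _ chiP _ _ (colsupp (loc y) m) (fun c => ip (mf y) (c *m point_row m a))) //.
  by move=> d c b; apply: colsupp_closed.
by move=> d c b; rewrite mulmxDl -scalemxAl ipDr.
Qed.

End Eigen.

(** * The affine systems behind the eigenvalues *)

Section Solutions.
Variables (F : finFieldType) (N : nat) (mu : {ffun 'I_N -> bool}) (X : 'M[F]_N).
Hypothesis sX : supported mu X.

Lemma ip_row p q (A : 'M[F]_(p, q)) (c : 'cV[F]_p) (a : 'rV[F]_q) :
  ip A (c *m a) = ip (c^T *m A) a.
Proof. by rewrite /ip trmx_mul mulmxA mxtrace_mulC mulmxA. Qed.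

Lemma ip_col p q (A : 'M[F]_(p, q)) (c : 'cV[F]_p) (a : 'rV[F]_q) :
  ip A (c *m a) = ip (A *m a^T) c.
Proof. by rewrite /ip trmx_mul mulmxA. Qed.

Lemma rowsupp_ip0 m (b : 'rV[F]_N) : (forall t, ~~ mu t -> b 0 t = 0) ->
  [forall a in rowsupp mu m, ip b a == 0] = (b *m Pcol F N m.+1 == 0).
Proof.
move=> bT; apply/forall_inP/eqP => [b0|b0 a].
  apply/rowP => t; rewrite mul_mx_diag !mxE; have [mt|mt] := leqP m.+1 t; last by rewrite mulr0.
  rewrite mulr1; have [mut|/bT//] := boolP (mu t).
  rewrite -(ip_delta b 0 t); apply/eqP/b0; rewrite inE; apply/forallP => t'; rewrite !mxE eqxx /=.
  by case: (eqVneq t' t) => [->|_]; rewrite ?mut ?mt ?eqxx // implybT.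
rewrite inE => /forallP ra; rewrite /ip /mxtrace big_ord1 mxE big1 // => t _; rewrite mxE.
have [at0|/(implyP (ra t))/andP[mut mt]] := eqVneq (a 0 t) 0; first by rewrite at0 mulr0.
have /rowP/(_ t) := b0; rewrite mul_mx_diag !mxE mt mulr1 => ->.
by rewrite mul0r.
Qed.

Lemma colsupp_ip0 m (b : 'cV[F]_N) : (forall s, mu s -> b s 0 = 0) ->
  [forall c in colsupp mu m, ip b c == 0] = (Prow F N m *m b == 0).
Proof.
move=> bT; apply/forall_inP/eqP => [b0|b0 a].
  apply/colP => t; rewrite mul_diag_mx !mxE; have [mt|mt] := ltnP t m; last by rewrite mul0r.
  rewrite mul1r; have [/bT//|mut] := boolP (mu t).
  rewrite -(ip_delta b t 0); apply/eqP/b0; rewrite inE; apply/forallP => t';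
    rewrite !mxE eqxx andbT.
  by case: (eqVneq t' t) => [->|_]; rewrite ?mut ?mt ?eqxx // implybT.
rewrite inE => /forallP ra; rewrite /ip /mxtrace big1 // => t _; rewrite !mxE big_ord1 mxE.
have [at0|/(implyP (ra t))/andP[mut mt]] := eqVneq (a t 0) 0; first by rewrite at0 mulr0.
have /colP/(_ t) := b0; rewrite mul_diag_mx !mxE mt mul1r => ->.
by rewrite mul0r.
Qed.

(** Testing against elementary rows gives an affine system in [c]: row [m] of the corner plus a
    combination of the rows above it must vanish. *)
Lemma row_cond m (c : 'cV[F]_N) : c \in colsupp mu m ->
  [forall a in rowsupp mu m, ip X (point_col m c *m a) == 0] =
  (row m (corner m.+1 m.+1 X) + c^T *m corner m m.+1 X == 0).
Proof.
move=> cc; rewrite (_ : [forall a in _, _] = [forall a in rowsupp mu m, ip ((point_col m c)^T *m X) a == 0]).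
  rewrite rowsupp_ip0; last first.
    by move=> t mt; rewrite mxE big1 // => s _; rewrite (supported_eq0 sX) ?mulr0 // mt orbT.
  congr (_ == _); rewrite /point_col linearD /= trmx_delta mulmxDl -rowE !mulmxDl.
  congr (_ + _).
    apply/rowP => t; rewrite mul_mx_diag !mxE ltnSn /=.
    by case: (m < t)%N; rewrite ?mulr1 ?mulr0.
  rewrite cornerE !mulmxA; congr (_ *m _ *m _); apply/rowP => s; rewrite mul_mx_diag !mxE.
  have [->|cs] := eqVneq (c s 0) 0; first by rewrite mul0r.
  by move: cc; rewrite inE => /forallP/(_ s)/implyP/(_ cs)/andP[_ ->]; rewrite mulr1.
by apply: eq_forallb => a; rewrite ip_row.
Qed.

Lemma col_cond m (a : 'rV[F]_N) : a \in rowsupp mu m ->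
  [forall c in colsupp mu m, ip X (c *m point_row m a) == 0] =
  (col m (corner m m X) - corner m m.+1 X *m a^T == 0).
Proof.
move=> ra; rewrite (_ : [forall a in _, _] = [forall c in colsupp mu m, ip (X *m (point_row m a)^T) c == 0]).
  rewrite colsupp_ip0; last first.
    by move=> t mt; rewrite mxE big1 // => s _; rewrite (supported_eq0 sX) ?mul0r // mt.
  congr (_ == _); rewrite /point_row linearB /= trmx_delta mulmxBr -colE !mulmxBr.
  congr (_ - _).
    apply/colP => t; rewrite mul_diag_mx !mxE leqnn andbT.
    by case: (t < m)%N; rewrite ?mul1r ?mul0r.
  rewrite cornerE -!mulmxA; congr (_ *m (_ *m _)); apply/colP => s; rewrite mul_diag_mx !mxE.
  have [->|cs] := eqVneq (a 0 s) 0; first by rewrite mulr0.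
  by move: ra; rewrite inE => /forallP/(_ s)/implyP/(_ cs)/andP[_ ->]; rewrite mul1r.
by apply: eq_forallb => c; rewrite ip_col.
Qed.

(** The system is solvable iff row [m] lies in the span of the rows above, that is, iff adding it
    keeps the corner rank. Column [m] vanishes here, so this is the absence of a pivot. *)
Lemma solrow_gt0 m : ~~ mu m -> (0 < solrow mu X m)%N = ~~ pivot X m.
Proof.
move=> mm; have sub : (row m (corner m.+1 m.+1 X) <= corner m m.+1 X)%MS = ~~ pivot X m.
  rewrite negbK (rk_col_Sset sX) // eq_sym; symmetry; apply: rank_addrow => [k km|].
    by apply/rowP => t; rewrite !mxE ltnS leq_eqVlt val_eqE (negPf km).
  by apply/rowP => t; rewrite !mxE ltnn.
rewrite -sub; apply/card_gt0P/idP => [[c]|/submxP[d dE]].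
  rewrite inE => /andP[cc]; rewrite row_cond // addr_eq0 => /eqP ->.
  by rewrite -mulNmx submxMl.
(* Coefficients outside [colsupp] meet only zero rows of the corner, so they can be discarded. *)
pose c : 'cV[F]_N := \col_s (if ~~ mu s && (s < m)%N then - d 0 s else 0).
have cc : c \in colsupp mu m.
  rewrite inE; apply/forallP => s; rewrite mxE.
  by case: ifP => _; rewrite ?implybT // eqxx.
exists c; rewrite inE cc row_cond // addr_eq0 dE -mulNmx; apply/eqP/rowP => t.
rewrite !mxE; apply: eq_bigr => s _; rewrite !mxE.
case: (boolP (~~ mu s && (s < m)%N)) => [_|]; first by rewrite opprK.
rewrite negb_and negbK => /orP[ms|/negPf ->]; last by rewrite !mulr0.
by rewrite (supported_eq0 sX) ?ms // if_same !mulr0.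
Qed.

Lemma solcol_gt0 m : mu m -> (0 < solcol mu X m)%N = ~~ pivot X m.
Proof.
move=> mm; have sub : ((col m (corner m m X))^T <= (corner m m.+1 X)^T)%MS = ~~ pivot X m.
  rewrite negbK (rk_row_Tset sX) // tr_col; symmetry;
    rewrite /rk -[X in X == _]mxrank_tr -[X in _ == X]mxrank_tr.
  apply: rank_addrow => [k km|].
    by apply/rowP => t; rewrite !mxE [(m <= k)%N]leq_eqVlt val_eqE eq_sym (negPf km).
  by apply/rowP => t; rewrite !mxE ltnn andbF.
rewrite -sub; apply/card_gt0P/idP => [[a]|/submxP[d dE]].
  rewrite inE => /andP[ra]; rewrite col_cond // subr_eq0 => /eqP ->.
  by rewrite trmx_mul submxMl.
pose a : 'rV[F]_N := \row_s (if mu s && (m < s)%N then d 0 s else 0).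
have ra : a \in rowsupp mu m.
  rewrite inE; apply/forallP => s; rewrite mxE.
  by case: ifP => _; rewrite ?implybT // eqxx.
exists a; rewrite inE ra col_cond // subr_eq0; apply/eqP/trmx_inj.
rewrite dE trmx_mul trmxK; apply/rowP => t; rewrite !mxE; apply: eq_bigr => s _; rewrite !mxE.
case: (boolP (mu s && (m < s)%N)) => [//|]; rewrite negb_and => /orP[ms|/negPf ->];
  last by rewrite andbF !mulr0.
by rewrite (supported_eq0 sX) ?ms ?orbT // if_same !mulr0.
Qed.

Definition Psupp (m : 'I_N) : 'M[F]_N := diag_mx (\row_s (~~ mu s && (s < m)%N)%:R).

Lemma sub_Psupp m (c : 'cV[F]_N) : (c^T <= Psupp m)%MS = (c \in colsupp mu m).
Proof.
apply/submxP/idP => [[d dE]|cc].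
  rewrite inE; apply/forallP => s; apply/implyP; have /rowP/(_ s) := dE.
  by rewrite mul_mx_diag !mxE => ->; case: (_ && _); rewrite ?mulr0 ?eqxx.
exists c^T; apply/rowP => s; rewrite mul_mx_diag !mxE.
have [->|cs] := eqVneq (c s 0) 0; first by rewrite mul0r.
by move: cc; rewrite inE => /forallP/(_ s)/implyP/(_ cs) ->; rewrite mulr1.
Qed.

(** The solutions are a coset of the left kernel of the corner, cut with the row space of [Psupp];
    rank-nullity gives its dimension. The exact count is what makes lowering after raising scalar on
    a type. *)
Lemma solrow_card m : ~~ mu m -> ~~ pivot X m ->
  solrow mu X m = (#|F| ^ (\rank (Psupp m) - rk m m.+1 X))%N.
Proof.
move=> mm pm; have : (0 < solrow mu X m)%N by rewrite solrow_gt0.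
case/card_gt0P => c0; rewrite inE => /andP[c0P]; rewrite row_cond // => /eqP c0E.
set A := corner m m.+1 X in c0E *.
have PA : Psupp m *m A = A.
  apply/matrixP => s t; rewrite mul_diag_mx !mxE.
  have [sm|ms] := ltnP s m; last by rewrite andFb mulr0.
  have [ms|ms] := boolP (mu s); last by rewrite mul1r.
  by rewrite (supported_eq0 sX) ?ms // if_same mulr0.
rewrite (_ : (_ - _)%N = \rank (Psupp m :&: kermx A)%MS); last first.
  by rewrite -(mxrank_mul_ker (Psupp m) A) PA addKn.
rewrite -card_rowg -(card_imset _ (_ : injective (fun u : 'rV[F]_N => c0 + u^T))); last first.
  by move=> u w /addrI/trmx_inj.
apply: eq_card => c; rewrite inE; apply/andP/imsetP => [[cc]|[u]].
  rewrite row_cond // => /eqP cE; exists (c - c0)^T; last by rewrite trmxK addrC subrK.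
  rewrite mem_rowg sub_capmx sub_Psupp -[c - c0]addrC -scaleN1r colsupp_closed //=.
  apply/sub_kermxP; rewrite linearD linearZ /= scaleN1r mulmxDl mulNmx.
  move/eqP: c0E; rewrite addrC addr_eq0 => /eqP ->.
  by rewrite opprK -/A cE.
rewrite mem_rowg sub_capmx -[u in (u <= Psupp m)%MS]trmxK sub_Psupp => /andP[uP /sub_kermxP uA] ->.
have cc : c0 + u^T \in colsupp mu m by rewrite -[c0]scale1r colsupp_closed.
by split=> //; rewrite row_cond // linearD /= trmxK mulmxDl uA addr0 c0E.
Qed.

End Solutions.

(** * Semisimple star-closed matrix algebras *)

Section StarAlgebra.
Variables (C : numClosedFieldType) (n : nat) (A : 'M[C]_n -> Prop).
Notation V := 'cV[C]_n.
Implicit Types (X Y : 'M[C]_n) (u w : V) (U W : {vspace V}).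

Definition adjmx X : 'M[C]_n := (map_mx Num.conj X)^T.

Hypothesis A1 : A 1%:M.
Hypothesis AZ : forall c X, A X -> A (c *: X).
Hypothesis AD : forall X Y, A X -> A Y -> A (X + Y).
Hypothesis AM : forall X Y, A X -> A Y -> A (X *m Y).
Hypothesis Aadj : forall X, A X -> A (adjmx X).

Definition submod W : Prop := forall X, A X -> forall w, w \in W -> X *m w \in W.

Definition irred W : Prop :=
  [/\ submod W, W != 0%VS & forall U, submod U -> (U <= W)%VS -> U = 0%VS \/ U = W].

Definition iso W W' : Prop :=
  exists f : 'End(V),
    [/\ (f @: W)%VS = W', (W :&: lker f)%VS = 0%VS &
        forall X, A X -> forall w, w \in W -> f (X *m w) = X *m f w].

Definition generated W w : Prop :=
  [/\ submod W, w \in W & forall U, submod U -> w \in U -> (W <= U)%VS].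

Definition irr_decomp (k : nat) (D : 'I_k -> {vspace V}) U : Prop :=
  [/\ forall i, irred (D i), directv (\sum_i D i) & (\sum_i D i)%VS = U].

(** A subspace of maximal dimension inside the predicate works, since any further vector could be
    added to it. This turns a module generated by a vector, given by an existential over [A], into a
    subspace. *)
Lemma vspace_of_pred (p : V -> Prop) :
  p 0 -> (forall c u w, p u -> p w -> p (c *: u + w)) ->
  exists U, forall u, u \in U <-> p u.
Proof.
move=> p0 pD; pose P d := `[< exists2 U, \dim U = d & forall u, u \in U -> p u >].
have [||d /asboolP[U dU Up] dmax] := @ex_maxnP P n.
- exists 0%N; apply/asboolP; exists 0%VS; first exact: dimv0.
  by move=> u; rewrite memv0 => /eqP ->.
- move=> d /asboolP[U <- _]; rewrite (leq_trans (dimvS (subvf U))) //.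
  by rewrite dimvf /dim /= muln1.
exists U => u; split=> [|pu]; first exact: Up.
apply/negPn/negP => nu; have : P d.+1.
  apply/asboolP; exists (<[u]> + U)%VS.
    rewrite dimv_disjoint_sum ?dim_vline ?dU.
      by case: eqP nu => [->|]; rewrite ?mem0v.
    apply/eqP; rewrite -subv0; apply/subvP => w; rewrite memv_cap => /andP[/vlineP[c ->] cu].
    rewrite memv0; have [->|c0] := eqVneq c 0; first by rewrite scale0r.
    by case/negP: nu; rewrite -[u](scalerK c0) memvZ.
  by move=> w /memv_addP[_ /vlineP[c ->] [w' /Up pw' ->]]; apply: pD.
by move/dmax; rewrite ltnn.
Qed.

Lemma submodI U W : submod U -> submod W -> submod (U :&: W).
Proof.
move=> sU sW X AX w; rewrite !memv_cap => /andP[wU wW].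
by rewrite sU ?sW.
Qed.

Definition herm u w : C := \sum_i (u i 0)^* * w i 0.

Lemma herm_eq0 u : herm u u = 0 -> u = 0.
Proof.
move=> h; apply/colP => i; rewrite mxE; apply/eqP; rewrite -normr_eq0 -sqrf_eq0 normCKC.
have h0 j : true -> 0 <= (u j 0)^* * u j 0 by rewrite -normCKC exprn_ge0.
by rewrite (psumr_eq0P h0 h).
Qed.

Lemma herm_adj X u w : herm u (X *m w) = herm (adjmx X *m u) w.
Proof.
rewrite /herm (eq_bigr (fun i => \sum_j (u i 0)^* * (X i j * w j 0))); last first.
  by move=> i _; rewrite mxE mulr_sumr.
rewrite exchange_big /=; apply: eq_bigr => j _; rewrite mxE rmorph_sum mulr_suml.
by apply: eq_bigr => i _; rewrite !mxE rmorphM /= conjCK mulrCA mulrA.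
Qed.

(** The Hermitian orthogonal of a submodule is stable because [A] is closed under adjoints, and
    positivity makes the intersection trivial. It is realised as the kernel of the matrix [B] of
    conjugated basis vectors. *)
Lemma orthogonal_complement W : submod W -> exists2 W', submod W' &
  (W + W' = fullv /\ W :&: W' = 0)%VS.
Proof.
move=> sW; pose b := vbasis W; pose B : 'M[C]_(\dim W, n) := \matrix_(j, i) (b`_j i 0)^*.
have BE u (j : 'I_(\dim W)) : (B *m u) j 0 = herm b`_j u.
  by rewrite mxE; apply: eq_bigr => i _; rewrite mxE.
pose f : 'Hom(V, 'cV[C]_(\dim W)) := linfun (mulmx B).
have kerP w : reflect (forall u, u \in W -> herm u w = 0) (w \in lker f).
  rewrite memv_ker lfunE /=; apply: (iffP eqP) => [Bw u uW|h].
    rewrite (coord_vbasis uW) /herm.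
    rewrite (eq_bigr (fun i => \sum_j (coord b j u)^* * ((b`_j i 0)^* * w i 0))); last first.
      move=> i _; rewrite summxE rmorph_sum mulr_suml.
      by apply: eq_bigr => j _; rewrite mxE rmorphM mulrA.
    rewrite exchange_big big1 //= => j _; rewrite -mulr_sumr -/(herm _ _) -BE Bw.
    by rewrite mxE mulr0.
  apply/colP => j; rewrite BE mxE; apply: h; apply: vbasis_mem.
  by apply: mem_nth; rewrite size_tuple.
exists (lker f); first by move=> X AX w /kerP h; apply/kerP => u uW; rewrite herm_adj h //;
  apply: sW => //; apply: Aadj.
have cap0 : (W :&: lker f = 0)%VS.
  apply/eqP; rewrite -subv0; apply/subvP => u; rewrite memv_cap memv0 => /andP[uW /kerP h].
  by apply/eqP/herm_eq0/h.
split=> //; apply/eqP; rewrite eqEdim subvf dimv_disjoint_sum //.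
have := limg_ker_dim f fullv; rewrite capfv dimvf => <-.
rewrite addnC leq_add2r (leq_trans (dimvS (subvf _))) //.
by rewrite dimvf /dim /= muln1.
Qed.

Lemma complement_in U W : submod U -> submod W -> (W <= U)%VS ->
  exists2 W', submod W' & (W + W' = U /\ W :&: W' = 0)%VS.
Proof.
move=> sU sW WU; have [W' sW' [full cap0]] := orthogonal_complement sW.
exists (W' :&: U)%VS; first exact: submodI.
by rewrite (vspace_modl _ WU) full capfv capvA cap0 cap0v.
Qed.

Lemma irred_sub U : submod U -> U != 0%VS -> exists2 D, irred D & (D <= U)%VS.
Proof.
have [d] := ubnP (\dim U); elim: d U => // d IHd U dU sU U0.
have [|nirr] := pselect (irred U); first by move=> irrU; exists U.
have [W [sW WU W0 WneU]] : exists W, [/\ submod W, (W <= U)%VS, W != 0%VS & W != U].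
  apply: contrapT => h; apply: nirr; split=> // W sW WU.
  have [->|W0] := eqVneq W 0%VS; first by left.
  have [->|WneU] := eqVneq W U; first by right.
  by case: h; exists W.
have ltd : (\dim W < d)%N.
  rewrite -ltnS; apply: leq_trans dU; rewrite ltnS ltn_neqAle (dimvS WU) andbT.
  by apply: contraNneq WneU => e; rewrite eqEdim WU e leqnn.
by have [D irrD DW] := IHd W ltd sW W0; exists D => //; apply: subv_trans WU.
Qed.

Lemma irr_decomp_exists U : submod U -> exists k (D : 'I_k -> {vspace V}), irr_decomp D U.
Proof.
have [d] := ubnP (\dim U); elim: d U => // d IHd U dU sU.
have [->|U0] := eqVneq U 0%VS.
  exists 0%N, (fun=> 0%VS); split=> [[]//||]; last by rewrite big_ord0.
  by apply/directvP; rewrite /= !big_ord0 dimv0.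
have [D0 irrD0 D0U] := irred_sub sU U0; have [sD0 D00 _] := irrD0.
have [W sW [DW cap0]] := complement_in sU sD0 D0U.
have dW : (\dim W < d)%N.
  have := dimv_disjoint_sum cap0; rewrite DW; move: dU D00; rewrite -dimv_eq0.
  by lia.
have [k [D [irrD dirD sumD]]] := IHd W dW sW.
pose E (i : 'I_k.+1) := if unlift ord0 i is Some j then D j else D0.
have E0 : E ord0 = D0 by rewrite /E unlift_none.
have EL j : E (lift ord0 j) = D j by rewrite /E liftK.
exists k.+1, E; split.
- by move=> i; rewrite /E; case: unlift.
- apply/directvP => /=; rewrite !big_ord_recl E0.
  rewrite (eq_bigr D) // dimv_disjoint_sum ?sumD //; congr (_ + _)%N.
  rewrite -sumD (directvP dirD) /=; apply: eq_bigr => j _.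
  by rewrite EL.
- by rewrite big_ord_recl E0 (eq_bigr D) // sumD.
Qed.

Lemma cyclic w : exists U, forall u, u \in U <-> exists2 X, A X & u = X *m w.
Proof.
apply: vspace_of_pred => [|c u u' [X AX ->] [X' AX' ->]].
  by exists (0 *: 1%:M); [apply: AZ | rewrite scale0r mul0mx].
exists (c *: X + X'); first by apply: AD => //; apply: AZ.
by rewrite mulmxDl scalemxAl.
Qed.

Lemma irred_cyclic W w u : irred W -> w \in W -> w != 0 -> u \in W -> exists2 X, A X & u = X *m w.
Proof.
move=> [sW W0 minW] wW w0 uW; have [U UP] := cyclic w.
have sU : submod U.
  move=> X AX u' /UP[Y AY ->]; apply/UP; exists (X *m Y); first exact: AM.
  by rewrite mulmxA.
have wU : w \in U by apply/UP; exists 1%:M; rewrite ?mul1mx.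
have UW : (U <= W)%VS by apply/subvP => u' /UP[X AX ->]; apply: sW.
case: (minW U sU UW) => UE; last by apply/UP; rewrite UE.
by move: wU; rewrite UE memv0 (negPf w0).
Qed.

Lemma irred_generated W w : irred W -> w \in W -> w != 0 -> generated W w.
Proof.
move=> irrW wW w0; have [sW _ _] := irrW; split=> // U sU wU.
apply/subvP => u uW; have [X AX ->] := irred_cyclic irrW wW w0 uW.
exact: sU.
Qed.

(** * Irreducible modules detected by an idempotent *)

Section Idempotent.
Variable e : 'M[C]_n.
Hypothesis Ae : A e.
Hypothesis e_idem : e *m e = e.
Hypothesis e_line : forall X w, A X -> e *m w = w -> e *m (X *m w) \in <[w]>%VS.

(** Every fixed vector is an eigenvector of the compression of [X]; comparing [w0], [w] and [w0 + w]
    forces equal eigenvalues unless [w] is a multiple of [w0], where they agree anyway. *)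
Lemma e_scalar X : A X -> exists c, forall w, e *m w = w -> e *m (X *m w) = c *: w.
Proof.
move=> AX; have [[w0 [w00 ew0]]|none] := pselect (exists w, w != 0 /\ e *m w = w); last first.
  exists 0 => w ew; have [->|w0] := eqVneq w 0; first by rewrite !mulmx0 scaler0.
  by case: none; exists w.
have /vlineP[c cE] := e_line AX ew0; exists c => w ew.
have /vlineP[d dE] := e_line AX ew.
have ews : e *m (w0 + w) = w0 + w by rewrite mulmxDr ew0 ew.
have /vlineP[f] := e_line AX ews; rewrite !mulmxDr cE dE scalerDr => fE.
have fE' : (c - f) *: w0 = (f - d) *: w.
  by rewrite !scalerBl; apply/eqP; rewrite subr_eq addrAC eq_sym subr_eq addrC -fE addrC.
have [fd|fd] := eqVneq (f - d) 0.
  move: fE'; rewrite fd scale0r => /eqP; rewrite scaler_eq0 (negPf w00) orbF subr_eq0.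
  by move=> /eqP ->; move/eqP: fd; rewrite subr_eq0 => /eqP ->.
have wE : w = ((f - d)^-1 * (c - f)) *: w0 by rewrite -scalerA fE' scalerK.
by rewrite -dE [in LHS]wE -!scalemxAr cE scalerA mulrC -scalerA -wE.
Qed.

Definition elin : 'End(V) := linfun (mulmx e).

Lemma elinE w : elin w = e *m w. Proof. by rewrite lfunE. Qed.

Lemma elin_fix D w : w \in (elin @: D)%VS -> e *m w = w.
Proof. by move=> /memv_imgP[u _ ->]; rewrite elinE mulmxA e_idem. Qed.

Lemma elin_sub D : submod D -> (elin @: D <= D)%VS.
Proof. by move=> sD; apply/subvP => w /memv_imgP[u uD ->]; rewrite elinE sD. Qed.

Lemma dim_elin_irred D w : irred D -> w \in D -> w != 0 -> e *m w = w -> \dim (elin @: D) = 1%N.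
Proof.
move=> irrD wD w0 ew; rewrite (_ : (elin @: D)%VS = <[w]>%VS) ?dim_vline ?w0 //.
apply/eqP; rewrite eqEsubv; apply/andP; split; last first.
  by rewrite -memvE -ew -elinE memv_img.
apply/subvP => u /memv_imgP[u' u'D ->]; rewrite elinE.
by have [X AX ->] := irred_cyclic irrD wD w0 u'D; apply: e_line.
Qed.

(** If [X] did not kill [w], irreducibility would give [w = Y *m (X *m w)]. The scalar of [Y *m X]
    after compression by [e] is 0, as seen on [w'], so [w] would be 0. *)
Lemma annihilator_sub W w w' X : irred W -> w \in W -> e *m w = w -> e *m w' = w' ->
  w' != 0 -> A X -> X *m w' = 0 -> X *m w = 0.
Proof.
move=> irrW wW ew ew' w'0 AX Xw'; apply/eqP/negPn/negP => Xw0.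
have [sW _ _] := irrW; have XwW : X *m w \in W by apply: sW.
have [Y AY wE] := irred_cyclic irrW XwW Xw0 wW.
have [c cE] := e_scalar (AM AY AX).
have := cE _ ew'; rewrite -mulmxA Xw' !mulmx0 => /esym/eqP; rewrite scaler_eq0 (negPf w'0) orbF.
move=> /eqP c0; have := cE _ ew; rewrite -mulmxA -wE ew c0 scale0r => w0.
by rewrite w0 mulmx0 eqxx in Xw0.
Qed.

(** Fixed vectors have the same annihilator in [A], so sending [X *m w'] to [X *m w] is well defined
    and injective. *)
Lemma iso_of_fixed D W w w' : irred D -> irred W -> w' \in D -> w' != 0 -> e *m w' = w' ->
  w \in W -> w != 0 -> e *m w = w -> iso D W.
Proof.
move=> irrD irrW w'D w'0 ew' wW w0 ew; have [sD _ _] := irrD; have [sW _ _] := irrW.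
have ann X : A X -> X *m w' = 0 -> X *m w = 0.
  by move=> AX; apply: (annihilator_sub irrW wW ew ew' w'0 AX).
have ann' X : A X -> X *m w = 0 -> X *m w' = 0.
  by move=> AX; apply: (annihilator_sub irrD w'D ew' ew w0 AX).
pose b := vbasis D.
have /fin_all_exists[G GP] (j : 'I_(\dim D)) : exists X, A X /\ b`_j = X *m w'.
  have [|X AX XE] := irred_cyclic irrD w'D w'0 (_ : b`_j \in D); last by exists X.
  by apply: vbasis_mem; apply: mem_nth; rewrite size_tuple.
(* The map is prescribed on a basis of [D] through the chosen [G]; coordinates along it are linear
   on all of [V], which extends the map. *)
pose f0 u := \sum_j coord b j u *: (G j *m w).
have f0_lin : linear f0.
  move=> c u u'; rewrite /f0 scaler_sumr -big_split /=; apply: eq_bigr => j _.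
  by rewrite linearP scalerDl scalerA.
pose f0L : {linear V -> V} := HB.pack f0 (GRing.isLinear.Build _ _ _ _ f0 f0_lin).
pose f : 'End(V) := linfun f0L.
have fE X : A X -> f (X *m w') = X *m w.
  move=> AX; rewrite lfunE /= /f0; apply/esym/eqP; rewrite -subr_eq0.
  pose Y := X - \sum_j coord b j (X *m w') *: G j.
  have -> : X *m w - \sum_j coord b j (X *m w') *: (G j *m w) = Y *m w.
    by rewrite mulmxBl mulmx_suml; congr (_ - _); apply: eq_bigr => j _; rewrite scalemxAl.
  apply/eqP/ann; last first.
    rewrite mulmxBl mulmx_suml; apply/eqP; rewrite subr_eq0; apply/eqP.
    rewrite [LHS](coord_vbasis (sD _ AX _ w'D)); apply: eq_bigr => j _.
    by rewrite -scalemxAl; case: (GP j) => _ <-.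
  rewrite /Y; apply: AD => //; rewrite -scaleN1r; apply: AZ.
  elim/big_ind: _ => [||j _]; [by rewrite -(scale0r 1%:M); apply: AZ | by move=> *; apply: AD |].
  by apply: AZ; case: (GP j).
exists f; split.
- apply/vspaceP => u; apply/memv_imgP/idP => [[u' u'D ->]|uW].
    by have [X AX ->] := irred_cyclic irrD w'D w'0 u'D; rewrite fE // sW.
  have [X AX ->] := irred_cyclic irrW wW w0 uW.
  by exists (X *m w'); rewrite ?fE // sD.
- apply/eqP; rewrite -subv0; apply/subvP => u; rewrite memv_cap memv_ker memv0 => /andP[uD].
  have [X AX ->] := irred_cyclic irrD w'D w'0 uD.
  by rewrite fE // => /eqP/(ann' _ AX) ->.
- move=> X AX u uD; have [Y AY ->] := irred_cyclic irrD w'D w'0 uD.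
  by rewrite mulmxA !fE ?mulmxA //; apply: AM.
Qed.

Lemma fixed_of_iso D W w : iso D W -> submod D -> w \in W -> w != 0 -> e *m w = w ->
  exists w', [/\ w' \in D, w' != 0 & e *m w' = w'].
Proof.
move=> [f [fD _ fX]] sD wW w0 ew; move: wW; rewrite -fD => /memv_imgP[u uD wE].
exists (e *m u); split; first exact: sD.
- by apply: contra w0 => /eqP eu; rewrite -ew wE -fX // eu linear0.
- by rewrite mulmxA e_idem.
Qed.

Lemma directv_subfamily (I : finType) (D E : I -> {vspace V}) : (forall i, (E i <= D i)%VS) ->
  directv (\sum_i D i) -> directv (\sum_i E i).
Proof.
move=> ED /directv_sum_independent ind; apply/directv_sum_independent => us usE.
by apply: ind => i iP; apply: (subvP (ED i)); apply: usE.
Qed.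

(** Applying [e] to the decomposition splits the image of [e] into lines for the summands isomorphic
    to [W] and 0 for the others: a nonzero piece contains a fixed vector, and [iso_of_fixed]
    applies. *)
Theorem multiplicity k (D : 'I_k -> {vspace V}) W w : irr_decomp D fullv ->
  irred W -> w \in W -> w != 0 -> e *m w = w ->
  #|[set i | `[< iso (D i) W >]]| = \dim (elin @: fullv).
Proof.
move=> [irrD dirD sumD] irrW wW w0 ew.
have dirE : directv (\sum_i (elin @: D i)).
  by apply: directv_subfamily dirD => i; apply: elin_sub; case: (irrD i).
rewrite -sumD limg_sum (directvP dirE) /= -sum1_card big_mkcond /=.
apply: eq_bigr => i _; rewrite inE; case: asboolP => [isoDW|niso].
  have [sD _ _] := irrD i; have [w' [w'D w'0 ew']] := fixed_of_iso isoDW sD wW w0 ew.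
  by rewrite (dim_elin_irred (irrD i) w'D).
apply/esym/eqP; rewrite dimv_eq0; apply/eqP.
apply/eqP; rewrite -subv0; apply/subvP => w' w'E; rewrite memv0.
apply/negPn/negP => w'0; apply: niso.
have [sD _ _] := irrD i; have w'D := subvP (elin_sub sD) _ w'E.
exact: (iso_of_fixed (irrD i) irrW w'D w'0 (elin_fix w'E) wW).
Qed.

Theorem exists_fixed_irred : (0 < \dim (elin @: fullv))%N ->
  exists W w, [/\ irred W, w \in W, w != 0 & e *m w = w].
Proof.
have [|k [D [irrD dirD sumD]]] := @irr_decomp_exists fullv; first by move=> *; rewrite memvf.
rewrite -sumD limg_sum lt0n dimv_eq0 => n0.
have [i Ei] : exists i, (elin @: D i)%VS != 0%VS.
  apply/existsP; apply: contraNT n0; rewrite negb_exists => /forallP all0.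
  by apply/eqP/big1 => i _; apply/eqP; have := all0 i; rewrite negbK.
have [sD _ _] := irrD i; have wE := memv_pick (elin @: D i)%VS.
exists (D i), (vpick (elin @: D i)%VS); split=> //.
- exact: subvP (elin_sub sD) _ wE.
- by rewrite vpick0.
- exact: elin_fix wE.
Qed.

End Idempotent.
End StarAlgebra.

(** * Counting matrices of a given type *)

Section Counting.
Variables (F : finFieldType) (N : nat) (mu : {ffun 'I_N -> bool}) (la : {set 'I_N}).
Hypothesis muT : forall m, mu m -> m \in la.

Let p (m : 'I_N) := ~~ mu m && (m \in la).
Hypothesis walk : forall k, (k <= N)%N -> (below mu k <= below p k)%N.

Notation q := #|F|.
(** Lattice path with an up-step at each index of [la] outside [mu] and a down-step at each index of
    [mu]; the truncated subtraction is exact by [walk]. By [rk_partial] it is the corner rank forced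
    by the type. *)
Definition height k : nat := (below p k - below mu k)%N.

Lemma heightT (k : 'I_N) : mu k -> height k = (height k.+1).+1.
Proof.
move=> muk; have := walk (ltn_ord k); rewrite /height !belowS /p muk /=.
by lia.
Qed.

Lemma heightS (k : 'I_N) : ~~ mu k -> height k.+1 = (height k + (k \in la))%N.
Proof.
move=> /[dup] muk /negPf muk'; have := walk (ltnW (ltn_ord k));
  rewrite /height !belowS /p muk muk' /=.
by lia.
Qed.

(** Pivots below [k] depend only on rows below [k], so the type can be checked while the matrix is
    filled row by row; the rows from [k] on are still 0. *)
Definition partial k : {set 'M[F]_N} := [set M | [&& supported mu M,
  [forall s : 'I_N, (k <= s)%N ==> (row s M == 0)] &
  [forall m : 'I_N, (m < k)%N ==> (pivot M m == (m \in la))]]].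

Lemma partialP k M : reflect [/\ supported mu M, forall s t : 'I_N, (k <= s)%N -> M s t = 0 &
  forall m : 'I_N, (m < k)%N -> pivot M m = (m \in la)] (M \in partial k).
Proof.
rewrite inE; apply: (iffP and3P) => [[sM /forallP r0 /forallP pv]|[sM r0 pv]]; split=> //.
- by move=> s t ks; have /implyP/(_ ks)/eqP/rowP/(_ t) := r0 s; rewrite !mxE.
- by move=> m mk; have /implyP/(_ mk)/eqP := pv m.
- by apply/forallP => s; apply/implyP => ks; apply/eqP/rowP => t; rewrite !mxE r0.
- by apply/forallP => m; apply/implyP => mk; rewrite pv.
Qed.

Lemma rk_partial k M : (k <= N)%N -> M \in partial k -> rk k k M = height k.
Proof.
move=> kN /partialP[sM _ pv]; have := rk_diag sM kN.
have -> : below (fun m => mu m && pivot M m) k = below mu k.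
  apply: eq_card => m; rewrite !inE; case: (ltnP m k) => //= mk.
  by case: (boolP (mu m)) => //= /muT mla; rewrite pv.
have -> : below (fun m => ~~ mu m && pivot M m) k = below p k.
  apply: eq_card => m; rewrite !inE; case: (ltnP m k) => //= mk.
  by rewrite /p pv.
by rewrite /height => <-; rewrite addnK.
Qed.

Definition PT k : 'M[F]_N := diag_mx (\row_t (mu t && (k <= t)%N)%:R).

Lemma sub_PT n (U : 'M[F]_(n, N)) k : reflect (forall i t, U i t != 0 -> mu t && (k <= t)%N) (U <= PT k)%MS.
Proof.
apply: (iffP submxP) => [[D ->] i t|h].
  by rewrite mul_mx_diag !mxE; case: (_ && _) => //; rewrite mulr0 eqxx.
exists U; apply/matrixP => i t; rewrite mul_mx_diag !mxE.
have [->|/h ->] := eqVneq (U i t) 0; by rewrite ?mul0r ?mulr1.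
Qed.

(** The comparison is between row spaces: [U], with any number of rows, stands for a subspace. *)
Definition fillings n k (U : 'M[F]_(n, N)) : nat := #|[set M in partial k | (corner k k M == U)%MS]|.

Lemma fillings0 n (U : 'M[F]_(n, N)) : \rank U = 0%N -> fillings 0 U = 1%N.
Proof.
move=> /eqP; rewrite mxrank_eq0 => /eqP ->; rewrite /fillings -(cards1 (0 : 'M[F]_N)).
congr #|pred_of_set _|; apply/setP => M; rewrite in_set in_set1;
  apply/andP/eqP => [[/partialP[_ r0 _] _]|->].
  by apply/matrixP => s t; rewrite mxE r0.
split.
  apply/partialP; split=> // [|s t _]; last by rewrite mxE.
  by apply/forallP => s; apply/forallP => t; rewrite mxE eqxx.
suff -> : corner 0 0 (0 : 'M[F]_N) = 0 by rewrite !sub0mx.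
by apply/matrixP => s t; rewrite !mxE.
Qed.

Lemma partialT (k : 'I_N) M : mu k ->
  (M \in partial k.+1) = (M \in partial k) && pivot M k.
Proof.
move=> muk; apply/partialP/andP => [[sM r0 pv]|[/partialP[sM r0 pv] pk]]; last first.
  split=> // [s t ks|m]; first by rewrite r0 // ltnW.
  by rewrite ltnS leq_eqVlt => /orP[/eqP/val_inj->|/pv//]; rewrite pk muT.
split; last by rewrite pv ?muT.
apply/partialP; split=> // [s t|m mk]; last by rewrite pv // ltnW.
rewrite leq_eqVlt => /orP[/eqP/val_inj<-|]; last exact: r0.
by rewrite (supported_eq0 sM) ?muk.
Qed.

(** No row is added, and losing column [k] must lower the rank by one. The old row space lies in [U]
    plus the line of [delta_mx 0 k], which has the same dimension, so [U] determines it. *)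
Lemma fillingsT n (k : 'I_N) (U : 'M[F]_(n, N)) : mu k -> (U <= PT k.+1)%MS -> \rank U = height k.+1 ->
  let U' := (U + (delta_mx 0 k : 'rV[F]_N))%MS in
  [/\ fillings k.+1 U = fillings k U', (U' <= PT k)%MS & \rank U' = height k].
Proof.
move=> muk UP rU U'; set e := (delta_mx 0 k : 'rV[F]_N) in U' *.
have eP : e *m Pcol F N k.+1 = 0.
  apply/rowP => t; rewrite mul_mx_diag !mxE; case: (eqVneq t k) => [->|];
    last by rewrite andbF mul0r.
  by rewrite ltnn mulr0.
have UPc : U *m Pcol F N k.+1 = U.
  apply/matrixP => i t; rewrite mul_mx_diag !mxE.
  have [->|/(elimT (sub_PT _ _) UP)/andP[_ ->]] := eqVneq (U i t) 0; by rewrite ?mul0r ?mulr1.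
have U'P : (U' <= PT k)%MS.
  rewrite addsmx_sub; apply/andP; split; apply/sub_PT => i t.
    by move/(elimT (sub_PT _ _) UP) => /andP[-> /ltnW].
  rewrite mxE; case: (eqVneq t k) => [->|]; rewrite ?andbF ?eqxx // => _.
  by rewrite muk leqnn.
have U'Pc : (U' *m Pcol F N k.+1 :=: U)%MS.
  by apply: eqmx_trans (addsmxMr _ _ _) _; rewrite UPc eP; apply: addsmx0.
have cap0 : (U :&: e)%MS = 0.
  apply/eqP; rewrite -submx0; apply/rV_subP => a; rewrite sub_capmx => /andP[aU /submxP[d aE]].
  rewrite aE; have : d *m e *m Pcol F N k.+1 = d *m e.
    rewrite -aE; have /submxP[d' ->] := aU.
    by rewrite -mulmxA UPc.
  by rewrite -mulmxA eP mulmx0 => <-; apply: sub0mx.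
have rU' : \rank U' = height k.
  rewrite /U' mxrank_disjoint_sum // rU heightT // (_ : \rank e = 1%N) ?addn1 //.
  by rewrite /e mxrank_delta.
split=> //; congr #|pred_of_set _|; apply/setP => M; rewrite !inE -!in_set.
have cE : supported mu M -> corner k.+1 k.+1 M = corner k k M *m Pcol F N k.+1.
  move=> sM; rewrite corner_mulr //; apply/matrixP => s t; rewrite !mxE ltnS leq_eqVlt val_eqE.
  by case: (eqVneq s k) => [->|//] /=; rewrite (supported_eq0 sM) ?muk // !if_same.
have := partialT M muk; rewrite !inE => ->; rewrite -andbA.
case: (boolP (M \in partial k)) => [Mk|]; last by rewrite inE => /negPf ->.
have /partialP[sM _ _] := Mk; move: (Mk); rewrite inE => -> /=.
have rM := rk_partial (ltnW (ltn_ord k)) Mk.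
have KU : (corner k k M <= corner k.+1 k.+1 M + e)%MS.
  apply/row_subP => i.
  rewrite (_ : row i _ = row i (corner k.+1 k.+1 M) + (corner k k M i k) *: e).
    by rewrite addmx_sub_adds ?row_sub ?scalemx_sub.
  rewrite (cE sM); apply/rowP => t; rewrite row_mul mul_mx_diag !mxE eqxx /=.
  case: (ltngtP k t) => [kt|tk|/val_inj <-];
    rewrite ?mulr1 ?mulr0 ?addr0 ?eqxx ?mulr1 ?add0r ?andbT ?leqnn ?andbT //.
  - by rewrite (_ : t == k = false) ?mulr0 ?addr0 // -val_eqE gtn_eqF.
  - by rewrite andbF (_ : t == k = false) ?mulr0 // -val_eqE ltn_eqF.
apply/idP/idP => [/andP[_ KU1e]|KU'e].
  have KU1 := eqmxP KU1e.
  have KU' : (corner k k M <= U')%MS.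
    by apply: submx_trans KU _; rewrite addsmxS ?KU1.
  by rewrite -(eq_leqif (mxrank_leqif_eq KU')) -/(rk k k M) rM rU'.
have KU' := eqmxP KU'e.
have KU1 : (corner k.+1 k.+1 M :=: U)%MS.
  by rewrite (cE sM); apply: eqmx_trans U'Pc; apply: eqmxMr.
apply/andP; split; last exact/eqmxP.
by rewrite /pivot rM /rk KU1 rU heightT // neq_ltn ltnSn orbT.
Qed.


Definition ext (k : 'I_N) (M : 'M[F]_N) (b : 'rV[F]_N) : 'M[F]_N := M + delta_mx k 0 *m b.

Lemma extE (k : 'I_N) M b i j : ext k M b i j = M i j + (i == k)%:R * b 0 j.
Proof. by rewrite !mxE big_ord1 mxE eqxx andbT. Qed.

Lemma corner_ext_small (k : 'I_N) M b a c : (a <= k)%N -> corner a c (ext k M b) = corner a c M.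
Proof.
move=> ak; apply/matrixP => i j; rewrite [LHS]mxE [RHS]mxE extE.
case: (ltnP i a) => //= ia; rewrite (_ : i == k = false) ?mul0r ?addr0 //.
by rewrite -val_eqE ltn_eqF // (leq_trans ia).
Qed.

Lemma corner_ext (k : 'I_N) M b : ~~ mu k -> M \in partial k -> (b <= PT k.+1)%MS ->
  (corner k.+1 k.+1 (ext k M b) :=: corner k k M + b)%MS.
Proof.
move=> muk /partialP[sM r0 _] /sub_PT bP.
have rowi (i : 'I_N) : (i < k)%N -> row i (corner k.+1 k.+1 (ext k M b)) = row i (corner k k M).
  move=> ik; apply/rowP => j; rewrite mxE [LHS]mxE extE !mxE ltnS (ltnW ik) ik /=.
  rewrite (_ : i == k = false) ?mul0r ?addr0; last by rewrite -val_eqE ltn_eqF.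
  rewrite [(k <= j)%N]leq_eqVlt val_eqE; case: (eqVneq k j) => [<-|//] /=.
  by rewrite ltnn (supported_eq0 sM) // muk orbT.
have rowk : row k (corner k.+1 k.+1 (ext k M b)) = b.
  apply/rowP => j; rewrite mxE [LHS]mxE extE eqxx mul1r ltnSn /= r0 // add0r.
  by case: ifP => // kj; apply/esym/eqP/negP => /negP/bP/andP[_]; rewrite kj.
have rowi0 (i : 'I_N) : (k < i)%N -> row i (corner k.+1 k.+1 (ext k M b)) = 0.
  by move=> ki; apply/rowP => j; rewrite !mxE ltnS leqNgt ki.
apply/eqmxP/andP; split.
  apply/row_subP => i; case: (ltngtP i k) => [ik|ki|/val_inj->].
  - by rewrite rowi // (submx_trans (row_sub _ _)) // addsmxSl.
  - by rewrite rowi0 // sub0mx.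
  - by rewrite rowk addsmxSr.
rewrite addsmx_sub -{2}rowk row_sub andbT; apply/row_subP => i.
have [ik|ki] := ltnP i k; first by rewrite -rowi // row_sub.
rewrite (_ : row i _ = 0) ?sub0mx //; apply/rowP => j; rewrite !mxE.
by rewrite ltnNge ki.
Qed.

(** Column [k] is 0, so [k] becomes a pivot iff the new row enlarges the row space of the corner. *)
Lemma ext_partial (k : 'I_N) M b : ~~ mu k -> M \in partial k -> (b <= PT k.+1)%MS ->
  (ext k M b \in partial k.+1) = ((b <= corner k k M)%MS == (k \notin la)).
Proof.
move=> muk Mk bP; have /partialP[sM r0 pv] := Mk; have /sub_PT bP' := bP.
have sE : supported mu (ext k M b).
  apply/supportedP => s t; rewrite extE; case: (eqVneq s k) => [->|_].
    rewrite r0 // add0r mul1r => /bP'/andP[-> kt].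
    by split=> //; apply: negPf.
  by rewrite mul0r addr0 => /(supported_nz sM)[/negPf].
have pE (m : 'I_N) : (m < k)%N -> pivot (ext k M b) m = pivot M m.
  by move=> mk; rewrite /pivot /rk !corner_ext_small // ltnW.
have pk : pivot (ext k M b) k = ~~ (b <= corner k k M)%MS.
  rewrite /pivot /rk corner_ext_small // (corner_ext muk Mk bP); congr (~~ _).
  rewrite (mxrank_leqif_sup (addsmxSl _ _)) addsmx_sub submx_refl.
  by [].
apply/partialP/eqP => [[_ _ pv']|bk].
  by rewrite -pv' // pk negbK.
split=> // [s t ks|m].
  rewrite extE r0 ?(ltnW ks) // (_ : s == k = false) ?mul0r ?addr0 //.
  by rewrite -val_eqE gtn_eqF.
by rewrite ltnS leq_eqVlt => /orP[/eqP/val_inj->|mk]; rewrite ?pk ?bk ?negbK // pE // pv.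
Qed.

Lemma partialS_ext (k : 'I_N) M' : ~~ mu k -> M' \in partial k.+1 ->
  exists M b, [/\ M \in partial k, (b <= PT k.+1)%MS & M' = ext k M b].
Proof.
move=> muk /partialP[sM r0 pv]; pose b := row k M'; pose M := M' - delta_mx k 0 *m b.
have ME i j : M i j = if i == k then 0 else M' i j.
  rewrite !mxE big_ord1 !mxE eqxx andbT; case: (eqVneq i k) => [->|_].
    by rewrite mul1r subrr.
  by rewrite mul0r subr0.
have M'E : M' = ext k M b by rewrite /ext subrK.
exists M, b; split=> //; last first.
  apply/sub_PT => i t; rewrite mxE => /(supported_nz sM)[_ -> ->] //.
apply/partialP; split.
- by apply/supportedP => s t; rewrite ME; case: ifP;
  rewrite ?eqxx // => _ /(supported_nz sM)[/negPf].
- move=> s t; rewrite ME leq_eqVlt eq_sym val_eqE; case: ifP => //= _ ks.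
  by rewrite r0.
- move=> m mk; rewrite -pv ?ltnS 1?ltnW //.
  have e a c : (a <= k)%N -> corner a c M' = corner a c M.
    by move=> ak; rewrite [in LHS]M'E corner_ext_small.
  by rewrite /pivot /rk !e // ltnW.
Qed.

Lemma ext_inj (k : 'I_N) M M' b b' : M \in partial k -> M' \in partial k ->
  ext k M b = ext k M' b' -> M = M' /\ b = b'.
Proof.
move=> /partialP[_ r0 _] /partialP[_ r0' _] e.
have bb : b = b'.
  apply/rowP => j; have /matrixP/(_ k j) := e.
  by rewrite !extE eqxx !mul1r r0 // r0' // !add0r.
by split=> //; move: e; rewrite bb => /addIr.
Qed.

Lemma fillings_pairs n (k : 'I_N) (U : 'M[F]_(n, N)) : ~~ mu k -> (U <= PT k.+1)%MS ->
  fillings k.+1 U = #|[set Mb : 'M[F]_N * 'rV[F]_N | [&& Mb.1 \in partial k,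
    (Mb.2 <= corner k k Mb.1)%MS == (k \notin la) & (corner k k Mb.1 + Mb.2 == U)%MS]]|.
Proof.
move=> muk UP; set P := [set Mb | _].
have bP (Mb : 'M[F]_N * 'rV[F]_N) : Mb \in P -> (Mb.2 <= PT k.+1)%MS.
  rewrite inE => /and3P[_ _ /eqmxP e]; apply: submx_trans UP.
  by rewrite -e addsmxSr.
rewrite /fillings -(card_in_imset (_ : {in P &, injective (fun Mb => ext k Mb.1 Mb.2)}));
  last first.
  move=> [M b] [M' b']; rewrite inE => /and3P[/= Mk _ _]; rewrite inE => /and3P[/= Mk' _ _].
  by move=> /(ext_inj Mk Mk')[-> ->].
apply: eq_card => M'; apply/setIdP/imsetP => [[M'k M'U]|[[M b] Mb ->]].
  have [M [b [Mk bPT M'E]]] := partialS_ext muk M'k; exists (M, b) => //=.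
  rewrite inE /= Mk -(ext_partial muk Mk bPT) -M'E M'k /=.
  by apply/eqmxP; apply: eqmx_trans (eqmx_sym (corner_ext muk Mk bPT)) _; rewrite -M'E; apply/eqmxP.
have bPT := bP _ Mb; move: Mb; rewrite inE /= => /and3P[Mk bk e].
split; first by rewrite ext_partial.
by apply/eqmxP; apply: eqmx_trans (corner_ext muk Mk bPT) _; apply/eqmxP.
Qed.

(** The new row must lie in the old row space, which is therefore already [U]. *)
Lemma fillingsN n (k : 'I_N) (U : 'M[F]_(n, N)) : ~~ mu k -> k \notin la -> (U <= PT k.+1)%MS ->
  fillings k.+1 U = (q ^ \rank U * fillings k U)%N.
Proof.
move=> muk kla UP; rewrite fillings_pairs // kla -card_rowg mulnC -cardsX.
apply: eq_card => -[M b]; rewrite in_setX mem_rowg [LHS]inE /=;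
  apply/and3P/andP => [[Mk /eqP bK /eqmxP e]|].
  have KU := eqmx_trans (eqmx_sym (addsmx_idPl bK)) e.
  by rewrite -KU bK; split=> //; apply/setIdP; split=> //; apply/eqmxP.
move=> [/setIdP[Mk /eqmxP KU]]; rewrite -KU => bK; split; rewrite ?bK //.
by apply/eqmxP; apply: eqmx_trans (addsmx_idPl bK) KU.
Qed.

Lemma card_hyperplanes n (k : 'I_N) (U : 'M[F]_(n, N)) c :
  (U <= PT k)%MS -> \rank U = (height k).+1 ->
  (forall n' (W : 'M[F]_(n', N)), (W <= PT k)%MS -> \rank W = height k -> fillings k W = c) ->
  (q.-1 * #|[set M in partial k | (corner k k M <= U)%MS]| = (q ^ (height k).+1).-1 * c)%N.
Proof.
move=> UP rU fc; set S := [set M in _ | _]; set r := height k in rU fc *.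
(* Double counting of the pairs (M, g) with M in S and g a nonzero functional on
   the row space of U whose kernel is the row space of the corner of M. *)
pose B := row_base U; have Bfree : row_free B := row_base_free U.
pose nz := [set~ (0 : 'rV[F]_(\rank U))].
pose Kg (g : 'rV[F]_(\rank U)) := kermx g^T *m B.
have KgU g : (Kg g <= U)%MS by apply: submx_trans (submxMl _ _) _; rewrite (eq_row_base U).
have rKg g : g \in nz -> \rank (Kg g) = r.
  rewrite !inE => g0; rewrite mxrankMfree // mxrank_ker mxrank_tr rank_rV g0.
  by rewrite rU subn1.
have cnz : #|nz| = (q ^ r.+1).-1.
  by rewrite cardsC1 card_mx mul1n rU.
have -> : ((q ^ r.+1).-1 * c = \sum_(g in nz) \sum_(M in partial k | (corner k k M == Kg g)%MS) 1)%N.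
  rewrite -cnz -sum_nat_const; apply: eq_bigr => g gnz; rewrite -(fc _ (Kg g)) ?rKg //.
    by rewrite sum1dep_card.
  exact: submx_trans (KgU g) UP.
rewrite (exchange_big_dep (mem S)) /=; last first.
  move=> g M gnz /andP[Mk /eqmxP e]; rewrite inE; apply/andP; split=> //.
  by rewrite e KgU.
rewrite mulnC -sum_nat_const; apply: eq_bigr => M /setIdP[Mk KU].
pose G := corner k k M *m pinvmx B.
have GB : G *m B = corner k k M by rewrite mulmxKpV // (eq_row_base U).
have rG : \rank G = r.
  by rewrite -(mxrankMfree _ Bfree) GB -/(rk k k M) rk_partial // ltnW.
(* The functionals vanishing on the row space of the corner form a line, whence the factor q - 1. *)
have kerE g : g \in nz -> (corner k k M == Kg g)%MS = (g <= kermx G^T)%MS.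
  move=> gnz; rewrite (sameP sub_kermxP eqP) -(inj_eq trmx_inj) trmx_mul trmxK trmx0.
  rewrite -(sameP sub_kermxP eqP) -(submxMfree _ _ Bfree) GB.
  apply/idP/idP => [/eqmxP ->//|KK].
  by rewrite -(eq_leqif (mxrank_leqif_eq KK)) -GB mxrankMfree // rG rKg.
rewrite sum1dep_card (eq_card (_ : _ =i rowg (kermx G^T) :\ 0)); last first.
  move=> g; rewrite inE in_setD1 mem_rowg; have [->|g0] := eqVneq g 0.
    by rewrite !inE eqxx.
  have gnz : g \in nz by rewrite !inE.
  by rewrite gnz Mk /= kerE.
have := cardsD1 (0 : 'rV[F]_(\rank U)) (rowg (kermx G^T)).
have e1 : (\rank U - r = 1)%N by rewrite rU subSnn.
by rewrite mem_rowg sub0mx card_rowg mxrank_ker mxrank_tr rG e1 expn1 => ->.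
Qed.

(** The old row space is a hyperplane of [U], and the new row lies in [U] outside it. The q - 1 in
    the number of such rows cancels the denominator in the number of hyperplanes; [card_hyperplanes]
    is a product formula to avoid that division. *)
Lemma fillingsP n (k : 'I_N) (U : 'M[F]_(n, N)) c : ~~ mu k -> k \in la -> (U <= PT k.+1)%MS ->
  \rank U = height k.+1 ->
  (forall n' (W : 'M[F]_(n', N)), (W <= PT k)%MS -> \rank W = height k -> fillings k W = c) ->
  fillings k.+1 U = ((q ^ (height k).+1).-1 * q ^ height k * c)%N.
Proof.
move=> muk kla UP rU fc; rewrite heightS // kla addn1 in rU.
have UPk : (U <= PT k)%MS.
  by apply/sub_PT => i t /(elimT (sub_PT _ _) UP)/andP[-> /ltnW].
rewrite fillings_pairs // kla /=; set S := [set M in partial k | (corner k k M <= U)%MS].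
have -> : #|[set Mb : 'M[F]_N * 'rV[F]_N | [&& Mb.1 \in partial k,
    (Mb.2 <= corner k k Mb.1)%MS == false & (corner k k Mb.1 + Mb.2 == U)%MS]]| =
    (#|S| * (q.-1 * q ^ height k))%N.
  rewrite -sum1dep_card (eq_bigl (fun Mb : 'M[F]_N * 'rV[F]_N => (Mb.1 \in S) &&
      (Mb.2 \in rowg U :\: rowg (corner k k Mb.1)))); last first.
    move=> [M b] /=; rewrite in_setD !mem_rowg; apply/and3P/and3P => [[Mk /eqP bK /eqmxP e]|].
      by split; rewrite ?bK -?e ?addsmxSr //; apply/setIdP; rewrite -e addsmxSl.
    move=> [/setIdP[Mk KU] nbK bU]; rewrite Mk (negPf nbK); split=> //.
    have KbU : (corner k k M + b <= U)%MS by rewrite addsmx_sub KU bU.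
    rewrite -(eq_leqif (mxrank_leqif_eq KbU)) rU; apply/eqP/anti_leq/andP; split.
      by rewrite -rU mxrankS.
    have := mxrank_leqif_sup (addsmxSl (corner k k M) b).
    rewrite addsmx_sub submx_refl (negPf nbK) -/(rk k k M) rk_partial ?(ltnW (ltn_ord k)) //.
    by move=> /ltn_leqif ->.
  rewrite -(pair_big_dep (mem S) (fun M b => b \in rowg U :\: rowg (corner k k M)) (fun _ _ => 1%N)) /=.
  rewrite -sum_nat_const; apply: eq_bigr => M /setIdP[Mk KU].
  rewrite sum1_card cardsD (setIidPr _) ?rowgS // !card_rowg rU.
  rewrite -/(rk k k M) rk_partial ?(ltnW (ltn_ord k)) // expnS -{2}[(q ^ _)%N]mul1n -mulnBl.
  by rewrite subn1.
by rewrite mulnA [(#|S| * _)%N]mulnC (card_hyperplanes UPk rU fc) mulnAC.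
Qed.

(** The factor at [s] is the ratio between the numbers of fillings with prescribed row space after
    and before row [s], rather than the number of choices for that row; indices of [mu] contribute
    1. *)
Definition weight k : nat := \prod_(s < N | (s < k)%N && ~~ mu s)
  (q ^ height s * (if s \in la then (q ^ (height s).+1).-1 else 1))%N.

Lemma weightS (k : 'I_N) : weight k.+1 =
  (weight k * (if mu k then 1 else q ^ height k * (if k \in la then (q ^ (height k).+1).-1 else 1)))%N.
Proof.
rewrite /weight big_mkcond [in RHS]big_mkcond (bigD1 k) //= [in RHS](bigD1 k) //= ltnn ltnSn /= mul1n mulnC.
congr (_ * _)%N; last by case: (mu k).
apply: eq_bigr => s sk; rewrite ltnS leq_eqVlt val_eqE (negPf sk) //.
Qed.

Theorem fillings_weight k : (k <= N)%N -> forall n (U : 'M[F]_(n, N)),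
  (U <= PT k)%MS -> \rank U = height k -> fillings k U = weight k.
Proof.
elim: k => [_ n U _ rU|k IHk kN n U UP rU].
  rewrite fillings0 ?rU /height ?below0 // /weight big1 // => s; by rewrite ltn0.
have IH := IHk (ltnW kN); have -> : k.+1 = (Ordinal kN).+1 by [].
rewrite weightS; have [muk|muk] := boolP (mu (Ordinal kN)).
  have [-> U'P rU'] := fillingsT muk UP rU.
  by rewrite muln1 (IH _ _ U'P rU').
have UPk : (U <= PT k)%MS.
  by apply/sub_PT => i t /(elimT (sub_PT _ _) UP)/andP[-> /ltnW].
have [kla|kla] := boolP (Ordinal kN \in la).
  by rewrite (fillingsP muk kla UP rU IH) mulnC [(_.-1 * _)%N]mulnC.
have rUk : \rank U = height k by rewrite rU (heightS muk) (negPf kla) addn0.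
by rewrite (fillingsN muk kla UP) rUk (IH _ _ UPk rUk) muln1 mulnC.
Qed.

Theorem card_pivots : height N = 0%N ->
  #|[set M : 'M[F]_N | supported mu M && [forall m, pivot M m == (m \in la)]]| = weight N.
Proof.
(* The last corner has no columns, so the target row space 0 selects every matrix of the type. *)
move=> hN; rewrite -(fillings_weight (leqnn N) (U := 0 : 'rV[F]_N)) ?sub0mx ?mxrank0 //.
apply: eq_card => M; rewrite inE; apply/andP/setIdP => [[sM /forallP pv]|[/partialP[sM _ pv] _]].
  split.
    apply/partialP; split=> // [s t|m _]; last exact: (eqP (pv m)).
    by rewrite leqNgt ltn_ord.
  suff -> : corner N N M = 0 by rewrite !sub0mx.
  by apply/matrixP => i j; rewrite !mxE [(N <= j)%N]leqNgt !ltn_ord.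
by split=> //; apply/forallP => m; rewrite pv.
Qed.

End Counting.

(** * The projector onto a location and type *)

Section Projector.
Variables (F : finFieldType) (N : nat) (H : vectType F).
Variables (x : 'I_N.+1 -> {vspace H}) (v : N.-tuple H).
Hypothesis xv : adapted_basis x v.
Variables (C : numClosedFieldType) (chi : F -> C).
Hypothesis chiP : nontrivial_additive_character chi.

Implicit Types (mu nu : {ffun 'I_N -> bool}) (y z : {vspace H}) (m n : 'I_N).

Notation loc := (location x).
Notation mf := (matrix_form x v).
Notation nP := #|{: {vspace H}}|.
Notation V := 'cV[C]_nP.
Notation cv := (chi_vec x v chi).
Notation inA := (@inH F N H x C).
Notation L := (Lmx x C).
Notation R := (Rmx x C).
Notation E := (Emx x C).

Lemma inH_sub X Y : inA X -> inA Y -> inA (X - Y).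
Proof. by move=> hX hY; apply: inH_add => //; rewrite -scaleN1r; apply: inH_scale. Qed.

Lemma adjmx_real (X : 'M[C]_nP) (b : 'I_nP -> 'I_nP -> bool) :
  (forall i j, X i j = (b i j)%:R) -> adjmx X = X^T.
Proof. by move=> Xb; apply/matrixP => i j; rewrite mxE mxE [RHS]mxE Xb rmorph_nat. Qed.

Lemma adjmx_Lmx m : adjmx (L m) = R m.
Proof. by apply: (@adjmx_real _ (fun i j => mcovers x m (enum_val j) (enum_val i))) => i j;
  rewrite mxE. Qed.

Lemma adjmx_Rmx m : adjmx (R m) = L m.
Proof.
rewrite (@adjmx_real _ (fun i j => mcovers x m (enum_val i) (enum_val j))) ?trmxK //.
by move=> i j; rewrite mxE mxE.
Qed.

Lemma adjmx_Emx mu : adjmx (E mu) = E mu.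
Proof.
rewrite (@adjmx_real _ (fun i j => (i == j) && (loc (enum_val i) == mu))); last by move=> i j;
  rewrite mxE.
by apply/matrixP => i j; rewrite mxE mxE [RHS]mxE eq_sym; case: (eqVneq i j) => [->|].
Qed.

(** The generators are 0-1 matrices, so the adjoint swaps [Lmx] and [Rmx] and fixes [Emx]. This
    closure feeds [orthogonal_complement]. *)
Lemma inH_adj X : inA X -> inA (adjmx X).
Proof.
elim=> [m|m|mu||a Y _ hY|Y Z _ hY _ hZ|Y Z _ hY _ hZ].
- by rewrite adjmx_Lmx; apply: inH_R.
- by rewrite adjmx_Rmx; apply: inH_L.
- by rewrite adjmx_Emx; apply: inH_E.
- by rewrite /adjmx map_mx1 trmx1; apply: inH_1.
- by rewrite /adjmx map_mxZ linearZ /=; apply: inH_scale.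
- by rewrite /adjmx map_mxD linearD /=; apply: inH_add.
- by rewrite /adjmx map_mxM trmx_mul; apply: inH_mul.
Qed.

Lemma nth_chi_tuple (i : 'I_nP) : (chi_tuple x v chi)`_i = cv (enum_val i).
Proof. by rewrite -tnth_nth tnth_mktuple. Qed.

Lemma chi_expand (u : V) : exists a : {vspace H} -> C, u = \sum_y a y *: cv y.
Proof.
exists (fun y => coord (chi_tuple x v chi) (enum_rank y) u).
rewrite [LHS](coord_basis (chi_basis xv chiP) (memvf u)).
rewrite [RHS](reindex (@enum_val _ {: {vspace H}})) /=; last first.
  by apply: onW_bij; exists enum_rank; [apply: enum_valK | apply: enum_rankK].
by apply: eq_bigr => i _; rewrite enum_valK; congr (_ *: _); apply: nth_chi_tuple.
Qed.

Lemma chi_mx_eq (X Y : 'M[C]_nP) : (forall y, X *m cv y = Y *m cv y) -> forall u : V, X *m u = Y *m u.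
Proof.
move=> XY u; have [a ->] := chi_expand u; rewrite !mulmx_sumr.
by apply: eq_bigr => y _; rewrite -!scalemxAr XY.
Qed.

Definition diagonal (X : 'M[C]_nP) (d : {vspace H} -> C) : Prop :=
  forall y, X *m cv y = d y *: cv y.

Lemma diagonal_mul X Y d d' : diagonal X d -> diagonal Y d' -> diagonal (X *m Y) (fun y => d y * d' y).
Proof. by move=> Xd Yd y; rewrite -mulmxA Yd -scalemxAr Xd scalerA mulrC. Qed.

Lemma diagonal_Emx mu : diagonal (E mu) (fun y => (loc y == mu)%:R).
Proof.
move=> y; apply: colP_rank => z; rewrite mxE (bigD1 (enum_rank z)) //= big1 ?addr0.
  rewrite [E mu _ _]mxE eqxx enum_rankK andTb [RHS]mxE (chi_vecE xv chiP).
  by case: (eqVneq (loc z) (loc y)) => [->|zy]; rewrite ?mulr0.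
by move=> i iz; rewrite mxE eq_sym (negPf iz) mul0r.
Qed.

(* prod_(1 <= j <= J) (1 - X / j) kills every eigenvalue in 1..J and fixes the kernel. *)
Lemma kernel_projector X (t : {vspace H} -> nat) : inA X -> diagonal X (fun y => (t y)%:R) ->
  exists2 K, inA K & diagonal K (fun y => (t y == 0%N)%:R).
Proof.
move=> AX Xt; pose d J y : C := \prod_(1 <= j < J.+1) (1 - (t y)%:R / j%:R).
have step J : exists2 K, inA K & diagonal K (d J).
  elim: J => [|J [K AK Kd]].
    by exists 1%:M; [apply: inH_1 | move=> y; rewrite mul1mx /d big_geq // scale1r].
  exists (K *m (1%:M - J.+1%:R^-1 *: X)).
    by apply: inH_mul => //; apply: inH_sub; [apply: inH_1 | apply: inH_scale].
  move=> y; rewrite -mulmxA mulmxBl mul1mx -scalemxAl Xt scalerA -{1}[cv y]scale1r -scalerBl.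
  have -> : d J.+1 y = d J y * (1 - (t y)%:R / J.+1%:R) by rewrite /d big_nat_recr.
  by rewrite -scalemxAr Kd scalerA [_^-1 * _]mulrC [RHS in _ = RHS *: _]mulrC.
have [K AK Kd] := step (\max_y t y)%N; exists K => // y; rewrite Kd; congr (_ *: _).
case: eqVneq => [ty|ty]; rewrite /d.
  by rewrite ty big1 // => j _; rewrite mul0r subr0.
have tj : (t y \in index_iota 1 (\max_y t y).+1).
  by rewrite mem_index_iota lt0n ty ltnS leq_bigmax.
rewrite (big_rem _ tj) /= divff ?subrr ?mul0r //.
by rewrite pnatr_eq0.
Qed.

(** The first factor of [theta] is a nonzero cardinality, so vanishing means an unsolvable system,
    that is, a pivot at [m]. *)
Lemma theta_eq0 y m : (theta x v y m == 0%N) = (m \in vtype x v y).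
Proof.
have sY := matrix_form_supported xv y.
rewrite (vtypeE xv) /theta; case: ifP => ym; rewrite muln_eq0.
  rewrite -[RHS]negbK -(solcol_gt0 sY ym) lt0n negbK [X in X || _](_ : _ = false) //.
  apply/eqP/eqP; rewrite -lt0n; apply/card_gt0P; exists 0; rewrite inE.
  by apply/forallP => s; rewrite mxE eqxx.
rewrite -[RHS]negbK -(solrow_gt0 sY (negbT ym)) lt0n negbK [X in X || _](_ : _ = false) //.
apply/eqP/eqP; rewrite -lt0n; apply/card_gt0P; exists 0; rewrite inE.
by apply/forallP => s; rewrite mxE eqxx.
Qed.

Lemma diagonal_theta m : diagonal (R m *m L m + L m *m R m) (fun y => (theta x v y m)%:R).
Proof.
move=> y; rewrite mulmxDl -!mulmxA (RL_eigen xv chiP) (LR_eigen xv chiP) -scalerDl -natrD.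
by case: (loc y m); rewrite ?addn0.
Qed.

Lemma type_projector la : exists2 K, inA K & diagonal K (fun y => (vtype x v y == la)%:R).
Proof.
have step (ms : seq 'I_N) : exists2 K, inA K &
    diagonal K (fun y => (all (fun m => (m \in vtype x v y) == (m \in la)) ms)%:R).
  elim: ms => [|m ms [K AK Kd]].
    by exists 1%:M; [apply: inH_1 | move=> y; rewrite mul1mx scale1r].
  have Am : inA (R m *m L m + L m *m R m).
    by apply: inH_add; apply: inH_mul; try exact: inH_R; exact: inH_L.
  have [J AJ Jd] := kernel_projector Am (diagonal_theta m).
  exists ((if m \in la then J else 1%:M - J) *m K).
    by apply: inH_mul => //; case: ifP => // _; apply: inH_sub => //; apply: inH_1.
  move=> y; rewrite -mulmxA Kd -scalemxAr /= -mulnb natrM -scalerA [RHS]scalerA mulrC -scalerA.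
  congr (_ *: _); have := Jd y; rewrite theta_eq0.
  case: (m \in la) => JE; first by rewrite JE eqb_id.
  by rewrite mulmxBl mul1mx JE; case: (m \in _); rewrite ?scale1r ?scale0r ?subrr ?subr0.
have [K AK Kd] := step (enum 'I_N); exists K => // y; rewrite Kd; congr ((nat_of_bool _)%:R *: _).
apply/allP/eqP => [h|-> //]; apply/setP => m.
by apply/eqP/h; rewrite mem_enum.
Qed.

Section Fixed.
Variables (mu : {ffun 'I_N -> bool}) (la : {set 'I_N}).
Hypothesis muT : forall m, mu m -> m \in la.

Definition selects (e : 'M[C]_nP) : Prop :=
  diagonal e (fun y => ((loc y == mu) && (vtype x v y == la))%:R).

Lemma selects_exists : exists2 e, inA e & selects e.
Proof.
have [K AK Kd] := type_projector la; exists (E mu *m K).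
  by apply: inH_mul => //; apply: inH_E.
by move=> y; rewrite (diagonal_mul (@diagonal_Emx mu) Kd) -natrM mulnb.
Qed.

Variable e : 'M[C]_nP.
Hypothesis eP : selects e.

Lemma selects_fixed_diag X (d : {vspace H} -> C) (c : C) : diagonal X d ->
  (forall y, loc y = mu -> vtype x v y = la -> d y = c) ->
  forall u : V, e *m u = u -> X *m u = c *: u.
Proof.
move=> Xd dc u eu; rewrite -{1}eu mulmxA; have h : forall u : V, X *m e *m u = c *: e *m u.
  apply: chi_mx_eq => y; rewrite -mulmxA -scalemxAl eP -scalemxAr Xd.
  case: andP => [[/eqP ly /eqP ty]|_]; last by rewrite !scale0r scaler0.
  by rewrite (dc y) // !scale1r.
by rewrite h -scalemxAl eu.
Qed.

Lemma selects_idem : e *m e = e.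
Proof.
have h : forall u : V, e *m e *m u = e *m u.
  apply: chi_mx_eq => y; rewrite -mulmxA eP -scalemxAr eP scalerA -natrM mulnb andbb.
  by [].
by apply/matrixP => i j; have /colP/(_ i) := h (delta_mx j 0); rewrite -!colE !mxE.
Qed.

Lemma selects_Emx (u : V) : e *m (E mu *m u) = e *m u.
Proof.
rewrite mulmxA; move: u; apply: chi_mx_eq => y;
  rewrite -mulmxA diagonal_Emx -scalemxAr eP scalerA -natrM mulnb.
by rewrite andbA andbb.
Qed.

Lemma fixed_Emx (u : V) : e *m u = u -> E mu *m u = u.
Proof.
move=> eu; rewrite (selects_fixed_diag (@diagonal_Emx mu) (c := 1)) ?scale1r //.
by move=> y -> _; rewrite eqxx.
Qed.

(** The squared norm of the lowered vector is the pairing of [Rmx m *m (Lmx m *m u)] with [u]. For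
    [m] in [mu] the eigenvalue is 0 because column-fullness puts [m] in [la]; for other [m] the
    product vanishes on the cell. *)
Lemma fixed_Lmx m (u : V) : e *m u = u -> L m *m u = 0.
Proof.
move=> eu; apply: herm_eq0; rewrite herm_adj adjmx_Lmx mulmxA.
rewrite (selects_fixed_diag (d := fun y => (if loc y m then theta x v y m else 0%N)%:R) (c := 0) _ _ eu).
- by rewrite scale0r /herm big1 // => i _; rewrite mxE rmorph0 mul0r.
- by move=> y; rewrite -mulmxA (RL_eigen xv chiP).
- move=> y -> ty; case: ifP => // /muT mla; apply/eqP; rewrite pnatr_eq0 theta_eq0.
  by rewrite ty.
Qed.

(** On the type the eigenvalue is 0; off it, [solrow_card] involves only a corner rank, which
    [rk_diag] computes from [mu] and [la]. *)
Lemma theta_const y y' m : loc y = mu -> vtype x v y = la -> loc y' = mu -> vtype x v y' = la ->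
  ~~ mu m -> theta x v y m = theta x v y' m.
Proof.
have aux z : loc z = mu -> vtype x v z = la -> m \notin la -> ~~ mu m ->
    theta x v z m = (#|(rowsupp mu m : pred 'rV[F]_N)| * #|F| ^ (\rank (Psupp F mu m) -
     (below (fun k => ~~ mu k && (k \in la)) m - below (fun k => mu k && (k \in la)) m)))%N.
  move=> lz tz mla mum; have sZ := matrix_form_supported xv z; rewrite lz in sZ.
  rewrite /theta lz (negPf mum) (solrow_card sZ) //; last by rewrite -(vtypeE xv) tz.
  congr (_ * _ ^ (_ - _))%N; rewrite -(rk_col_Sset sZ) //.
  have := rk_diag sZ (ltnW (ltn_ord m)).
  have -> : below (fun k => mu k && pivot (mf z) k) m = below (fun k => mu k && (k \in la)) m.
    by apply: eq_card => k; rewrite !inE -(vtypeE xv) tz.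
  have -> : below (fun k => ~~ mu k && pivot (mf z) k) m = below (fun k => ~~ mu k && (k \in la)) m.
    by apply: eq_card => k; rewrite !inE -(vtypeE xv) tz.
  by move=> <-; rewrite addnK.
move=> ly ty ly' ty' mum; have [mla|mla] := boolP (m \in la); last by rewrite !aux.
have /eqP -> : theta x v y m == 0%N by rewrite theta_eq0 ty.
by apply/esym/eqP; rewrite theta_eq0 ty'.
Qed.

Lemma fixed_LRmx m : exists c, forall u : V, e *m u = u -> L m *m (R m *m u) = c *: u.
Proof.
have LR : diagonal (L m *m R m) (fun y => (if loc y m then 0%N else theta x v y m)%:R).
  by move=> y; rewrite -mulmxA (LR_eigen xv chiP).
have [mum|mum] := boolP (mu m).
  exists 0 => u eu; rewrite mulmxA (selects_fixed_diag LR (c := 0)) // => y -> _.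
  by rewrite mum.
have [[y0 [l0 t0]]|none] := pselect (exists y, loc y = mu /\ vtype x v y = la); last first.
  exists 0 => u eu; rewrite mulmxA (selects_fixed_diag LR (c := 0)) // => y ly ty.
  by case: none; exists y.
exists (theta x v y0 m)%:R => u eu; rewrite mulmxA (selects_fixed_diag LR (c := (theta x v y0 m)%:R)) //.
by move=> y ly ty; rewrite ly (negPf mum) (theta_const ly ty l0 t0).
Qed.

(* The span of the vectors R_(m_1) ... R_(m_k) w. *)
Inductive raised (w : V) : V -> Prop :=
| raised_base : raised w w
| raised_R m u : raised w u -> raised w (R m *m u)
| raised_scale c u : raised w u -> raised w (c *: u)
| raised_add u u' : raised w u -> raised w u' -> raised w (u + u').

Lemma raised0 w : raised w 0.
Proof. by rewrite -(scale0r w); apply/raised_scale/raised_base. Qed.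

Section Raised.
Variable w : V.
Hypothesis ew : e *m w = w.

Lemma raised_E nu u : raised w u -> raised w (E nu *m u).
Proof.
move=> ru; elim: ru nu => [|m u' _ IH|c u' _ IH|u1 u2 _ IH1 _ IH2] nu.
- rewrite -(fixed_Emx ew) mulmxA EmxM; case: eqP => [->|_]; rewrite ?mul0mx.
    by rewrite (fixed_Emx ew); apply: raised_base.
  exact: raised0.
- rewrite (Emx_Rmx_col xv); case: ifP => _; last exact: raised0.
  by apply: raised_R; apply: IH.
- by rewrite -scalemxAr; apply: raised_scale; apply: IH.
- by rewrite mulmxDr; apply: raised_add; [apply: IH1 | apply: IH2].
Qed.

(** The product moves right through the word: passing a different [R n] costs only the constant of
    [Rmx_qcomm], a repeated [R m] gives 0, and on [w] it is scalar. *)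
Lemma raised_LR m u : raised w u -> raised w (L m *m (R m *m u)).
Proof.
elim=> [|n u' _ IH|c u' _ IH|u1 u2 _ IH1 _ IH2].
- by have [c cE] := fixed_LRmx m; rewrite cE //; apply/raised_scale/raised_base.
- have [<-|mn] := eqVneq m n.
    by rewrite [R m *m (R m *m _)]mulmxA (Rmx_sqr xv) mul0mx mulmx0; apply: raised0.
  have [c RR] := Rmx_qcomm xv C m n.
  rewrite [R m *m (R n *m _)]mulmxA RR -scalemxAl -scalemxAr -mulmxA [L m *m (R n *m _)]mulmxA.
  by rewrite (Lmx_Rmx_comm xv) // -mulmxA; apply/raised_scale/raised_R.
- by rewrite -!scalemxAr; apply: raised_scale.
- by rewrite !mulmxDr; apply: raised_add.
Qed.

Lemma raised_L m u : raised w u -> raised w (L m *m u).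
Proof.
elim=> [|n u' ru IH|c u' _ IH|u1 u2 _ IH1 _ IH2].
- by rewrite fixed_Lmx //; apply: raised0.
- have [<-|mn] := eqVneq m n; first exact: raised_LR.
  by rewrite mulmxA (Lmx_Rmx_comm xv) // -mulmxA; apply: raised_R.
- by rewrite -scalemxAr; apply: raised_scale.
- by rewrite mulmxDr; apply: raised_add.
Qed.

Lemma raised_inH X u : inA X -> raised w u -> raised w (X *m u).
Proof.
move=> AX; elim: AX u => [m|m|nu||a Y _ hY|Y Z _ hY _ hZ|Y Z _ hY _ hZ] u ru.
- exact: raised_L.
- exact: raised_R.
- exact: raised_E.
- by rewrite mul1mx.
- by rewrite -scalemxAl; apply/raised_scale/hY.
- by rewrite mulmxDl; apply: raised_add; [apply: hY | apply: hZ].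
- by rewrite -mulmxA; apply/hY/hZ.
Qed.

(** Each raising operator increases the dimension, so a word of positive length has no component in
    the cell [mu]; only multiples of [w] survive there. *)
Lemma raised_graded u : raised w u ->
  (forall nu, (#|Tset nu| < #|Tset mu|)%N -> E nu *m u = 0) /\ E mu *m u \in <[w]>%VS.
Proof.
elim=> [|m u' _ [IH _]|c u' _ [IH IH']|u1 u2 _ [IH1 IH1'] _ [IH2 IH2']].
- split; last by rewrite fixed_Emx // memv_line.
  move=> nu lt; rewrite -(fixed_Emx ew) mulmxA EmxM; case: eqP => [nuE|_]; last by rewrite mul0mx.
  by rewrite nuE ltnn in lt.
- have low nu : nu m -> (#|Tset (unset nu m)| < #|Tset nu|)%N.
    move=> num; rewrite [X in (_ < X)%N](cardsD1 m) inE num ltnS subset_leq_card //.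
    by apply/subsetP => i; rewrite !inE ffunE; case: (i == m).
  split=> [nu lt|]; rewrite (Emx_Rmx_col xv).
    case: ifP => // /low lt'; rewrite IH ?mulmx0 //.
    exact: ltn_trans lt' lt.
  case: ifP => [/low lt'|_]; last exact: mem0v.
  by rewrite IH // mulmx0 mem0v.
- split=> [nu lt|]; first by rewrite -scalemxAr IH ?scaler0.
  by rewrite -scalemxAr; apply: memvZ.
- split=> [nu lt|]; first by rewrite mulmxDr IH1 ?IH2 ?addr0.
  by rewrite mulmxDr; apply: memvD.
Qed.

Lemma selects_line X : inA X -> e *m (X *m w) \in <[w]>%VS.
Proof.
move=> AX; have [_ /vlineP[k]] := raised_graded (raised_inH AX (raised_base w)).
by rewrite -selects_Emx => ->; rewrite -scalemxAr ew; apply: memvZ; apply: memv_line.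
Qed.

End Raised.
End Fixed.
End Projector.

(** * The multiplicity formula *)

Section Dimension.
Variables (F : finFieldType) (N : nat) (H : vectType F).
Variables (x : 'I_N.+1 -> {vspace H}) (v : N.-tuple H).
Hypothesis xv : adapted_basis x v.
Variables (C : numClosedFieldType) (chi : F -> C).
Hypothesis chiP : nontrivial_additive_character chi.

Implicit Types (mu : {ffun 'I_N -> bool}) (la : {set 'I_N}) (y : {vspace H}).

Notation loc := (location x).
Notation nP := #|{: {vspace H}}|.
Notation V := 'cV[C]_nP.
Notation cv := (chi_vec x v chi).

Lemma coord_cv (i : 'I_nP) y : coord (chi_tuple x v chi) i (cv y) = (i == enum_rank y)%:R.
Proof.
have := nth_chi_tuple x v chi (enum_rank y); rewrite enum_rankK => <-.
by rewrite coord_free ?(basis_free (chi_basis xv chiP)) // eq_sym.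
Qed.

Lemma sum_chi_lines : (\sum_y <[cv y]>)%VS = fullv.
Proof.
apply/eqP; rewrite eqEsubv subvf; apply/subvP => u _.
have [a ->] := chi_expand xv chiP u; apply: memv_sumr => y _.
by rewrite memvZ ?memv_line.
Qed.

Lemma directv_chi_lines : directv (\sum_y <[cv y]>).
Proof.
apply/directv_sum_independent => us usP us0 y _.
have /fin_all_exists[a aE] z : exists c, us z = c *: cv z by apply/vlineP/usP.
have := congr1 (coord (chi_tuple x v chi) (enum_rank y)) us0.
rewrite linear0 linear_sum (bigD1 y) //= aE linearZ /= coord_cv eqxx mulr1 big1 ?addr0.
  by move=> ->; rewrite scale0r.
move=> z zy; rewrite aE linearZ /= coord_cv (inj_eq enum_rank_inj) eq_sym (negPf zy).
by rewrite mulr0.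
Qed.

Lemma cv_neq0 y : cv y != 0.
Proof.
apply/eqP => cy; have := coord_cv (enum_rank y) y; rewrite cy linear0 eqxx => /eqP.
by rewrite eq_sym oner_eq0.
Qed.

Lemma dim_diagonal e (P : pred {vspace H}) : diagonal x v chi e (fun y => (P y)%:R) ->
  \dim (elin e @: fullv) = #|[set y | P y]|.
Proof.
move=> eP; have e_cv y : (elin e @: <[cv y]>)%VS = <[(P y)%:R *: cv y]>%VS.
  by rewrite limg_line elinE eP.
have sub y : (<[(P y)%:R *: cv y]> <= <[cv y]>)%VS by rewrite -memvE memvZ ?memv_line.
have := directv_subfamily sub directv_chi_lines.
rewrite -sum_chi_lines limg_sum (eq_bigr _ (fun y _ => e_cv y)) => /directvP ->.
rewrite /= -[RHS]sum1_card [RHS]big_mkcond /=; apply: eq_bigr => y _; rewrite dim_vline inE.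
by case: (P y); rewrite ?scale1r ?scale0r ?eqxx ?cv_neq0.
Qed.

Lemma vtype_even y : ~~ odd #|vtype x v y|.
Proof.
have sY := matrix_form_supported xv y; have := rk_diag sY (leqnn N).
rewrite rk_colN // add0n; set t := below _ _; set s := below _ _ => ts.
have -> : #|vtype x v y| = (t + s)%N.
  rewrite -(cardsID (Tset (loc y))); congr (_ + _)%N; apply: eq_card => m;
    rewrite !inE (vtypeE xv) ltn_ord.
    by rewrite andbC.
  by [].
by rewrite ts addnn odd_double.
Qed.

(** [K] is 1 on [Vtype la] and 0 on the other summands, which gives the disjointness that [daddv_pi]
    needs. By [vtype_even], each character of another type lies in the complementary sum, so both
    sides agree on the basis. *)
Lemma Eproj_type la K : ~~ odd #|la| -> diagonal x v chi K (fun y => (vtype x v y == la)%:R) ->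
  forall u : V, Eproj x v chi la u = K *m u.
Proof.
move=> evla Kd; pose W := (\sum_(la' : {set 'I_N} | ~~ odd #|la'| && (la' != la)) Vtype x v chi la')%VS.
have VK la' u : u \in Vtype x v chi la' -> K *m u = (la' == la)%:R *: u.
  move=> uV; have /subvP/(_ u uV) : (Vtype x v chi la' <=
      lker (linfun (mulmx K) - (la' == la)%:R *: \1%VF))%VS.
    apply/span_subvP => u' /mapP[y]; rewrite mem_enum inE => /eqP ty ->.
    by apply/eqlfunP; rewrite lfunE scale_lfunE id_lfunE /= Kd ty.
  by move/eqlfunP; rewrite lfunE scale_lfunE id_lfunE.
have WK u : u \in W -> K *m u = 0.
  case/memv_sumP => us usP ->; rewrite mulmx_sumr big1 // => la' Pla'.
  by rewrite (VK _ _ (usP _ Pla')); case/andP: Pla' => _ /negPf ->; rewrite scale0r.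
have cap0 : (Vtype x v chi la :&: W = 0)%VS.
  apply/eqP; rewrite -subv0; apply/subvP => u; rewrite memv_cap memv0 => /andP[/VK uV /WK uW].
  by move: uV; rewrite eqxx scale1r uW => <-.
have cvV y : cv y \in Vtype x v chi (vtype x v y).
  by apply/memv_span/mapP; exists y; rewrite ?mem_enum ?inE.
have E_cv y : Eproj x v chi la (cv y) = K *m cv y.
  rewrite Kd /Eproj -/W; have [ty|ty] := eqVneq (vtype x v y) la.
    by rewrite scale1r daddv_pi_id // -ty.
  have cvW : cv y \in W.
    by apply: (subvP (sumv_sup (vtype x v y) _ (subvv _)) _ (cvV y)); rewrite vtype_even.
  have capC : (W :&: Vtype x v chi la = 0)%VS by rewrite capvC.
  have e := daddv_pi_add cap0 (subvP (addvSr _ _) _ cvW).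
  rewrite (daddv_pi_id capC cvW) in e; rewrite scale0r.
  by apply: (addIr (cv y)); rewrite add0r.
move=> u; have [a ->] := chi_expand xv chiP u; rewrite linear_sum mulmx_sumr.
by apply: eq_bigr => y _; rewrite linearZ /= E_cv scalemxAr.
Qed.

Lemma card_points_pivots mu la :
  #|[set y | (loc y == mu) && (vtype x v y == la)]| =
  #|[set M : 'M[F]_N | supported mu M && [forall m, pivot M m == (m \in la)]]|.
Proof.
rewrite -!sum1dep_card.
have := big_cell xv mu (fun M => if [forall m, pivot M m == (m \in la)] then 1%N else 0%N).
rewrite -!big_mkcondr /= => <-; apply: eq_bigl => y; congr (_ && _).
apply/eqP/forallP => [<- m|h]; first by rewrite (vtypeE xv).
by apply/setP => m; rewrite (vtypeE xv); exact: (eqP (h m)).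
Qed.

End Dimension.

(** * Admissible pairs as lattice paths *)

Section Admissible.
Variables (N : nat) (mu : {ffun 'I_N -> bool}) (la : {set 'I_N}).

Lemma below_nth_smallest (p : {set 'I_N}) k :
  below (fun m => m \in p) k = (\sum_(i < #|p|) (nth_smallest p i < k)%N)%N.
Proof.
rewrite cardE -(size_map val); set s := map _ _.
rewrite -(big_mkord xpredT (fun i => nat_of_bool (nth 0 s i < k)%N)).
rewrite -(big_nth 0%N xpredT (fun a => nat_of_bool (a < k)%N)) big_map big_enum /=.
rewrite /below -sum1dep_card big_mkcond [RHS]big_mkcond /=; apply: eq_bigr => m _.
by case: (m < k)%N; case: (m \in p).
Qed.

Hypothesis adm : admissible mu la.
Hypothesis full : column_full mu la.

Let muT m : mu m -> m \in la.
Proof. by move=> mum; apply: (subsetP full); rewrite inE. Qed.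

Let laT : la :&: Tset mu = Tset mu. Proof. exact/setIidPr. Qed.

Let p (m : 'I_N) := ~~ mu m && (m \in la).

Let belowp k : below p k = below (fun m => m \in la :&: Sset mu) k.
Proof. by apply: eq_card => m; rewrite !inE /p; case: (m < k)%N; case: (mu m);
  case: (m \in la). Qed.

Let belowmu k : below mu k = below (fun m => m \in Tset mu) k.
Proof. by apply: eq_card => m; rewrite !inE. Qed.

Let card_p : #|la :&: Sset mu| = #|Tset mu|.
Proof. by have [n [-> <- _]] := adm; rewrite laT. Qed.

(** Ballot form of admissibility: if the i-th element of [la] in [Tset mu] is below [k], so is the
    i-th one in [Sset mu]. Column-fullness makes the former count all of [mu]. *)
Lemma admissible_walk k : (k <= N)%N -> (below mu k <= below p k)%N.
Proof.
have [n [cS cT lt]] := adm; move=> _; rewrite belowp belowmu !below_nth_smallest.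
rewrite cS -laT cT; apply: leq_sum => i _.
have := lt i (ltn_ord i); case: (ltnP (nth_smallest (la :&: Tset mu) i) k) => //= tk st.
by rewrite (ltn_trans st tk).
Qed.

Lemma below_card (b : 'I_N -> bool) k : (N <= k)%N -> below b k = #|[set m | b m]|.
Proof. by move=> Nk; apply: eq_card => m; rewrite !inE (leq_trans (ltn_ord m)). Qed.

Let card_p' : #|[set m | p m]| = #|Tset mu|.
Proof. by rewrite -card_p; apply: eq_card => m; rewrite !inE /p andbC. Qed.

Lemma admissible_height0 : height mu la N = 0%N.
Proof.
rewrite /height !below_card // -/p card_p' (_ : [set m | mu m] = Tset mu) ?subnn //.
Qed.

Let card_above (b : 'I_N -> bool) k : (#|[set m | b m & (k <= m)%N]| + below b k = #|[set m : 'I_N | b m]|)%N.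
Proof.
rewrite addnC -(cardsID [set m : 'I_N | (m < k)%N] [set m | b m]); congr (_ + _)%N.
  by apply: eq_card => m; rewrite !inE andbC.
by apply: eq_card => m; rewrite !inE -leqNgt andbC.
Qed.

(** The first term of [rho] counts up-steps up to and including [s], whence the extra 1; the second
    counts down-steps from [s] on; half of [la] is all of [Tset mu]. *)
Lemma rho_height s : s \in la :&: Sset mu -> rho s mu la = (height mu la s).+1%:Z.
Proof.
rewrite inE => /andP[sla]; rewrite inE => mus.
have c1 : #|la :&: Sle mu s| = (below p s).+1.
  have -> : (below p s).+1 = below p s.+1 by rewrite belowS /p mus sla addn1.
  apply: eq_card => m; rewrite !inE /p ltnS.
  by case: (m \in la); case: (mu m); case: (m <= s)%N.
have c2 : (#|la :&: Tge mu s| + below mu s = #|Tset mu|)%N.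
  rewrite -(card_above mu s); congr (_ + _)%N; apply: eq_card => m; rewrite !inE.
  by case: (boolP (mu m)) => [/muT ->|]; rewrite ?andbF.
have c3 : #|la| = #|Tset mu|.*2.
  rewrite -(cardsID (Tset mu)) laT -addnn; congr (_ + _)%N; rewrite -card_p.
  by apply: eq_card => m; rewrite !inE andbC.
rewrite /rho c1 c3 doubleK /height -/p; have := admissible_walk (ltnW (ltn_ord s)).
by lia.
Qed.

Lemma card_Bset : #|Bset mu| = (\sum_(s in Sset mu) (#|Tset mu| - below mu s))%N.
Proof.
rewrite -sum1_card (eq_bigl (fun st : 'I_N * 'I_N => (st.1 \in Sset mu) &&
  ((st.2 \in Tset mu) && (st.1 < st.2)%N))); last by move=> st; rewrite !inE.
rewrite -(pair_big_dep (mem (Sset mu)) (fun s t => (t \in Tset mu) && (s < t)%N) (fun _ _ => 1%N)) /=.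
apply: eq_bigr => s; rewrite inE => mus; rewrite sum1dep_card -(card_above mu s) addnK.
apply: eq_card => t; rewrite !inE [X in _ = _ && X]leq_eqVlt val_eqE; case: (eqVneq s t) => [<-|//].
by rewrite (negPf mus).
Qed.

(** Exchange of summation: an index [s] is counted once for each up-step at or after it, and there
    are [#|Tset mu|] up-steps in all. *)
Lemma nstatE : nstat mu (la :&: Sset mu) = (\sum_(s in Sset mu) (#|Tset mu| - below p s))%N.
Proof.
rewrite /nstat (eq_bigr (fun s : 'I_N => \sum_(s' in Sset mu | (s' <= s)%N) 1)%N); last first.
  by move=> s _; rewrite sum1dep_card; apply: eq_card => m; rewrite !inE.
rewrite (exchange_big_dep (mem (Sset mu))) /=; last by move=> s s' _ /andP[].
apply: eq_bigr => s sS; rewrite sum1dep_card -card_p' -(card_above p s) addnK.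
by apply: eq_card => m; move: sS; rewrite !inE /p => ->; case: (mu m); case: (m \in la).
Qed.

(** At each [s], the height is the number of positions of [Bset mu] in row [s] minus the share of
    [s] in [nstat]. This is the origin of the exponent of q. *)
Lemma sum_height : (\sum_(s in Sset mu) height mu la s + nstat mu (la :&: Sset mu) = #|Bset mu|)%N.
Proof.
rewrite card_Bset nstatE -big_split /=; apply: eq_bigr => s _.
have := admissible_walk (ltnW (ltn_ord s)); rewrite /height -/p.
have : (below p s <= #|Tset mu|)%N by rewrite -card_p' -(card_above p s) leq_addl.
by move: (below p s) (below mu s) #|Tset mu| => a b c; lia.
Qed.

Lemma weight_formula (F : finFieldType) : (weight F mu la N)%:R =
  (#|F|%:R : rat) ^ (#|Bset mu|%:Z - (nstat mu (la :&: Sset mu))%:Z)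
  * \prod_(s in la :&: Sset mu) ((#|F|%:R : rat) ^ (rho s mu la) - 1).
Proof.
have q0 : (0 < #|F|)%N by apply/card_gt0P; exists 0.
rewrite -sum_height PoszD addrK -exprnP -natrX expn_sum.
have -> : weight F mu la N = (\prod_(s in Sset mu) (#|F| ^ height mu la s *
    (if s \in la then (#|F| ^ (height mu la s).+1).-1 else 1)))%N.
  by apply: eq_bigl => s; rewrite ltn_ord inE.
rewrite natr_prod; under eq_bigr do rewrite natrM.
rewrite big_split /= [in RHS]natr_prod; congr (_ * _).
rewrite [RHS](eq_bigl (fun s => (s \in Sset mu) && (s \in la))); last by move=> s;
  rewrite inE andbC.
rewrite big_mkcondr /=; apply: eq_bigr => s sS; case: ifP => // sla.
have sin : s \in la :&: Sset mu by rewrite in_setI sla.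
by rewrite (rho_height sin) -exprnP -natrX -subn1 natrB ?expn_gt0 ?q0.
Qed.

Lemma weight_gt0 (F : finFieldType) : (0 < weight F mu la N)%N.
Proof.
have q1 : (1 < #|F|)%N by exact: card_finNzRing_gt1.
rewrite /weight prodn_cond_gt0 // => s _; rewrite muln_gt0 expn_gt0 (ltnW q1) /=.
by case: ifP => // _; rewrite -ltnS prednK ?expn_gt0 ?(ltnW q1) // -{1}(expn0 #|F|) ltn_exp2l.
Qed.

End Admissible.

Theorem theorem11p7 (R : realType) (F : finFieldType) (N : nat)
    (H : vectType F) (x : 'I_N.+1 -> {vspace H}) (v : N.-tuple H)
    (chi : F -> R[i]) :
  (1 <= N)%N ->
  \dim (fullv : {vspace H}) = N ->
  full_flag x ->
  adapted_basis x v ->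
  nontrivial_additive_character chi ->
  forall (mu : {ffun 'I_N -> bool}) (la : {set 'I_N}),
  admissible mu la ->
  column_full mu la ->
  (exists W : {vspace 'cV[R[i]]_#|{: {vspace H}}|},
     Hirreducible x W /\ has_endpoint_shape x v chi W mu la) /\
  (forall W : {vspace 'cV[R[i]]_#|{: {vspace H}}|},
     Hirreducible x W -> has_endpoint_shape x v chi W mu la ->
     exists2 m : nat, is_multiplicity x W m &
       m%:R = (#|F|%:R : rat) ^ (#|Bset mu|%:Z - (nstat mu (la :&: Sset mu))%:Z)
              * \prod_(s in la :&: Sset mu)
                  ((#|F|%:R : rat) ^ (rho s mu la) - 1)).
Proof.
move=> _ _ _ xv chiP mu la adm full.
have muT m : mu m -> m \in la by move=> mum; apply: (subsetP full); rewrite inE.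
pose C : numClosedFieldType := R[i]; pose chi' : F -> C := chi.
have chiP' : nontrivial_additive_character chi' := chiP.
have [e Ae eP] := selects_exists xv chiP' mu la.
have [K AK Kd] := type_projector xv chiP' la.
have e_idem := selects_idem xv chiP' eP.
have e_line X w (AX : inH x X) (ew : e *m w = w) := selects_line xv chiP' muT eP ew AX.
have A1 := inH_1 x C; have AZ := @inH_scale _ _ _ x C; have AD := @inH_add _ _ _ x C.
have AM := @inH_mul _ _ _ x C; have Aadj := @inH_adj _ _ _ x C.
have evla : ~~ odd #|la|.
  have [n [cS cT _]] := adm; rewrite -(cardsID (Tset mu)) cT.
  have -> : #|la :\: Tset mu| = n by rewrite -cS; apply: eq_card => m; rewrite !inE andbC.
  by rewrite addnn odd_double.
(* The idempotent found inside the algebra agrees with the projections in the definition of endpoint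
   and shape, so these conditions concern vectors fixed by [e]. *)
have EK (u : 'cV[C]_#|{: {vspace H}}|) : Emx x C mu *m Eproj x v chi' la u = e *m u.
  rewrite (Eproj_type xv chiP' evla Kd) mulmxA; move: u; apply: (chi_mx_eq xv chiP') => y.
  by rewrite (diagonal_mul (diagonal_Emx xv chiP' mu) Kd) eP -natrM mulnb.
have dimE : \dim (elin e @: fullv) = weight F mu la N.
  rewrite (dim_diagonal xv chiP' eP) (card_points_pivots xv).
  by rewrite (card_pivots F muT (admissible_walk adm full) (admissible_height0 adm full)).
split=> [|W irrW [_ _ [u [w0 [_ wW _]]]]].
  (* The image of [e] is nonzero because [weight] is positive, so some irreducible contains a fixed
     vector, which generates it. *)
  have [|W [w [irrW wW w0 ew]]] := exists_fixed_irred Aadj Ae e_idem.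
    by rewrite dimE weight_gt0.
  exists W; split; first exact: irrW.
  split=> //; exists w; rewrite /= EK ew; split=> //.
  exact: (irred_generated A1 AZ AD AM irrW wW w0).
exists (weight F mu la N); last exact: weight_formula.
rewrite /= EK in w0 wW; split=> [|k D dec].
  exact: (irr_decomp_exists Aadj (fun _ _ w _ => memvf _)).
have ew : e *m (e *m u) = e *m u by rewrite mulmxA e_idem.
by rewrite -dimE -(multiplicity A1 AZ AD AM Ae e_idem e_line dec irrW wW w0 ew).
Qed.
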